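(* Let $(M,H,J)$ be a strictly pseudoconvex CR $3$-manifold such that the dual $\mathscr{K}^*$ of its canonical bundle admits a global cube root. Suppose $u$ is a complex solution of the CR invariant equation $\nabla_1\nabla_1u+iA_{11}u=0$ on weight $(1,1)$ densities. Then there exist trace free sections $s_A{}^B$ of $\mathcal{E}_A{}^B=\mathrm{End}(\mathcal{T})$ ($\mathcal{T}$ the CR standard tractor bundle) with $s_A{}^B\boldsymbol{Z}^A\boldsymbol{Z}_B=iu$ satisfying $$\nabla_1s_A{}^B=u\,\kappa_{10A}{}^B\mod\boldsymbol{Z}_A\boldsymbol{Z}^B,$$ i.e. $\nabla_1s_A{}^B=u\,\kappa_{10A}{}^B+r_1\boldsymbol{Z}_A\boldsymbol{Z}^B$ for some section $r_1$ of $\mathcal{E}_1(-1,-1)$.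
   Context: All objects are smooth. A strictly pseudoconvex CR $3$-manifold $(M,H,J)$: $M$ is an oriented $3$-manifold, $H\subset TM$ a contact distribution, $J:H\to H$ a bundle endomorphism with $J^2=-\mathrm{id}$. $\mathbb{C}\otimes H=T^{1,0}\oplus T^{0,1}$ is the decomposition into $\pm i$ eigenspaces of $J$. $\mathscr{K}=\Lambda^{2,0}=\Lambda^2(\Lambda^{1,0})$ is the canonical bundle, where $\Lambda^{1,0}$ is the annihilator of $T^{0,1}$ in $\mathbb{C}T^*M$. Pseudohermitian calculus. Contact forms $\theta$ are taken with $d\theta(\cdot,J\cdot)$ positive definite on $H$. The Reeb field $T$ satisfies $\theta(T)=1$, $T\lrcorner d\theta=0$. Let $Z_1$ be a local frame of $T^{1,0}$, $Z_{\bar1}=\overline{Z_1}$, and $(\theta,\theta^1,\theta^{\bar1})$ the coframe dual to $(T,Z_1,Z_{\bar1})$; then $d\theta=ih_{1\bar1}\theta^1\wedge\theta^{\bar1}$ with $h_{1\bar1}>0$, $h^{1\bar1}=1/h_{1\bar1}$. The Tanaka--Webster connection $\nabla$ is $\nabla Z_1=\omega_1{}^1\otimes Z_1$, $\nabla Z_{\bar1}=\omega_{\bar1}{}^{\bar1}\otimes Z_{\bar1}$, $\nabla T=0$, where $\omega_{\bar1}{}^{\bar1}=\overline{\omega_1{}^1}$, $d\theta^1=\theta^1\wedge\omega_1{}^1+A^1{}_{\bar1}\theta\wedge\theta^{\bar1}$ and $\omega_1{}^1+\omega_{\bar1}{}^{\bar1}=h^{1\bar1}dh_{1\bar1}$;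 $A^1{}_{\bar1}$ is the torsion. Subscripts $1,\bar1,0$ on $\nabla$ denote components of covariant derivatives along $Z_1,Z_{\bar1},T$ (leftmost derivative taken last). Indices are raised and lowered with $h^{1\bar1},h_{1\bar1}$: $\nabla^1=h^{1\bar1}\nabla_{\bar1}$, $A_{11}=h_{1\bar1}\overline{A^1{}_{\bar1}}$. The scalar curvature $R$ is defined by $d\omega_1{}^1=Rh_{1\bar1}\theta^1\wedge\theta^{\bar1}+(\nabla^1A_{11})\theta^1\wedge\theta-(\nabla^{\bar1}A_{\bar1\bar1})\theta^{\bar1}\wedge\theta$. Set $Q_{11}=-\frac16\nabla_1\nabla_1R-\frac i2RA_{11}+\nabla_0A_{11}+\frac{2i}3\nabla_1\nabla^1A_{11}$, $Y_1=-i\nabla^1Q_{11}$, $T_1=\frac1{12}(\nabla_1R-4i\nabla^1A_{11})$. Densities. $\mathcal{E}(1,0)$ is a fixed cube root of $\mathscr{K}^*$ and $\mathcal{E}(w,w')=\mathcal{E}(1,0)^w\otimes\overline{\mathcal{E}(1,0)}^{w'}$ ($w-w'\in\mathbb{Z}$), so $\mathcal{E}(-3,0)=\mathscr{K}$. Write $\mathcal{E}^1=T^{1,0}$, $\mathcal{E}_1=(T^{1,0})^*$, and append $(w,w')$ for tensoring with $\mathcal{E}(w,w')$. $\nabla$ acts on $\mathscr{K}$ and hence on all $\mathcal{E}(w,w')$. A contact form $\theta$ determines the section $\zeta\otimes\bar\zeta$ of $\mathcal{E}(-3,-3)$ by $\theta\wedge d\theta=i\theta\wedge(T\lrcorner\zeta)\wedge(T\lrcorner\bar\zeta)$;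 $\theta\mapsto|\zeta|^{2/3}$ identifies the annihilator of $H$ with the real part of $\mathcal{E}(-1,-1)$, and dually $\mathbb{C}\otimes TM/H=\mathcal{E}(1,1)$; $\nabla$ respects this. Using the trivialization of $\mathcal{E}(1,1)$ by $\theta$, $u$ becomes a function with $u_{e^\Upsilon\theta}=e^{\Upsilon}u_\theta$, and the equation reads $Z_1Z_1u_\theta-\omega_1{}^1(Z_1)Z_1u_\theta+iA_{11}u_\theta=0$ (independent of $\theta$). Likewise $h_{1\bar1}$ is regarded as a $\theta$-independent section $\boldsymbol{h}_{1\bar1}$ of $\mathcal{E}_{1\bar1}(1,1)$, and $R,A_{11},T_1,Q_{11},Y_1$ become sections of $\mathcal{E}(-1,-1)$, $\mathcal{E}_{11}$, $\mathcal{E}_1(-1,-1)$, $\mathcal{E}_{11}(-1,-1)$, $\mathcal{E}_1(-2,-2)$ respectively. Tractors. The standard tractor bundle $\mathcal{T}=\mathcal{E}^A$ (rank $3$) is, for each $\theta$, identified with $\mathcal{E}(0,1)\oplus\mathcal{E}^1(-1,0)\oplus\mathcal{E}(-1,0)\ni(\sigma,\mu^1,\rho)$, where for $\hat\theta=e^\Upsilon\theta$ the identifications are related by $\hat\sigma=\sigma$, $\hat\mu^1=\mu^1+\Upsilon^1\sigma$, $\hat\rho=\rho-\Upsilon_1\mu^1-\frac12(\Upsilon^1\Upsilon_1-i\Upsilon_0)\sigma$, with $\Upsilon_1=\nabla_1\Upsilon$, $\Upsilon^1=\nabla^1\Upsilon$, $\Upsilon_0=\nabla_0\Upsilon$. The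 tractor metric is the Hermitian metric $h_{A\bar B}$ given by the matrix $\begin{pmatrix} 0 & 0 & 1 \\ 0 & \boldsymbol{h}_{1\bar1} & 0 \\ 1 & 0 & 0 \end{pmatrix}$. The canonical tractor $\boldsymbol{Z}^A$ is the section $(0,0,1)^t$ of $\mathcal{E}^A\otimes\mathcal{E}(1,0)$, and $\boldsymbol{Z}_A=h_{A\bar B}\overline{\boldsymbol{Z}^B}$, so $\boldsymbol{Z}_Av^A=\sigma$ for $v^A=(\sigma,\mu^1,\rho)$. Endomorphisms $s_A{}^B$ act as $v^A\mapsto s_A{}^Bv^A$; thus $s_A{}^B\boldsymbol{Z}^A\boldsymbol{Z}_B$ is the top right matrix entry, and $\boldsymbol{Z}_A\boldsymbol{Z}^B$ is the matrix with single nonzero entry $1$ at bottom left. The $(1,0)$-part of the (CR invariant) tractor connection is $$\nabla_1v^A=\begin{pmatrix} \nabla_1\sigma \\ \nabla_1\mu^1+\rho+\frac14R\sigma \\ \nabla_1\rho-iA_{11}\mu^1-\sigma T_1 \end{pmatrix},$$ extended to $\mathrm{End}(\mathcal{T})$ by the Leibniz rule $(\nabla_1s)v=\nabla_1(sv)-s\nabla_1v$. The tractor curvature component $\kappa_{10A}{}^B$ (a CR invariant section of $\mathcal{E}_1\otimes\mathcal{E}_A{}^B(-1,-1)$) is $$\kappa_{10A}{}^B=\begin{pmatrix} 0 & 0 & 0 \\ 0 & 0 & 0 \\ Y_1 & iQ_{11} & 0 \end{pmatrix}.$$ *)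

(* Defs.v *)
From HB Require Import structures.
From mathcomp Require Import all_boot all_order all_algebra.
From mathcomp Require Import all_classical all_reals all_analysis.
From mathcomp Require Import complex.
From mathcomp Require Import ring.

Set Implicit Arguments.
Unset Strict Implicit.
Unset Printing Implicit Defensive.

Import Order.TTheory GRing.Theory Num.Theory.
Import numFieldNormedType.Exports.

Local Open Scope classical_set_scope.
Local Open Scope complex_scope.
Local Open Scope ring_scope.

Section Smooth.
Variable R : realType.
Implicit Types (V : set 'rV[R]_3) (f : 'rV[R]_3 -> R).

Definition partial (i : 'I_3) f : 'rV[R]_3 -> R :=
  fun x => 'D_(delta_mx 0 i) f x.

Fixpoint Ck (k : nat) V f : Prop :=
  (forall x, V x -> {for x, continuous f}) /\
  (if k is k'.+1 then
     forall i, (forall x, V x -> derivable f x (delta_mx 0 i)) /\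
               Ck k' V (partial i f)
   else True).

Definition Cinfty V f := forall k, Ck k V f.

Lemma eq_Ck k V f g : open V -> (forall x, V x -> f x = g x) ->
  Ck k V f -> Ck k V g.
Proof.
move=> oV.
have nfg (u v : 'rV[R]_3 -> R) x : (forall y, V y -> u y = v y) -> V x ->
    \forall y \near x, u y = v y.
  by move=> uv Vx; apply: filterS (open_nbhs_nbhs (conj oV Vx)).
have cfg (u v : 'rV[R]_3 -> R) : (forall y, V y -> u y = v y) ->
    (forall x, V x -> {for x, continuous u}) ->
    forall x, V x -> {for x, continuous v}.
  move=> uv cu x Vx; rewrite /prop_for /continuous_at -(uv x Vx).
  apply: cvg_trans (cu x Vx); exact: (@near_eq_cvg _ _ (nbhs x) _ _ _ (nfg u v x uv Vx)).
elim: k f g => [|k IH] f g fg [cf Hf]; split=> //; try exact: cfg cf.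
move=> i; have [df Cf] := Hf i; split.
  by move=> x Vx; apply: near_eq_derivable (df x Vx); apply: (nfg f g).
by apply: IH Cf => x Vx; apply: near_eq_derive; apply: (nfg f g).
Qed.

Lemma Ck_opp k V f : open V -> Ck k V f -> Ck k V (fun x => - f x).
Proof.
move=> oV; elim: k f => [|k IH] f [cf Hf]; split=> //.
- by move=> x Vx; apply: continuousN; exact: cf.
- by move=> x Vx; apply: continuousN; exact: cf.
move=> i; have [df Cf] := Hf i; split.
  by move=> x Vx; apply: derivableN; exact: df.
apply: eq_Ck (IH _ Cf) => // x Vx.
by rewrite /partial deriveN//; exact: df.
Qed.

End Smooth.

Section Manifold.
Variable R : realType.

Record chart (M : Type) := Chart {
  dom : set M;
  coord : M -> 'rV[R]_3;
  pt : 'rV[R]_3 -> M }.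

(* A homeomorphism from an open set of M onto an open set of R^3; [pt] is the
   inverse of [coord], and is meaningful on the image of [dom] only. *)
Definition is_chart (M : topologicalType) (phi : chart M) : Prop :=
  [/\ open (dom phi),
      (forall p, dom phi p -> pt phi (coord phi p) = p) &
      forall V, V `<=` dom phi -> (open V <-> open (coord phi @` V))].

Definition transition (M : Type) (phi psi : chart M) (i : 'I_3)
    (x : 'rV[R]_3) : R := coord psi (pt phi x) 0 i.

Record oriented_manifold3 := OrientedManifold3 {
  points :> topologicalType;
  hausdorffM : hausdorff_space points;
  countableM : @second_countable points;
  atlas : set (chart points);
  atlas_chart : forall phi, atlas phi -> is_chart phi;
  atlas_cover : forall p, exists2 phi, atlas phi & dom phi p;
  atlas_smooth : forall phi psi i, atlas phi -> atlas psi ->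
    Cinfty (coord phi @` (dom phi `&` dom psi)) (transition phi psi i);
  atlas_oriented : forall phi psi x, atlas phi -> atlas psi ->
    (coord phi @` (dom phi `&` dom psi)) x ->
    0 < \det (\matrix_(i < 3, j < 3) partial j (transition phi psi i) x) }.

Variable M : oriented_manifold3.
Local Notation C := R[i].
Implicit Types (U V : set M) (f g : M -> C) (p : M).

Definition smooth_on U f : Prop := forall phi, atlas phi ->
  Cinfty (coord phi @` (U `&` dom phi)) (fun x => complex.Re (f (pt phi x))) /\
  Cinfty (coord phi @` (U `&` dom phi)) (fun x => complex.Im (f (pt phi x))).

Definition smooth_at p f : Prop :=
  exists U, [/\ open U, U p & smooth_on U f].

(* Complex tangent vectors at p: C-linear derivations at p of germs of smooth
   complex functions.  They are set to vanish on functions which are not smooth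
   near p, so that two tangent vectors are equal iff they agree on germs. *)
Definition is_tangent p (v : (M -> C) -> C^o) : Prop :=
  [/\ (forall (a : C) f g, smooth_at p f -> smooth_at p g ->
         v (fun q => a * f q + g q) = a * v f + v g),
      (forall f g, smooth_at p f -> smooth_at p g ->
         v (fun q => f q * g q) = v f * g p + f p * v g),
      (forall f g, smooth_at p f -> smooth_at p g ->
         (\forall q \near p, f q = g q) -> v f = v g) &
      (forall f, ~ smooth_at p f -> v f = 0)].

Definition tangent_pred p : {pred ((M -> C) -> C^o)} :=
  fun v => `[< is_tangent p v >].

Fact tangent_submod p : submod_closed (tangent_pred p).
Proof.
split; first by apply/asboolP; split => *; rewrite /= ?mulr0 ?mul0r ?addr0.
move=> a v w /asboolP[v1 v2 v3 v4] /asboolP[w1 w2 w3 w4]; apply/asboolP.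
have E h : (a *: v + w) h = a * v h + w h by [].
split.
- by move=> b f g sf sg; rewrite !E v1// w1//; ring.
- by move=> f g sf sg; rewrite !E v2// w2//; ring.
- by move=> f g sf sg fg; rewrite !E (v3 f g)// (w3 f g).
- by move=> f sf; rewrite E v4// w4// mulr0 addr0.
Qed.

HB.instance Definition _ p :=
  GRing.isSubmodClosed.Build C ((M -> C) -> C^o) (tangent_pred p)
    (tangent_submod p).

Definition CT p := {v : (M -> C) -> C^o | tangent_pred p v}.

HB.instance Definition _ p := SubType.on (CT p).
HB.instance Definition _ p := [Choice of CT p by <:].
HB.instance Definition _ p := [SubChoice_isSubLmodule of CT p by <:].

Lemma smooth_on_conj U f : open U -> smooth_on U f ->
  smooth_on U (fun q => (f q)^*).
Proof.
move=> oU sf phi aphi; have [odom _ ophi] := atlas_chart aphi.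
have oI : open (coord phi @` (U `&` dom phi)).
  by apply/ophi; [move=> x [] | exact: openI].
have [sR sI] := sf _ aphi; split=> k.
  by apply: eq_Ck (sR k) => // x _; case: (f _).
by apply: eq_Ck (Ck_opp oI (sI k)) => // x _; case: (f _).
Qed.

Lemma smooth_at_conj p f : smooth_at p f -> smooth_at p (fun q => (f q)^*).
Proof.
by move=> [U [oU Up sf]]; exists U; split=> //; exact: smooth_on_conj.
Qed.

Fact conj_tangent p (v : CT p) :
  tangent_pred p (fun f => (val v (fun q => (f q)^*))^*).
Proof.
have /asboolP[v1 v2 v3 v4] := valP v; apply/asboolP; split.
- move=> a f g sf sg.
  under eq_fun do rewrite rmorphD rmorphM.
  rewrite v1; [|exact: smooth_at_conj..].
  by rewrite rmorphD rmorphM /= conjCK.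
- move=> f g sf sg.
  under eq_fun do rewrite rmorphM.
  rewrite v2; [|exact: smooth_at_conj..].
  by rewrite rmorphD !rmorphM /= !conjCK.
- move=> f g sf sg fg; congr (_^*).
  apply: v3; [exact: smooth_at_conj..|].
  by apply: filterS fg => q ->.
- move=> f sf; rewrite v4 ?rmorph0// => /smooth_at_conj.
  by under eq_fun do rewrite conjCK.
Qed.

Definition tconj p (v : CT p) : CT p := 
  exist (tangent_pred p) _ (conj_tangent v).

(* Values of [field], [form1] and [form2] are unconstrained outside the open
   set over which smoothness is asserted. *)
Definition field := forall p, CT p.
Definition form1 := forall p, {linear CT p -> C^o}.
Definition form2 := forall p, CT p -> CT p -> C.

Definition app (X : field) f : M -> C := fun p => val (X p) f.

Definition conj_field (X : field) : field := fun p => tconj (X p).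

Definition smooth_field U (X : field) : Prop := forall V f,
  open V -> V `<=` U -> smooth_on V f -> smooth_on V (app X f).

(* The default value 0 is only taken where X or Y is not smooth. *)
Definition bracket (X Y : field) : field := fun p => insubd (0 : CT p)
  (fun f => if `[< smooth_at p f >]
            then val (X p) (app Y f) - val (Y p) (app X f) else 0).

Definition contract (a : form1) (X : field) : M -> C := fun p => a p (X p).

Definition smooth_form1 U (a : form1) : Prop := forall V X,
  open V -> V `<=` U -> smooth_field V X -> smooth_on V (contract a X).

Definition smooth_form2 U (w : form2) : Prop := forall V X Y,
  open V -> V `<=` U -> smooth_field V X -> smooth_field V Y ->
  smooth_on V (fun p => w p (X p) (Y p)).

(* (d a)(X, Y) for smooth fields X and Y *)
Definition d1 (a : form1) (X Y : field) : M -> C := fun p =>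
  val (X p) (contract a Y) - val (Y p) (contract a X) - a p (bracket X Y p).

(* d a = w over U *)
Definition d1_eq U (a : form1) (w : form2) : Prop := forall V X Y,
  open V -> V `<=` U -> smooth_field V X -> smooth_field V Y ->
  forall p, V p -> d1 a X Y p = w p (X p) (Y p).

Definition conj_form p (a : CT p -> C) : CT p -> C := fun v => (a (tconj v))^*.

Definition wedge11 p (a b : CT p -> C) : CT p -> CT p -> C :=
  fun v w => a v * b w - a w * b v.

Definition wedge12 p (a : CT p -> C) (b : CT p -> CT p -> C) :
    CT p -> CT p -> CT p -> C :=
  fun v w x => a v * b w x + a w * b x v + a x * b v w.

(* Contact forms th with kernel H and d th (., J .) positive definite on H *)
Definition contact_form (H : forall p, set (CT p))
    (J : forall p, CT p -> CT p) U (th : form1) : Prop :=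
  [/\ smooth_form1 U th,
      (forall p v, U p -> th p (tconj v) = (th p v)^*),
      (forall p v, U p -> tconj v = v -> (th p v = 0 <-> H p v)) &
      (forall V X, open V -> V `<=` U ->
         smooth_field V X -> smooth_field V (fun p => J p (X p)) ->
         (forall p, V p -> H p (X p)) ->
         forall p, V p -> X p != 0 -> 0 < d1 th X (fun q => J q (X q)) p)].

(* Strictly pseudoconvex CR structures.  By [H_frame], H is a smooth real
   distribution of rank 2 and J is smooth; by [H_contact], H is a contact
   distribution.  J is unconstrained outside H. *)
Record CRstructure := CRStructure {
  Hd : forall p, set (CT p);
  Jd : forall p, CT p -> CT p;
  H_real : forall p (v : CT p), Hd v -> tconj v = v;
  H_zero : forall p, Hd (0 : CT p);
  H_lin : forall p (a : R) (v w : CT p), Hd v -> Hd w -> Hd (a%:C *: v + w);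
  J_H : forall p (v : CT p), Hd v -> Hd (Jd v);
  J_lin : forall p (a : R) (v w : CT p), Hd v -> Hd w ->
    Jd (a%:C *: v + w) = a%:C *: Jd v + Jd w;
  J_sq : forall p (v : CT p), Hd v -> Jd (Jd v) = - v;
  H_frame : forall p, exists U (X : field),
    [/\ open U /\ U p, smooth_field U X, smooth_field U (fun q => Jd (X q)),
        (forall q, U q -> Hd (X q) /\ X q != 0) &
        (forall q (v : CT q), U q -> Hd v ->
           exists a b : R, v = a%:C *: X q + b%:C *: Jd (X q))];
  H_contact : forall p, exists U (th : form1),
    [/\ open U, U p & contact_form Hd Jd U th] }.

Section CR.
Variable S : CRstructure.

(* The eigenspaces of the C-linear extension of J to the complexification
   of H *)
Definition T10 p (v : CT p) : Prop := exists X Y : CT p,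
  [/\ Hd S X, Hd S Y, v = X + 'i *: Y & Jd S X + 'i *: Jd S Y = 'i *: v].

Definition T01 p (v : CT p) : Prop := exists X Y : CT p,
  [/\ Hd S X, Hd S Y, v = X + 'i *: Y & Jd S X + 'i *: Jd S Y = - 'i *: v].

(* Fibres of the canonical bundle; every element is decomposable, since the
   annihilator of T^{0,1} has rank 2. *)
Definition canonical p (w : CT p -> CT p -> C) : Prop :=
  exists a b : {linear CT p -> C^o},
    (forall v, T01 v -> a v = 0 /\ b v = 0) /\ w = wedge11 a b.

(* Cube roots of the dual of the canonical bundle: a complex line bundle
   E(1,0), given by its fibres and its smooth local sections, with a smooth
   isomorphism from its cube onto the dual of the canonical bundle, given by
   the pairing [cube x w] of x (x) x (x) x with w. *)
Record cube_root := CubeRoot {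
  E10 : M -> lmodType C;
  smooth_sec : set M -> (forall p, E10 p) -> Prop;
  E10_line : forall p,
    exists2 x : E10 p, x != 0 & forall y, exists a, y = a *: x;
  sec_local : forall U x, open U ->
    (smooth_sec U x <-> forall p, U p -> exists V,
       [/\ open V, V p, V `<=` U & smooth_sec V x]);
  sec_frame : forall p, exists U x,
    [/\ open U, U p, smooth_sec U x & forall q, U q -> x q != 0];
  sec_smooth : forall U x y, open U -> smooth_sec U x ->
    (forall q, U q -> x q != 0) ->
    (smooth_sec U y <->
       exists2 f, smooth_on U f & forall q, U q -> y q = f q *: x q);
  cube : forall p, E10 p -> (CT p -> CT p -> C) -> C;
  cube_lin : forall p (x : E10 p) (a : C) (w w' : CT p -> CT p -> C),
    canonical w -> canonical w' ->
    cube x (fun v v' => a * w v v' + w' v v') = a * cube x w + cube x w';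
  cube_hom : forall p (x : E10 p) (a : C) (w : CT p -> CT p -> C),
    canonical w -> cube (a *: x) w = a ^+ 3 * cube x w;
  cube_iso : forall p (x : E10 p), x != 0 ->
    exists2 w, canonical w & cube x w != 0;
  cube_smooth : forall U x (w : form2), open U -> smooth_sec U x ->
    smooth_form2 U w -> (forall p, U p -> canonical (w p)) ->
    smooth_on U (fun p => cube (x p) (w p)) }.

(* A contact form [th] over an open set [dm], its Reeb field [Tf], a frame [Z1]
   of T^{1,0}, the coframe (th, th1, conj th1) dual to (Tf, Z1, conj Z1), the
   Levi form [h], the connection form [om] = omega_1^1 and the torsion
   [tors] = A^1_{bar 1} *)
Record psh_frame := PshFrame {
  dm : set M;
  dm_open : open dm;
  th : form1;
  th_contact : contact_form (Hd S) (Jd S) dm th;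
  Tf : field;
  Tf_smooth : smooth_field dm Tf;
  Tf_real : forall p, dm p -> tconj (Tf p) = Tf p;
  Tf_th : forall p, dm p -> th p (Tf p) = 1;
  Tf_dth : forall V X, open V -> V `<=` dm -> smooth_field V X ->
    forall p, V p -> d1 th Tf X p = 0;
  Z1 : field;
  Z1_smooth : smooth_field dm Z1;
  Z1_T10 : forall p, dm p -> T10 (Z1 p) /\ Z1 p != 0;
  th1 : form1;
  th1_smooth : smooth_form1 dm th1;
  th1_dual : forall p, dm p ->
    [/\ th1 p (Z1 p) = 1, th1 p (tconj (Z1 p)) = 0 & th1 p (Tf p) = 0];
  h : M -> C;
  h_smooth : smooth_on dm h;
  h_gt0 : forall p, dm p -> 0 < h p;
  th_eq : d1_eq dm th
    (fun p v w => 'i * h p * wedge11 (th1 p) (conj_form (th1 p)) v w);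
  om : form1;
  om_smooth : smooth_form1 dm om;
  tors : M -> C;
  tors_smooth : smooth_on dm tors;
  th1_eq : d1_eq dm th1
    (fun p v w => wedge11 (th1 p) (om p) v w
                  + tors p * wedge11 (th p) (conj_form (th1 p)) v w);
  om_eq : forall p v, dm p ->
    om p v + conj_form (om p) v = (h p)^-1 * val v h }.

Section PshCalculus.
Variable F : psh_frame.

Definition Z1b : field := conj_field (Z1 F).

(* Derivative along X of the component of a tensor with k lower indices 1
   (- k upper ones if k < 0) *)
Definition nabt (k : int) (X : field) f : M -> C := fun p =>
  val (X p) f - k%:~R * om F p (X p) * f p.

(* nabla^1 on tensors with k lower indices 1; the result has k - 1. *)
Definition nabt_up (k : int) f : M -> C := fun p => (h F p)^-1 * nabt k Z1b f p.

Definition A11 : M -> C := fun p => h F p * (tors F p)^*.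

Definition divA : M -> C := nabt_up 2 A11.

End PshCalculus.

Section Tractors.
Variable L : cube_root.

(* [Rs] is the scalar curvature.  The frame [ed] of E(1,0) is such that
   zeta = ed^{-3} is normalized by th; thus th = |zeta|^{2/3} is identified
   with ed^{-1} (x) conj ed^{-1}, and components of sections of E(w,w) in this
   frame are those in the trivialization by th. *)
Record frame := Frame {
  psh :> psh_frame;
  Rs : M -> C;
  Rs_smooth : smooth_on (dm psh) Rs;
  Rs_eq : d1_eq (dm psh) (om psh)
    (fun p v w =>
       Rs p * h psh p * wedge11 (th1 psh p) (conj_form (th1 psh p)) v w
       + divA psh p * wedge11 (th1 psh p) (th psh p) v w
       - (divA psh p)^* * wedge11 (conj_form (th1 psh p)) (th psh p) v w);
  ed : forall p, E10 L p;
  ed_smooth : smooth_sec (dm psh) ed;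
  zeta : form2;
  zeta_canonical : forall p, dm psh p -> canonical (@zeta p);
  zeta_ed : forall p, dm psh p -> cube (ed p) (@zeta p) = 1;
  (* th /\ d th = i th /\ (T _| zeta) /\ (T _| conj zeta) *)
  zeta_th : forall V (X Y W : field), open V -> V `<=` dm psh ->
    smooth_field V X -> smooth_field V Y -> smooth_field V W ->
    forall p, V p ->
      th psh p (X p) * d1 (th psh) Y W p + th psh p (Y p) * d1 (th psh) W X p
        + th psh p (W p) * d1 (th psh) X Y p
      = 'i * wedge12 (th psh p)
               (wedge11 (zeta (Tf psh p)) (conj_form (zeta (Tf psh p))))
               (X p) (Y p) (W p) }.

Section Calculus.
Variable F : frame.

Definition zetaTZ : M -> C := fun p => zeta F (Tf F p) (Z1 F p).

(* nabla ed = conn (x) ed: as zeta = zetaTZ th /\ th1 and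
   nabla (th /\ th1) = - om (x) (th /\ th1), nabla zeta = - 3 conn (x) zeta
   gives - 3 conn = zetaTZ^{-1} d zetaTZ - om. *)
Definition conn p (v : CT p) : C :=
  (om F p v - (zetaTZ p)^-1 * val v zetaTZ) / 3%:R.

(* Derivative along X of the component of a section of E_{1...1}(w,w'), with k
   lower indices 1 (- k upper ones if k < 0) *)
Definition nab (k w w' : int) (X : field) f : M -> C := fun p =>
  nabt F k X f p
  + (w%:~R * conn (X p) + w'%:~R * conj_form (@conn p) (X p)) * f p.

Definition Q11 : M -> C := fun p =>
  - 6%:R^-1 * nabt F 1 (Z1 F) (nabt F 0 (Z1 F) (Rs F)) p
  - 'i / 2%:R * Rs F p * A11 F p
  + nabt F 2 (Tf F) (A11 F) p
  + 2%:R * 'i / 3%:R * nabt F 1 (Z1 F) (divA F) p.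

Definition Y1 : M -> C := fun p => - 'i * nabt_up F 2 Q11 p.

Definition T1 : M -> C := fun p =>
  12%:R^-1 * (nabt F 0 (Z1 F) (Rs F) p - 4%:R * 'i * divA F p).

End Calculus.

(* Sections of E_{1...1}(w,w') over M, with k lower indices 1, as compatible
   families of components in all local frames *)
Definition density (k w w' : int) (x : frame -> M -> C) : Prop :=
  (forall F : frame, smooth_on (dm F) (x F)) /\
  (forall (F F' : frame) p (nu la : C), dm F p -> dm F' p ->
     Z1 F' p = nu *: Z1 F p -> ed F' p = la *: ed F p ->
     x F' p = nu ^ k * la ^ (- w) * la^* ^ (- w') * x F p).

Definition mx3 (rows : seq (seq C)) : 'M[C]_3 :=
  \matrix_(i < 3, j < 3) nth 0 (nth [::] rows i) j.

Definition cv3 (col : seq C) : 'cV[C]_3 := \col_(i < 3) nth 0 col i.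

(* th F' = exp(Upsilon) th F, and [Ups F F' X] is X Upsilon, computed as
   exp(Upsilon)^{-1} X (exp(Upsilon)). *)
Definition expUps (F F' : frame) : M -> C := contract (th F') (Tf F).
Definition Ups (F F' : frame) (X : field) : M -> C := fun p =>
  (expUps F F' p)^-1 * val (X p) (expUps F F').

(* Change of the components (sigma, mu^1, rho) of a tractor from F to F': first
   the change of splitting from th F to th F', then the change of frames of
   E(0,1), E^1(-1,0) and E(-1,0), where Z1 F' = nu Z1 F and ed F' = la ed F *)
Definition tractor_change (F F' : frame) (nu la : C) p : 'M[C]_3 :=
  let ups1 := Ups F F' (Z1 F) p in
  let ups1up := (h F p)^-1 * Ups F F' (Z1b F) p in
  let ups0 := Ups F F' (Tf F) p in
  mx3 [:: [:: (la^*)^-1; 0; 0]; [:: 0; nu^-1 * la; 0]; [:: 0; 0; la]]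
  *m mx3 [:: [:: 1; 0; 0];
             [:: ups1up; 1; 0];
             [:: - ((ups1up * ups1 - 'i * ups0) / 2%:R); - ups1; 1]].

(* Sections of End(T) over M *)
Definition end_section (s : frame -> M -> 'M[C]_3) : Prop :=
  (forall (F : frame) i j, smooth_on (dm F) (fun p => s F p i j)) /\
  (forall (F F' : frame) p (nu la : C), dm F p -> dm F' p ->
     Z1 F' p = nu *: Z1 F p -> ed F' p = la *: ed F p ->
     s F' p *m tractor_change F F' nu la p =
     tractor_change F F' nu la p *m s F p).

Definition tractor_metric (F : frame) p : 'M[C]_3 :=
  mx3 [:: [:: 0; 0; 1]; [:: 0; h F p; 0]; [:: 1; 0; 0]].

(* The canonical tractor Z^A, and Z_A = h_{A bar B} conj(Z^B) *)
Definition Zup : 'cV[C]_3 := cv3 [:: 0; 0; 1].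
Definition Zdown (F : frame) p : 'rV[C]_3 :=
  (tractor_metric F p *m map_mx Num.conj Zup)^T.

Definition kappa10 (F : frame) p : 'M[C]_3 :=
  mx3 [:: [:: 0; 0; 0]; [:: 0; 0; 0]; [:: Y1 F p; 'i * Q11 F p; 0]].

Definition nabla1 (F : frame) (v : M -> 'cV[C]_3) : M -> 'cV[C]_3 := fun p =>
  let sigma := fun q => v q (inord 0) 0 in
  let mu := fun q => v q (inord 1) 0 in
  let rho := fun q => v q (inord 2) 0 in
  cv3 [:: nab F 0 0 1 (Z1 F) sigma p;
          nab F (-1) (-1) 0 (Z1 F) mu p + rho p + Rs F p / 4%:R * sigma p;
          nab F 0 (-1) 0 (Z1 F) rho p - 'i * A11 F p * mu p
            - sigma p * T1 F p].

(* nabla_1 s = t over the domain of F, with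
   (nabla_1 s) v = nabla_1 (s v) - s (nabla_1 v) *)
Definition nabla1_end_eq (F : frame) (s t : M -> 'M[C]_3) : Prop :=
  forall V (v : M -> 'cV[C]_3), open V -> V `<=` dm F ->
    (forall i, smooth_on V (fun p => v p i 0)) ->
    forall p, V p ->
      nabla1 F (fun q => s q *m v q) p - s p *m nabla1 F v p = t p *m v p.

End Tractors.
End CR.
End Manifold.

(* Main.v *)
(** The section is s = i m with m_02 = u, and its other entries are found one after
    the other by requiring that s be trace free and that the entries 02, 12, 22, 10
    of nabla_1 s and 02, 01, 00 of nabla_{bar 1} s vanish.  The remaining entries of
    the equation for nabla_1 s then follow from the commutation relations and from
    the equation on u, and the entry 20 defines r_1.

    With the frame Z = Z_1, Y = h^{-1} Z_{bar 1}, -iT, the structure equations, the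
    curvature and, up to constant factors, the entries of m become integral
    polynomials in derivatives of functions, in which i, h and complex conjugation
    do not occur.  Hence everything is checked in an arbitrary commutative ring with
    three derivations.  Under a change of contact form and frame, each component is
    multiplied by a weight and its derivatives become those of a twisted connection,
    so that independence of the choices is a polynomial identity in the derivatives
    of Upsilon; it is applied to the ring of smooth functions on the intersection of
    the domains of two frames. *)

Require Import Defs.
From HB Require Import structures.
From mathcomp Require Import all_boot all_order all_algebra.
From mathcomp Require Import all_classical all_reals all_analysis.
From mathcomp Require Import complex ring.

Set Implicit Arguments.
Unset Strict Implicit.
Unset Printing Implicit Defensive.

Import Order.TTheory GRing.Theory Num.Theory.
Import numFieldNormedType.Exports.

Local Open Scope classical_set_scope.
Local Open Scope complex_scope.
Local Open Scope ring_scope.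

Local Notation contract := Defs.contract.

(** * The calculus of a pseudohermitian structure, over an abstract ring *)

(** Only one of two conjugate equations is imposed on u: D1 D1 u can be eliminated, second
    derivatives along Y cannot. The conditions on nabla_{bar 1} s therefore only fix entries.

    The obstacle is independence of the frame. Entry 20 has order four in u and r_1 order five, and
    r_1 too has to be a section. To avoid expanding such jets in the laws of the lower left entries
    and of r_1, the nine entries are kept as unknowns there: D1 of each entry other than 20 is an
    expression in the entries, so the transformed derivatives follow from a first-order system.

    Two contact forms are compared through their ratio e^Upsilon only, and the ring contains no
    logarithm. The derivatives of Upsilon are logarithmic derivatives, and their commutation
    relations come from those applied to e^Upsilon. With the chosen normalizations, 6 is the only
    number inverted in the abstract argument.

    The link between Upsilon and the frames of E(1,0) is the normalization of zeta = ed^{-3}: it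
    fixes ed in modulus, so that ed' = la ed forces |la|^2 = e^{-Upsilon}. *)

Definition derivation (K : pzRingType) (d : K -> K) : Prop :=
  (forall f g, d (f + g) = d f + d g) /\
  (forall f g, d (f * g) = d f * g + f * d g).

Section Derivation.
Variables (K : pzRingType) (d : K -> K).
Hypothesis dd : derivation d.

Lemma derD f g : d (f + g) = d f + d g. Proof. exact: dd.1. Qed.
Lemma derM f g : d (f * g) = d f * g + f * d g. Proof. exact: dd.2. Qed.
Lemma der0 : d 0 = 0.
Proof. by apply: (addrI (d 0)); rewrite -derD !addr0. Qed.
Lemma derN f : d (- f) = - d f.
Proof. by apply: (addrI (d f)); rewrite -derD !subrr der0. Qed.
Lemma der1 : d 1 = 0.
Proof.
by have := derM 1 1; rewrite !mulr1 mul1r => /(congr1 (+%R^~ (- d 1))); rewrite subrr addrK.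
Qed.
Lemma der_nat n : d n%:R = 0.
Proof. by elim: n => [|n IH]; rewrite ?der0// -natr1 derD der1 IH addr0. Qed.

End Derivation.

(* Derivatives along Z = Z_1, Y = h^{-1} Z_{bar 1} and -iT, and the values wZ, wY,
   wT of omega_1^1 on them; R = 12 sc, i A_11 = 3 al and the conjugate of i A_11,
   with both indices raised, is 3 be.  The factors make the formulas integral. *)
Record calculus (K : comPzRingType) := Calculus {
  dZ : K -> K; dY : K -> K; dT : K -> K;
  wZ : K; wY : K; wT : K; sc : K; al : K; be : K;
  dZ_der : derivation dZ; dY_der : derivation dY; dT_der : derivation dT;
  comm_ZY : forall f, dZ (dY f) = dY (dZ f) + dT f - wY * dZ f - wZ * dY f;
  comm_ZT : forall f, dZ (dT f) = dT (dZ f) - wT * dZ f - 3 * al * dY f;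
  comm_YT : forall f, dY (dT f) = dT (dY f) + wT * dY f + 3 * be * dZ f;
  curv_ZY : dZ wY = dY wZ + wT - 2 * wZ * wY + 12 * sc;
  curv_ZT : dZ wT = dT wZ - wT * wZ + 3 * al * wY - 3 * dY al;
  curv_YT : dY wT = dT wY + wT * wY - 3 * dZ be - 3 * wZ * be }.

Section Calculus.
Variables (K : comPzRingType) (c : calculus K).
Implicit Types (k : int) (f g : K).

(* nabla_1, nabla^1 and -i nabla_0 on components with k lower indices 1 *)
Definition D1 k f := dZ c f - k%:~R * wZ c * f.
Definition Du k f := dY c f - k%:~R * wY c * f.
Definition D0 k f := dT c f - k%:~R * wT c * f.

Lemma D1_def k f : D1 k f = dZ c f - k%:~R * wZ c * f. Proof. by []. Qed.

Let dz := dZ_der c.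
Let dy := dY_der c.
Let dt := dT_der c.

Lemma D1D k f g : D1 k (f + g) = D1 k f + D1 k g.
Proof. by rewrite /D1 (derD dz); ring. Qed.
Lemma DuD k f g : Du k (f + g) = Du k f + Du k g.
Proof. by rewrite /Du (derD dy); ring. Qed.
Lemma D0D k f g : D0 k (f + g) = D0 k f + D0 k g.
Proof. by rewrite /D0 (derD dt); ring. Qed.
Lemma D1N k f : D1 k (- f) = - D1 k f.
Proof. by rewrite /D1 (derN dz); ring. Qed.
Lemma DuN k f : Du k (- f) = - Du k f.
Proof. by rewrite /Du (derN dy); ring. Qed.
Lemma D0N k f : D0 k (- f) = - D0 k f.
Proof. by rewrite /D0 (derN dt); ring. Qed.
Lemma D1M k1 k2 k f g : k = k1 + k2 -> D1 k (f * g) = D1 k1 f * g + f * D1 k2 g.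
Proof. by move->; rewrite /D1 (derM dz) intrD; ring. Qed.
Lemma DuM k1 k2 k f g : k = k1 + k2 -> Du k (f * g) = Du k1 f * g + f * Du k2 g.
Proof. by move->; rewrite /Du (derM dy) intrD; ring. Qed.
Lemma D0M k1 k2 k f g : k = k1 + k2 -> D0 k (f * g) = D0 k1 f * g + f * D0 k2 g.
Proof. by move->; rewrite /D0 (derM dt) intrD; ring. Qed.
Lemma D1_nat k n f : D1 k (n%:R * f) = n%:R * D1 k f.
Proof. by rewrite /D1 (derM dz) (der_nat dz); ring. Qed.
Lemma Du_nat k n f : Du k (n%:R * f) = n%:R * Du k f.
Proof. by rewrite /Du (derM dy) (der_nat dy); ring. Qed.
Lemma D0_nat k n f : D0 k (n%:R * f) = n%:R * D0 k f.
Proof. by rewrite /D0 (derM dt) (der_nat dt); ring. Qed.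

Lemma der_int d k : derivation d -> d k%:~R = 0 :> K.
Proof.
by move=> dd; case: k => n; rewrite ?NegzE ?mulrNz ?(derN dd) -?pmulrn (der_nat dd) ?oppr0.
Qed.

Lemma D1_int k n f : D1 k (n%:~R * f) = n%:~R * D1 k f.
Proof. by rewrite /D1 (derM dz) (der_int _ dz); ring. Qed.
Lemma Du_int k n f : Du k (n%:~R * f) = n%:~R * Du k f.
Proof. by rewrite /Du (derM dy) (der_int _ dy); ring. Qed.
Lemma D0_int k n f : D0 k (n%:~R * f) = n%:~R * D0 k f.
Proof. by rewrite /D0 (derM dt) (der_int _ dt); ring. Qed.

(** The new weights are separate variables tied by equations, so that rewriting leaves integer
    literals rather than sums such as k - 1. *)
Lemma D1_Du k k1 k2 f : k1 = k - 1 -> k2 = k + 1 ->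
  D1 k1 (Du k f) = Du k2 (D1 k f) + D0 k f - 12 * (k%:~R * (sc c * f)).
Proof.
move=> -> ->.
rewrite /D1 /Du /D0 !(derD dz, derN dz, derM dz, derD dy, derN dy, derM dy).
rewrite (der_int _ dz) (der_int _ dy) comm_ZY curv_ZY !intrD !mulrNz; ring.
Qed.

Lemma D1_D0 k k1 f : k1 = k + 1 ->
  D1 k (D0 k f) = D0 k1 (D1 k f) - 3 * (al c * Du k f) + 3 * (k%:~R * (Du 2%Z (al c) * f)).
Proof.
move=> ->.
rewrite /D1 /Du /D0 !(derD dz, derN dz, derM dz, derD dt, derN dt, derM dt).
rewrite (der_int _ dz) (der_int _ dt) comm_ZT curv_ZT !intrD; ring.
Qed.

Lemma D0_Du k k1 f : k1 = k - 1 ->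
  D0 k1 (Du k f) = Du k (D0 k f) - 3 * (be c * D1 k f) - 3 * (k%:~R * (D1 (-2)%Z (be c) * f)).
Proof.
move=> ->.
rewrite /D1 /Du /D0 !(derD dy, derN dy, derM dy, derD dt, derN dt, derM dt).
rewrite (der_int _ dy) (der_int _ dt) comm_YT curv_YT !intrD; ring.
Qed.

(* A mark recording that f is a component with k lower indices, from which the
   tactics below choose the weights in the Leibniz rule. *)
Definition has_weight (k : int) (f : K) := True.
End Calculus.

(** Weights are reduced to literals, so that equal derivatives coincide syntactically and become one
    atom for [ring]. All summands of a component have the same weight, hence only the first is
    inspected. *)
Ltac weight_of e := lazymatch e with
  | ?f * ?g => let k := weight_of f in let l := weight_of g in
               eval vm_compute in (intZmod.addz k l)
  | ?f + ?g => weight_of f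
  | - ?f => weight_of f
  | D1 _ ?k _ => eval vm_compute in (intZmod.addz k (Posz 1))
  | Du _ ?k _ => eval vm_compute in (intZmod.addz k (Negz 0))
  | D0 _ ?k _ => k
  | sc _ => constr:(Posz 0)
  | al _ => constr:(Posz 2)
  | be _ => constr:(Negz 1)
  | _%:R => constr:(Posz 0)
  | _%:~R => constr:(Posz 0)
  | 1 => constr:(Posz 0)
  | _ => match goal with H : has_weight ?k e |- _ => k end
  end.

Ltac isub k l := eval vm_compute in (intZmod.addz k (intZmod.oppz l)).
Ltac iadd k l := eval vm_compute in (intZmod.addz k l).

(* Expands derivatives of sums and products and reorders iterated derivatives to
   Du ... Du D0 ... D0 D1 ... D1. *)
Ltac jet1 := match goal with
  | |- context [D1 ?c ?k (?n%:~R * ?f)] => rewrite (D1_int c k n f)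
  | |- context [Du ?c ?k (?n%:~R * ?f)] => rewrite (Du_int c k n f)
  | |- context [D0 ?c ?k (?n%:~R * ?f)] => rewrite (D0_int c k n f)
  | |- context [D1 ?c ?k (?f + ?g)] => rewrite (D1D c k f g)
  | |- context [D1 ?c ?k (- ?f)] => rewrite (D1N c k f)
  | |- context [Du ?c ?k (?f + ?g)] => rewrite (DuD c k f g)
  | |- context [Du ?c ?k (- ?f)] => rewrite (DuN c k f)
  | |- context [D0 ?c ?k (?f + ?g)] => rewrite (D0D c k f g)
  | |- context [D0 ?c ?k (- ?f)] => rewrite (D0N c k f)
  | |- context [D1 ?c ?k (?n%:R * ?f)] => rewrite (@D1_nat _ c k n f)
  | |- context [Du ?c ?k (?n%:R * ?f)] => rewrite (@Du_nat _ c k n f)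
  | |- context [D0 ?c ?k (?n%:R * ?f)] => rewrite (@D0_nat _ c k n f)
  | |- context [D1 ?c ?k (?f * ?g)] => let k1 := weight_of f in let k2 := isub k k1 in
      rewrite (@D1M _ c k1 k2 k f g erefl)
  | |- context [Du ?c ?k (?f * ?g)] => let k1 := weight_of f in let k2 := isub k k1 in
      rewrite (@DuM _ c k1 k2 k f g erefl)
  | |- context [D0 ?c ?k (?f * ?g)] => let k1 := weight_of f in let k2 := isub k k1 in
      rewrite (@D0M _ c k1 k2 k f g erefl)
  | |- context [D1 ?c ?k1 (Du ?c ?k ?f)] => let k2 := iadd k (Posz 1) in
      rewrite (@D1_Du _ c k k1 k2 f erefl erefl)
  | |- context [D1 ?c ?k (D0 ?c ?k ?f)] => let k2 := iadd k (Posz 1) in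
      rewrite (@D1_D0 _ c k k2 f erefl)
  | |- context [D0 ?c ?k1 (Du ?c ?k ?f)] => rewrite (@D0_Du _ c k k1 f erefl)
  end.

Ltac jet_eq := repeat jet1; ring.

(** * The entries of s and their first-order system *)

Section Solution.
Variables (K : comPzRingType) (c : calculus K) (u : K).
Local Notation D1 := (D1 c).
Local Notation Du := (Du c).
Local Notation D0 := (D0 c).
Local Notation S := (sc c).
Local Notation al := (al c).
Local Notation be := (be c).

(* T_1, the same with the roles of Z and Y exchanged, and Q_11 *)
Definition tracT1 := D1 0%Z S - Du 2%Z al.
Definition tracTu := Du 0%Z S - D1 (-2)%Z be.
Definition cartanQ := - (2 * D1 1%Z tracT1) - 18 * (S * al) + 3 * D0 2%Z al.

(* The entries for the solution 3 u: the factor keeps them integral. *)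
Definition s02 := 3 * u.
Definition s01 := 3 * D1 0%Z u.
Definition s12 := 3 * Du 0%Z u.
(** Entry 12 of nabla_1 s prescribes s11 - s22 = 3 Xl, and entry 01 of nabla_{bar 1} s prescribes
    s11 - s00 = 3 Xu. Together with trace zero these give the diagonal; the factor 3 in [s02] saves
    a division by 3. *)
Definition Xl := D1 (-1)%Z (Du 0%Z u) + 3 * (S * u).
Definition Xu := Du 1%Z (D1 0%Z u) + 3 * (S * u).
Definition s00 := Xl - 2 * Xu.
Definition s11 := Xl + Xu.
Definition s22 := Xu - 2 * Xl.
(** Here nabla_1 s = D1 s + [G, s], where G has rows (0, 0, 0), (3 S, 0, 1), (- T_1, - 3 al, 0).
    Entry 22 of nabla_1 s determines [s21], entry 00 of nabla_{bar 1} s determines [s10], and entry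
    10 of nabla_1 s determines [s20]. *)
Definition s21 := D1 0%Z s22 - tracT1 * s02 - 3 * (al * s12).
Definition s10 := Du 0%Z s00 - tracTu * s02 - 3 * (be * s01).
Definition s20 := - (D1 (-1)%Z s10 + 3 * (S * (s00 - s11)) + s12 * tracT1).

Hypothesis eqn : D1 1%Z (D1 0%Z u) = - (3 * (al * u)).
Hypothesis wu : has_weight 0%Z u.

Ltac jetsu := repeat first [rewrite !eqn | jet1].

(** The entries 00, 01, 11 and 21 of nabla_1 s are not prescribed by the construction; they are
    where the equation on u enters. *)
Lemma D1_s00 : D1 0%Z s00 = 3 * (S * s01) - s02 * tracT1.
Proof. rewrite /s00 /Xl /Xu /s01 /s02 /tracT1. jetsu. ring. Qed.

Lemma D1_s01 : D1 1%Z s01 = - (3 * (al * s02)).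
Proof. rewrite /s01 /s02. jetsu. ring. Qed.

Lemma D1_s02 : D1 0%Z s02 = s01.
Proof. rewrite /s01 /s02. jetsu. ring. Qed.

Lemma D1_s12 : D1 (-1)%Z s12 = s11 - s22 - 3 * (S * s02).
Proof. rewrite /s12 /s11 /s22 /s02 /Xl /Xu. jetsu. ring. Qed.

Lemma D1_s11 : D1 0%Z s11 = - (3 * (S * s01)) - s21 - 3 * (al * s12).
Proof. rewrite /s21 /s22 /s11 /s01 /s02 /s12 /Xl /Xu /tracT1. jetsu. ring. Qed.

Lemma D1_s22 : D1 0%Z s22 = s21 + s02 * tracT1 + 3 * (al * s12).
Proof. rewrite /s21; ring. Qed.

Lemma D1_s10 : D1 (-1)%Z s10 = - (s20 + 3 * (S * (s00 - s11)) + s12 * tracT1).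
Proof. rewrite /s20; ring. Qed.

(** This is where the Cartan tensor appears: beyond the terms of [G, s], the derivatives of [S] and
    [al] produced by the commutations collect into [cartanQ], multiplied by u alone. *)
Lemma D1_s21 : D1 1%Z s21 = tracT1 * s01 + 3 * (al * (s11 - s22)) + s02 * cartanQ.
Proof.
rewrite /s21 /s22 /s11 /s01 /s02 /s12 /Xl /Xu /tracT1 /cartanQ. jetsu. ring.
Qed.
End Solution.

(** * Change of contact form, with the weights factored out *)

Section Rescaling.
Variables (K : comPzRingType) (c : calculus K) (x y w u : K).
Local Notation D1 := (D1 c).
Local Notation Du := (Du c).
Local Notation D0 := (D0 c).
Local Notation S := (sc c).
Local Notation al := (al c).
Local Notation be := (be c).
Local Notation T1 := (tracT1 c).
Local Notation Tu := (tracTu c).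

(* D1, Du and D0 of the rescaled calculus, on f of weight nu^k e^{-m Upsilon}, with
   that weight factored out; 6 x, 6 y and 6 w are the derivatives of Upsilon. *)
Definition twist1 k m f := D1 k f - 6 * ((m + k + k)%:~R * (x * f)).
Definition twistu k m f := Du k f - 6 * ((m - k)%:~R * (y * f)).
Definition twist0 k m f := D0 k f - 6 * (y * D1 k f) + 6 * (x * Du k f)
  - 6 * (m%:~R * (w * f)) - 6 * (k%:~R * ((D1 (-1)%Z y - 6 * (x * y)) * f)).

Hypotheses (wx : has_weight 1%Z x) (wy : has_weight (-1)%Z y) (ww : has_weight 0%Z w).
(** These three are the commutation relations in weight 0 applied to Upsilon and divided by 6. *)
Hypothesis D1y : D1 (-1)%Z y = Du 1%Z x + w.
Hypothesis D1w : D1 0%Z w = D0 1%Z x - 3 * (al * y).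
Hypothesis D0y : D0 (-1)%Z y = Du 0%Z w - 3 * (be * x).

Ltac jetsx := rewrite /twist1 /twistu /twist0; repeat first [rewrite !D1y | rewrite !D1w | rewrite !D0y | jet1].

(** The laws of the curvature and torsion under theta -> e^Upsilon theta. The term 2 Du x + w is Du
    x + D1 y, symmetric in the two second derivatives of Upsilon. *)
Definition hatS := S - 2 * Du 1%Z x - w - 6 * (x * y).
Definition hat_al := al - 2 * D1 1%Z x + 12 * (x * x).
Definition hat_be := be - 2 * Du (-1)%Z y + 12 * (y * y).
Definition hatT1 := T1 + 18 * (S * x) + 18 * (w * x) - 108 * (y * (x * x))
  + 18 * (y * D1 1%Z x) - 18 * (y * al) - 18 * (x * D1 (-1)%Z y) - 3 * D1 0%Z w.
Definition hatTu := Tu + 18 * (S * y) - 18 * (y * D1 (-1)%Z y) - 108 * (x * (y * y))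
  + 3 * Du 0%Z w + 18 * (x * Du (-1)%Z y) - 18 * (x * be).

Lemma hatT1E : twist1 0%Z 1%Z hatS - twistu 2%Z 0%Z hat_al = hatT1.
Proof. rewrite /hatS /hat_al /hatT1 /tracT1. jetsx. ring. Qed.

Lemma hatTuE : twistu 0%Z 1%Z hatS - twist1 (-2)%Z 2%Z hat_be = hatTu.
Proof. rewrite /hatS /hat_be /hatTu /tracTu. jetsx. ring. Qed.

(** No derivative of Upsilon survives: this is the CR invariance of the Cartan tensor, as an
    identity in jets of Upsilon up to order three. *)
Lemma hatQE : - (2 * twist1 1%Z 1%Z hatT1) - 18 * (hatS * hat_al) + 3 * twist0 2%Z 0%Z hat_al = cartanQ c.
Proof. rewrite /hatS /hat_al /hatT1 /tracT1 /cartanQ /tracT1. jetsx. ring. Qed.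

(* hat_ij are the entries of N s N^{-1}, for the change of splitting
   N = [[1, 0, 0], [6 y, 1, 0], [n20, - 6 x, 1]]; m20 is the corner entry of N^{-1}. *)
Let n20 := - (18 * (x * y) + 3 * w).
Let m20 := 3 * w - 18 * (x * y).
Local Notation s00 := (s00 c u).
Local Notation s01 := (s01 c u).
Local Notation s02 := (s02 u).
Local Notation s10 := (s10 c u).
Local Notation s11 := (s11 c u).
Local Notation s12 := (s12 c u).
Local Notation s20 := (s20 c u).
Local Notation s21 := (s21 c u).
Local Notation s22 := (s22 c u).

Definition hat00 := s00 - 6 * (y * s01) + m20 * s02.
Definition hat01 := s01 + 6 * (x * s02).
Definition hat02 := s02.
Definition hat10 := 6 * (y * s00) + s10 - 6 * (y * (6 * (y * s01) + s11))
  + m20 * (6 * (y * s02) + s12).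
Definition hat11 := 6 * (y * s01) + s11 + 6 * (x * (6 * (y * s02) + s12)).
Definition hat12 := 6 * (y * s02) + s12.
Let r21 := n20 * s01 - 6 * (x * s11) + s21.
Let r22 := n20 * s02 - 6 * (x * s12) + s22.
Definition hat20 := n20 * s00 - 6 * (x * s10) + s20 - 6 * (y * r21) + m20 * r22.
Definition hat21 := r21 + 6 * (x * r22).
Definition hat22 := r22.

(** This is r_1 / i. Since Y_1 = - i Du Q, the curvature term in entry 20 of nabla_1 s / i is -
    [s02] Du Q, whence the last sign. *)
Definition residual := D1 0%Z s20 - T1 * s00 - 3 * (al * s10) - 3 * (S * s21) + T1 * s22
  + s02 * Du 2%Z (cartanQ c).

Hypothesis eqn : D1 1%Z (D1 0%Z u) = - (3 * (al * u)).
Hypothesis wu : has_weight 0%Z u.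
Let D1u : D1 0%Z s02 = s01. Proof. by rewrite /s02 /s01 D1_nat. Qed.
Let Duu : Du 0%Z s02 = s12. Proof. by rewrite /s02 /s12 Du_nat. Qed.
Let Du01 : Du 1%Z s01 = s11 - s00 - 3 * (S * s02).
Proof. rewrite /s01 /s11 /s00 /s02 /Xl /Xu. jet_eq. Qed.
Let Du00 : Du 0%Z s00 = s10 + Tu * s02 + 3 * (be * s01).
Proof. rewrite /s10; ring. Qed.

(** The entries are treated as atoms with a declared weight; [jetss] differentiates them by the
    first-order system instead of unfolding them into jets of u. *)
Let v0 : has_weight 0%Z s02. Proof. by []. Qed.
Let v1 : has_weight 1%Z s01. Proof. by []. Qed.
Let v2 : has_weight (-1)%Z s12. Proof. by []. Qed.
Let v3 : has_weight 0%Z s00. Proof. by []. Qed.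
Let v4 : has_weight 0%Z s11. Proof. by []. Qed.
Let v5 : has_weight 0%Z s22. Proof. by []. Qed.
Let v6 : has_weight 1%Z s21. Proof. by []. Qed.
Let v7 : has_weight (-1)%Z s10. Proof. by []. Qed.
Let v8 : has_weight 0%Z s20. Proof. by []. Qed.

Ltac jetss := rewrite /twist1 /twistu /twist0; repeat first [rewrite !D1y | rewrite !D1w | rewrite !D0y
 | rewrite !(D1_s00 eqn) | rewrite !(D1_s01 eqn) | rewrite !D1u | rewrite !D1_s12
 | rewrite !(D1_s11 eqn) | rewrite !D1_s22 | rewrite !D1_s10 | rewrite !(D1_s21 eqn)
 | rewrite !Duu | rewrite !Du01 | rewrite !Du00 | jet1].

Lemma hat01E : 3 * twist1 0%Z (-1)%Z u = hat01.
Proof. rewrite /hat01 /s01 /s02 /twist1. jet_eq. Qed.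

Lemma hat12E : 3 * twistu 0%Z (-1)%Z u = hat12.
Proof. rewrite /hat12 /s12 /s02 /twistu. jet_eq. Qed.

Lemma hat_diagE : let Xl := twist1 (-1)%Z 0%Z (twistu 0%Z (-1)%Z u) + 3 * (hatS * u) in
  let Xu := twistu 1%Z (-1)%Z (twist1 0%Z (-1)%Z u) + 3 * (hatS * u) in
  [/\ hat00 = Xl - 2 * Xu, hat11 = Xl + Xu & hat22 = Xu - 2 * Xl].
Proof.
split; rewrite /hat00 /hat11 /hat22 /r22 /n20 /m20 /s00 /s01 /s02 /s11 /s12 /s22 /Xl /Xu /hatS.
all: jetsx; ring.
Qed.

Lemma hat21E : twist1 0%Z 0%Z hat22 - hatT1 * hat02 - 3 * (hat_al * hat12) = hat21.
Proof.
rewrite /hat21 /hat02 /hat12 /hat22 /r21 /r22 /n20 /hat_al /hatT1; jetss; ring.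
Qed.

Lemma hat10E : twistu 0%Z 0%Z hat00 - hatTu * hat02 - 3 * (hat_be * hat01) = hat10.
Proof.
rewrite /hat10 /hat00 /hat01 /hat02 /m20 /hat_be /hatTu; jetss; ring.
Qed.

Lemma hat20E : - (twist1 (-1)%Z 1%Z hat10 + 3 * (hatS * (hat00 - hat11)) + hat12 * hatT1) = hat20.
Proof.
rewrite /hat20 /hat10 /hat00 /hat11 /hat12 /r21 /r22 /n20 /m20 /hatS /hatT1; jetss; ring.
Qed.

Lemma residual_hat : twist1 0%Z 1%Z hat20 - hatT1 * hat00 - 3 * (hat_al * hat10) - 3 * (hatS * hat21)
  + hatT1 * hat22 + hat02 * twistu 2%Z 1%Z (cartanQ c) = residual.
Proof.
(* [s20] is the one entry whose D1 is not given by the system; the definition of [residual] is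
   turned into the missing rule. *)
have D20 : D1 0%Z s20 = residual + T1 * s00 + 3 * (al * s10) + 3 * (S * s21)
    - T1 * s22 - s02 * Du 2%Z (cartanQ c) by rewrite /residual; ring.
rewrite /hat20 /hat21 /hat10 /hat00 /hat22 /r21 /r22 /n20 /m20 /hatS /hat_al /hatT1 /hat02; jetss.
rewrite D20; ring.
Qed.
End Rescaling.

Section ZPower.
Variables (K : comPzRingType) (a b : K).
Hypothesis ab : a * b = 1.

(** [K] carries no inversion, so integer powers are formed from a pair of mutually inverse
    elements. *)
Definition zpow (k : int) : K := match k with Posz j => a ^+ j | Negz j => b ^+ j.+1 end.

Lemma zpowS k : zpow (k + 1) = a * zpow k.
Proof.
case: k => [j|[|j]].
- rewrite (_ : Posz j + 1 = Posz j.+1) /zpow ?exprS //; by rewrite -addn1 PoszD.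
- by rewrite /= expr1 ab expr0.
rewrite (_ : Negz j.+1 + 1 = Negz j) /zpow; last first.
  by rewrite !NegzE -(addn1 j.+1) PoszD opprD addrNK.
by rewrite (exprS b j.+1) mulrA ab mul1r.
Qed.

Lemma zpowP k : zpow (k - 1) = b * zpow k.
Proof. by rewrite -{2}(subrK 1 k) zpowS mulrA (mulrC b) ab mul1r. Qed.

Lemma der_zpow (d : K -> K) l k : derivation d -> d a = l * a ->
  d (zpow k) = k%:~R * l * zpow k.
Proof.
move=> dd da.
have db : d b = - l * b.
  have: a * d b = - l.
    have := derM dd a b; rewrite ab (der1 dd) da -mulrA ab mulr1 => /esym/eqP.
    by rewrite addrC addr_eq0 => /eqP.
  by move/(congr1 ( *%R b)); rewrite mulrA (mulrC b a) ab mul1r => ->; rewrite mulrC.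
have dX (e g : K) j : d e = g * e -> d (e ^+ j) = j%:R * g * e ^+ j.
  move=> de; elim: j => [|j IH]; first by rewrite expr0 (der1 dd); ring.
  by rewrite exprS (derM dd) IH de -natr1; ring.
case: k => j; first by rewrite /= (dX _ l).
by rewrite /= (dX _ (- l))// NegzE mulrNz -pmulrn; ring.
Qed.
End ZPower.

(* Z' = nu Z, te = e^Upsilon, ta = e^{-Upsilon}; al' and be' are the transformation law
   of the torsion, whereas that of the curvature follows from the other fields. *)
Record rescaling (K : comPzRingType) (c c' : calculus K) := Rescaling {
  nu : K; nv : K; ta : K; te : K;
  rx : K; ry : K; rw : K;
  nuE : nu * nv = 1; taE : ta * te = 1;
  dZ_te : dZ c te = 6 * rx * te; dY_te : dY c te = 6 * ry * te; dT_te : dT c te = 6 * rw * te;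
  dZ' : forall f, dZ c' f = nu * dZ c f;
  dY' : forall f, dY c' f = nv * ta * dY c f;
  dT' : forall f, dT c' f = ta * (dT c f - 6 * ry * dZ c f + 6 * rx * dY c f);
  wZ' : wZ c' = nu * (wZ c + 12 * rx + nv * dZ c nu);
  wY' : wY c' = nv * ta * (wY c - 6 * ry + nv * dY c nu);
  wT' : wT c' = ta * (wT c + nv * dT c nu - 6 * ry * (nv * dZ c nu) + 6 * rx * (nv * dY c nu)
                      + 6 * dZ c ry + 6 * rx * wY c - 36 * rx * ry);
  al' : al c' = nu ^+ 2 * hat_al c rx;
  be' : be c' = (nv * ta) ^+ 2 * hat_be c ry;
  inv6 : K; inv6E : 6 * inv6 = 1 }.

(** * Transformation laws between two calculi *)

Section Laws.
Variables (K : comPzRingType) (c c' : calculus K) (r : rescaling c c').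
Local Notation x := (rx r).
Local Notation y := (ry r).
Local Notation w := (rw r).
Local Notation nu := (nu r).
Local Notation nv := (nv r).
Local Notation ta := (ta r).
Local Notation te := (te r).
Let dz := dZ_der c.
Let dy := dY_der c.
Let dt := dT_der c.

Lemma div6 (f g : K) : 6 * f = 6 * g -> f = g.
Proof.
by move/(congr1 ( *%R (inv6 r))); rewrite !mulrA (mulrC (inv6 r)) inv6E !mul1r.
Qed.

Definition wpow k m := zpow nu nv k * zpow ta te m.

Lemma der_ta d l : derivation d -> d te = l * te -> d ta = - l * ta.
Proof.
move=> dd; have taC : te * ta = 1 by rewrite mulrC taE.
by move/(der_zpow taC (-1)%Z dd) => /=; rewrite expr1 => ->; ring.
Qed.

Lemma der_wpow d l k m : derivation d -> d te = l * te ->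
  d (wpow k m) = (k%:~R * (nv * d nu) - m%:~R * l) * wpow k m.
Proof.
move=> dd dte; rewrite /wpow (derM dd) (der_zpow (taE r) m dd (der_ta dd dte)).
have dnu : d nu = (nv * d nu) * nu by rewrite mulrAC (mulrC nv) nuE mul1r.
rewrite (der_zpow (nuE r) k dd dnu); ring.
Qed.

Lemma wpowSk k m : wpow (k + 1) m = nu * wpow k m.
Proof. by rewrite /wpow (zpowS (nuE r)); ring. Qed.
Lemma wpowPk k m : wpow (k - 1) m = nv * wpow k m.
Proof. by rewrite /wpow (zpowP (nuE r)); ring. Qed.
Lemma wpowSm k m : wpow k (m + 1) = ta * wpow k m.
Proof. by rewrite /wpow (zpowS (taE r)); ring. Qed.

Lemma D1_wpow k m f : D1 c' k (wpow k m * f) = wpow (k + 1) m * twist1 c x k m f.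
Proof.
rewrite wpowSk /twist1 /D1 (dZ' r) (wZ' r) (derM dz) (der_wpow _ _ dz (dZ_te r)) !intrD; ring.
Qed.

Lemma Du_wpow k m f : Du c' k (wpow k m * f) = wpow (k - 1) (m + 1) * twistu c y k m f.
Proof.
rewrite wpowPk wpowSm /twistu /Du (dY' r) (wY' r) (derM dy) (der_wpow _ _ dy (dY_te r)) !intrD mulrNz; ring.
Qed.

Lemma D0_wpow k m f : D0 c' k (wpow k m * f) = wpow k (m + 1) * twist0 c x y w k m f.
Proof.
rewrite wpowSm /twist0 /D0 /D1 /Du (dT' r) (wT' r) (derM dz) (derM dy) (derM dt).
rewrite (der_wpow _ _ dz (dZ_te r)) (der_wpow _ _ dy (dY_te r)) (der_wpow _ _ dt (dT_te r)); ring.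
Qed.

Let subE (a b : K) : a = b -> a - b = 0. Proof. by move->; rewrite subrr. Qed.

(** The commutation relation is applied to e^Upsilon and divided by it; the products of first
    derivatives of Upsilon cancel. The derivatives of Upsilon are 6 x, 6 y and 6 w, so a factor 6
    remains to be cancelled. *)
Lemma D1_ry : D1 c (-1)%Z y = Du c 1%Z x + w.
Proof.
have /subE := comm_ZY c te.
rewrite dZ_te dY_te dT_te !(derM dz, derM dy) dZ_te dY_te (der_nat dz) (der_nat dy).
set H := (X in X = 0) => H0; apply: div6; apply/eqP; rewrite -subr_eq0; apply/eqP.
rewrite -[RHS](mulr0 ta) -H0 /H /D1 /Du; ring: (taE r).
Qed.

Lemma D1_rw : D1 c 0%Z w = D0 c 1%Z x - 3 * (al c * y).
Proof.
have /subE := comm_ZT c te.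
rewrite dZ_te dY_te dT_te !(derM dz, derM dt) dZ_te dT_te (der_nat dz) (der_nat dt).
set H := (X in X = 0) => H0; apply: div6; apply/eqP; rewrite -subr_eq0; apply/eqP.
rewrite -[RHS](mulr0 ta) -H0 /H /D1 /D0; ring: (taE r).
Qed.

Lemma D0_ry : D0 c (-1)%Z y = Du c 0%Z w - 3 * (be c * x).
Proof.
have /subE := comm_YT c te.
rewrite dZ_te dY_te dT_te !(derM dy, derM dt) dY_te dT_te (der_nat dy) (der_nat dt).
set H := (X in X = 0) => H0; apply: div6; apply/eqP; rewrite -subr_eq0; apply/eqP.
rewrite -[RHS](mulr0 (- ta)) -H0 /H /Du /D0; ring: (taE r).
Qed.

Lemma der_nv d : derivation d -> d nv = - (nv * d nu) * nv.
Proof.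
move=> dd; have H : nu * d nv = - (d nu * nv).
  have := derM dd nu nv; rewrite (nuE r) (der1 dd) => /esym/eqP.
  by rewrite addrC addr_eq0 => /eqP.
have -> : d nv = nv * (nu * d nv) by rewrite mulrA (mulrC nv) (nuE r) mul1r.
by rewrite H mulrN mulrA mulNr.
Qed.

Lemma sc' : sc c' = ta * hatS c x y w.
Proof.
apply: div6; apply: div6; apply/eqP; rewrite -subr_eq0; apply/eqP.
have /subE := curv_ZY c'; have /subE := curv_ZY c; have /subE := comm_ZY c nu.
have /subE := D1_ry.
rewrite (wZ' r) (wY' r) (wT' r) (dZ' r) (dY' r) !(derM dy, derM dz, derD dy, derD dz, derN dy, derN dz).
rewrite !(der_nv dz, der_nv dy, der_ta dz (dZ_te r), der_ta dy (dY_te r), der1 dz, der1 dy).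
set HY := (X in X = 0 -> _); set HN := (X in _ -> X = 0 -> _).
set HC := (X in _ -> _ -> X = 0 -> _); set H' := (X in _ -> _ -> _ -> X = 0 -> _).
move=> Y0 N0 C0 H0.
(* A combination of vanishing expressions equal to 36 (sc c' - ta hatS). The coefficient 3 turns 12
   [sc] into 36 [sc]; the relation on nu removes its second derivatives, and [HY] exchanges D1 y for
   Du x + w. *)
transitivity (- (3 * H') + 3 * ta * HC + 3 * (ta * nv) * HN - 36 * ta * HY).
  rewrite /H' /HC /HN /HY /hatS /D1 /Du; ring: (nuE r).
by rewrite Y0 N0 C0 H0 !mulr0 oppr0 !addr0.
Qed.

Lemma wpowE k k' m m' : wpow k m * wpow k' m' = wpow (k + k') (m + m').
Proof.
have zE (a b : K) (ab : a * b = 1) i j : zpow a b i * zpow a b j = zpow a b (i + j).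
  elim: i => [|i|i] => [|IH|IH]; first by rewrite add0r; exact: mul1r.
    have -> : Posz i.+1 = Posz i + 1 by rewrite -addn1 PoszD.
    by rewrite addrAC !zpowS// -mulrA IH.
  have -> : - (Posz i.+1) = - Posz i - 1 by rewrite -addn1 PoszD opprD.
  by rewrite addrAC !zpowP// -mulrA IH.
by rewrite /wpow -(zE _ _ (nuE r)) -(zE _ _ (taE r)); ring.
Qed.

Lemma wpowM k m k' m' k2 m2 f g : k2 = k + k' -> m2 = m + m' ->
  (wpow k m * f) * (wpow k' m' * g) = wpow k2 m2 * (f * g).
Proof. by move=> -> ->; rewrite -wpowE; ring. Qed.

Lemma D1_wpowE k k2 m f : k2 = k + 1 -> D1 c' k (wpow k m * f) = wpow k2 m * twist1 c x k m f.
Proof. by move->; exact: D1_wpow. Qed.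

Lemma Du_wpowE k m k2 m2 f : k2 = k - 1 -> m2 = m + 1 ->
  Du c' k (wpow k m * f) = wpow k2 m2 * twistu c y k m f.
Proof. by move=> -> ->; exact: Du_wpow. Qed.

Lemma D0_wpowE k m m2 f : m2 = m + 1 ->
  D0 c' k (wpow k m * f) = wpow k m2 * twist0 c x y w k m f.
Proof. by move=> ->; exact: D0_wpow. Qed.

Lemma sc_wpow : sc c' = wpow 0%Z 1%Z * hatS c x y w.
Proof. by rewrite sc' /wpow /zpow expr0 expr1 mul1r. Qed.

Lemma al_wpow : al c' = wpow 2%Z 0%Z * hat_al c x.
Proof. by rewrite (al' r) /wpow /zpow expr0 mulr1. Qed.

Lemma be_wpow : be c' = wpow (-2)%Z 2%Z * hat_be c y.
Proof. by rewrite (be' r) /wpow /zpow exprMn. Qed.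

Let Dy := D1_ry.
Let Dw := D1_rw.
Let Dz := D0_ry.

Lemma T1_wpow : tracT1 c' = wpow 1%Z 1%Z * hatT1 c x y w.
Proof.
rewrite /tracT1 sc_wpow al_wpow (D1_wpowE (k2 := 1%Z))// (Du_wpowE (k2 := 1%Z) (m2 := 1%Z))//.
rewrite -(hatT1E Dy Dw); ring.
Qed.

Lemma Tu_wpow : tracTu c' = wpow (-1)%Z 2%Z * hatTu c x y w.
Proof.
rewrite /tracTu sc_wpow be_wpow (D1_wpowE (k2 := (-1)%Z))// (Du_wpowE (k2 := (-1)%Z) (m2 := 2%Z))//.
rewrite -(hatTuE Dy Dz); ring.
Qed.

Lemma Q_wpow : cartanQ c' = wpow 2%Z 1%Z * cartanQ c.
Proof.
rewrite {1}/cartanQ T1_wpow sc_wpow al_wpow (D1_wpowE (k2 := 2%Z))// (D0_wpowE 2%Z (m2 := 1%Z))//.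
rewrite (wpowM (k2 := 2%Z) (m2 := 1%Z))// -(hatQE Dy Dw); ring.
Qed.

Section Solution.
Variables (u u' : K).
Hypothesis uE : u' = te * u.
Hypothesis eqn : D1 c 1%Z (D1 c 0%Z u) = - (3 * (al c * u)).

Let u_wpow : u' = wpow 0%Z (-1)%Z * u.
Proof. by rewrite uE /wpow /zpow expr0 expr1 mul1r. Qed.

Lemma s02_wpow : s02 u' = wpow 0%Z (-1)%Z * s02 u.
Proof. by rewrite /s02 u_wpow; ring. Qed.

Lemma s01_wpow : s01 c' u' = wpow 1%Z (-1)%Z * hat01 c x u.
Proof. by rewrite /s01 u_wpow (D1_wpowE (k2 := 1%Z))// -hat01E; ring. Qed.

Lemma s12_wpow : s12 c' u' = wpow (-1)%Z 0%Z * hat12 c y u.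
Proof. by rewrite /s12 u_wpow (Du_wpowE (k2 := (-1)%Z) (m2 := 0%Z))// -hat12E; ring. Qed.

Let Xl_wpow : Xl c' u' = wpow 0%Z 0%Z * (twist1 c x (-1)%Z 0%Z (twistu c y 0%Z (-1)%Z u) + 3 * (hatS c x y w * u)).
Proof.
rewrite /Xl u_wpow (Du_wpowE (k2 := (-1)%Z) (m2 := 0%Z))// (D1_wpowE (k2 := 0%Z))// sc_wpow.
by rewrite (wpowM (k2 := 0%Z) (m2 := 0%Z))//; ring.
Qed.

Let Xu_wpow : Xu c' u' = wpow 0%Z 0%Z * (twistu c y 1%Z (-1)%Z (twist1 c x 0%Z (-1)%Z u) + 3 * (hatS c x y w * u)).
Proof.
rewrite /Xu u_wpow (D1_wpowE (k2 := 1%Z))// (Du_wpowE (k2 := 0%Z) (m2 := 0%Z))// sc_wpow.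
by rewrite (wpowM (k2 := 0%Z) (m2 := 0%Z))//; ring.
Qed.

Lemma s00_wpow : s00 c' u' = wpow 0%Z 0%Z * hat00 c x y w u.
Proof. by rewrite /s00 Xl_wpow Xu_wpow; have [-> _ _] := hat_diagE u Dy; ring. Qed.

Lemma s11_wpow : s11 c' u' = wpow 0%Z 0%Z * hat11 c x y u.
Proof. by rewrite /s11 Xl_wpow Xu_wpow; have [_ -> _] := hat_diagE u Dy; ring. Qed.

Lemma s22_wpow : s22 c' u' = wpow 0%Z 0%Z * hat22 c x y w u.
Proof. by rewrite /s22 Xl_wpow Xu_wpow; have [_ _ ->] := hat_diagE u Dy; ring. Qed.

Lemma s21_wpow : s21 c' u' = wpow 1%Z 0%Z * hat21 c x y w u.
Proof.
rewrite /s21 s22_wpow T1_wpow s02_wpow al_wpow s12_wpow (D1_wpowE (k2 := 1%Z))//.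
rewrite !(wpowM (k2 := 1%Z) (m2 := 0%Z))// -(hat21E u Dy Dw) /hat02; ring.
Qed.

Lemma s10_wpow : s10 c' u' = wpow (-1)%Z 1%Z * hat10 c x y w u.
Proof.
rewrite /s10 s00_wpow Tu_wpow s02_wpow be_wpow s01_wpow (Du_wpowE (k2 := (-1)%Z) (m2 := 1%Z))//.
rewrite !(wpowM (k2 := (-1)%Z) (m2 := 1%Z))// -(hat10E u Dy) /hat02; ring.
Qed.

Lemma s20_wpow : s20 c' u' = wpow 0%Z 1%Z * hat20 c x y w u.
Proof.
rewrite /s20 s10_wpow s00_wpow s11_wpow sc_wpow s12_wpow T1_wpow (D1_wpowE (k2 := 0%Z))//.
rewrite -mulrBr !(wpowM (k2 := 0%Z) (m2 := 1%Z))// -(hat20E Dy Dw eqn); ring.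
Qed.

Lemma residual_wpow : residual c' u' = wpow 1%Z 1%Z * residual c u.
Proof.
rewrite /residual s20_wpow T1_wpow s00_wpow al_wpow s10_wpow sc_wpow s21_wpow s22_wpow s02_wpow Q_wpow.
rewrite (D1_wpowE (k2 := 1%Z))// (Du_wpowE (k2 := 1%Z) (m2 := 2%Z))//.
rewrite !(wpowM (k2 := 1%Z) (m2 := 1%Z))// -/(residual c u) -(residual_hat Dy Dw eqn) /hat02; ring.
Qed.
End Solution.
End Laws.

(* The hypotheses express the frame c' in the frame c, and compare the brackets
   [Z', Y'] (e1-e3), [Z', T'] (f1-f3) and [Y', T'] (g1-g2) computed in both. *)
Section MkRescaling.
Variables (K : comPzRingType) (c c' : calculus K) (nu nv ta te m a b i6 : K).
Hypotheses (nuE : nu * nv = 1) (taE : ta * te = 1) (i6E : 6 * i6 = 1).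
Hypothesis dZ'E : forall f, dZ c' f = nu * dZ c f.
Hypothesis dY'E : forall f, dY c' f = m * dY c f.
Hypothesis dT'E : forall f, dT c' f = ta * dT c f + a * dZ c f + b * dY c f.
Hypothesis e1 : m * nu = ta.
Hypothesis e2 : - (m * nu * wY c) - m * dY c nu = a - wY c' * nu.
Hypothesis e3 : - (m * nu * wZ c) + nu * dZ c m = b - wZ c' * m.
Hypothesis f1 : nu * (dZ c ta + b) = 0.
Hypothesis f2 : nu * (- (ta * wT c) + dZ c a - b * wY c)
  - (ta * dT c nu + a * dZ c nu + b * dY c nu) = - (wT c' * nu).
Hypothesis f3 : nu * (- (ta * (3 * al c)) + dZ c b - b * wZ c) = - (3 * al c' * m).
Hypothesis g1 : m * (dY c ta - a) = 0.
Hypothesis g2 : m * (ta * (3 * be c) + dY c a + a * wY c) = 3 * be c' * nu.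

Let rx := i6 * (ta * dZ c te).
Let ry := i6 * (ta * dY c te).
Let rw := i6 * (ta * dT c te).
Let dz := dZ_der c.
Let dy := dY_der c.
Let dt := dT_der c.

Let log_te d : d te = 6 * (i6 * (ta * d te)) * te.
Proof. by rewrite mulrA i6E mul1r mulrAC taE mul1r. Qed.

Let der_log d l : derivation d -> d te = l * te -> d ta = - l * ta.
Proof.
move=> dd; have taC : te * ta = 1 by rewrite mulrC taE.
by move/(der_zpow taC (-1)%Z dd) => /=; rewrite expr1 => ->; ring.
Qed.

Let zta : dZ c ta = - (6 * rx) * ta. Proof. exact: der_log dz (log_te _). Qed.
Let yta : dY c ta = - (6 * ry) * ta. Proof. exact: der_log dy (log_te _). Qed.

Let mE : m = nv * ta.
Proof. by rewrite -e1; ring: nuE. Qed.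
(** As [Z', T'] has no T component, the Y component of T' is forced to be a derivative of Upsilon.
    In the same way [Y', T'] determines the Z component in [aE]. *)
Let bE : b = 6 * rx * ta.
Proof.
have: nv * (nu * (dZ c ta + b)) = 0 by rewrite f1 mulr0.
rewrite mulrA (mulrC nv) nuE mul1r zta => /eqP; rewrite addrC addr_eq0 => /eqP ->; ring.
Qed.
Let aE : a = - (6 * ry * ta).
Proof.
have: (te * nu) * (m * (dY c ta - a)) = 0 by rewrite g1 mulr0.
have -> : (te * nu) * (m * (dY c ta - a)) = (nu * nv) * (ta * te) * (dY c ta - a).
  by rewrite mE; ring.
rewrite nuE taE !mul1r yta => /eqP; rewrite subr_eq0 => /eqP <-; ring.
Qed.

Let znv d : derivation d -> d nv = - (nv * d nu) * nv.
Proof.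
move=> dd; have H : nu * d nv = - (d nu * nv).
  have := derM dd nu nv; rewrite nuE (der1 dd) => /esym/eqP.
  by rewrite addrC addr_eq0 => /eqP.
have -> : d nv = nv * (nu * d nv) by rewrite mulrA (mulrC nv) nuE mul1r.
by rewrite H mulrN mulrA mulNr.
Qed.

Let regular3 (f g : K) : 3 * f = 3 * g -> f = g.
Proof.
move=> fg; have E f' : f' = 2 * i6 * (3 * f').
  have -> : 2 * i6 * (3 * f') = 6 * i6 * f' by ring.
  by rewrite i6E mul1r.
by rewrite (E f) fg -E.
Qed.

Let wZ'E : wZ c' = nu * (wZ c + 12 * rx + nv * dZ c nu).
Proof.
have H : wZ c' * m = b - (- (m * nu * wZ c) + nu * dZ c m) by rewrite e3; ring.
have -> : wZ c' = te * nu * (wZ c' * m) by rewrite mE; ring: nuE taE.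
rewrite H bE mE (derM dz) (znv dz) zta; ring: nuE taE.
Qed.

Let wY'E : wY c' = nv * ta * (wY c - 6 * ry + nv * dY c nu).
Proof.
have H : wY c' * nu = a - (- (m * nu * wY c) - m * dY c nu) by rewrite e2; ring.
have -> : wY c' = nv * (wY c' * nu) by ring: nuE.
rewrite H aE mE; ring: nuE taE.
Qed.

Let wT'E : wT c' = ta * (wT c + nv * dT c nu - 6 * ry * (nv * dZ c nu)
  + 6 * rx * (nv * dY c nu) + 6 * dZ c ry + 6 * rx * wY c - 36 * rx * ry).
Proof.
have H : wT c' * nu = (ta * dT c nu + a * dZ c nu + b * dY c nu)
  - nu * (- (ta * wT c) + dZ c a - b * wY c).
  by apply: oppr_inj; rewrite -[LHS]f2; ring.
have -> : wT c' = nv * (wT c' * nu) by ring: nuE.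
rewrite H aE bE (derN dz) (derM dz _ ta) (derM dz 6 ry) zta (der_nat dz); ring: nuE taE.
Qed.

Let al'E : al c' = nu ^+ 2 * hat_al c rx.
Proof.
apply: regular3.
have H : 3 * al c' * m = - (nu * (- (ta * (3 * al c)) + dZ c b - b * wZ c)) by rewrite f3; ring.
have -> : 3 * al c' = te * nu * (3 * al c' * m) by rewrite mE; ring: nuE taE.
rewrite H bE (derM dz _ ta) (derM dz 6 rx) zta (der_nat dz) /hat_al /D1; ring: taE.
Qed.

Let be'E : be c' = (nv * ta) ^+ 2 * hat_be c ry.
Proof.
apply: regular3.
have -> : 3 * be c' = nv * (3 * be c' * nu) by ring: nuE.
rewrite -g2 mE aE (derN dy) (derM dy _ ta) (derM dy 6 ry) yta (der_nat dy) /hat_be /Du; ring.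
Qed.

(** The record is transparent because its fields are later evaluated at points by unfolding them to
    the given data. *)
Definition mk_rescaling : rescaling c c'.
Proof.
refine (@Rescaling K c c' nu nv ta te rx ry rw nuE taE _ _ _ dZ'E _ _ wZ'E wY'E wT'E al'E be'E i6 i6E).
- exact: log_te.
- exact: log_te.
- exact: log_te.
- by move=> f; rewrite dY'E mE.
- by move=> f; rewrite dT'E aE bE; ring.
Defined.
End MkRescaling.

(** * Naturality of the entries under ring morphisms *)

Section Morphism.
Variables (K K' : comPzRingType) (c : calculus K) (c' : calculus K') (phi : K -> K').
Hypothesis phiD : forall f g, phi (f + g) = phi f + phi g.
Hypothesis phiN : forall f, phi (- f) = - phi f.
Hypothesis phiM : forall f g, phi (f * g) = phi f * phi g.
Hypothesis phi1 : phi 1 = 1.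
Hypothesis phiZ : forall f, phi (dZ c f) = dZ c' (phi f).
Hypothesis phiY : forall f, phi (dY c f) = dY c' (phi f).
Hypothesis phiT : forall f, phi (dT c f) = dT c' (phi f).
Hypotheses (phi_wZ : phi (wZ c) = wZ c') (phi_wY : phi (wY c) = wY c') (phi_wT : phi (wT c) = wT c').
Hypotheses (phi_sc : phi (sc c) = sc c') (phi_al : phi (al c) = al c') (phi_be : phi (be c) = be c').

Lemma phi_nat n : phi n%:R = n%:R.
Proof.
elim: n => [|n IH]; last by rewrite -!natr1 phiD IH phi1.
by apply: (addrI (phi 0)); rewrite -phiD !addr0.
Qed.

Lemma phi_int k : phi k%:~R = k%:~R.
Proof. by case: k => n; rewrite ?NegzE ?mulrNz ?phiN -!pmulrn phi_nat. Qed.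

Lemma phi_D1 k f : phi (D1 c k f) = D1 c' k (phi f).
Proof. by rewrite /D1 phiD phiN !phiM phi_int phiZ phi_wZ. Qed.
Lemma phi_Du k f : phi (Du c k f) = Du c' k (phi f).
Proof. by rewrite /Du phiD phiN !phiM phi_int phiY phi_wY. Qed.
Lemma phi_D0 k f : phi (D0 c k f) = D0 c' k (phi f).
Proof. by rewrite /D0 phiD phiN !phiM phi_int phiT phi_wT. Qed.

Let E := (phi_sc, phi_al, phi_be, phi_D1, phi_Du, phi_D0, phi_nat, phiD, phiN, phiM).

Lemma phi_T1 : phi (tracT1 c) = tracT1 c'. Proof. by rewrite /tracT1 !E. Qed.
Lemma phi_Tu : phi (tracTu c) = tracTu c'. Proof. by rewrite /tracTu !E. Qed.
Lemma phi_Q : phi (cartanQ c) = cartanQ c'.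
Proof. by rewrite /cartanQ !(phi_T1, E). Qed.

Variable u : K.
Lemma phi_s02 : phi (s02 u) = s02 (phi u). Proof. by rewrite /s02 !E. Qed.
Lemma phi_s01 : phi (s01 c u) = s01 c' (phi u). Proof. by rewrite /s01 !E. Qed.
Lemma phi_s12 : phi (s12 c u) = s12 c' (phi u). Proof. by rewrite /s12 !E. Qed.
Let phi_Xl : phi (Xl c u) = Xl c' (phi u). Proof. by rewrite /Xl !E. Qed.
Let phi_Xu : phi (Xu c u) = Xu c' (phi u). Proof. by rewrite /Xu !E. Qed.
Lemma phi_s00 : phi (s00 c u) = s00 c' (phi u). Proof. by rewrite /s00 !(phi_Xl, phi_Xu, E). Qed.
Lemma phi_s11 : phi (s11 c u) = s11 c' (phi u). Proof. by rewrite /s11 !(phi_Xl, phi_Xu, E). Qed.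
Lemma phi_s22 : phi (s22 c u) = s22 c' (phi u). Proof. by rewrite /s22 !(phi_Xl, phi_Xu, E). Qed.
Lemma phi_s21 : phi (s21 c u) = s21 c' (phi u).
Proof. by rewrite /s21 !(phi_s22, phi_T1, phi_s02, phi_s12, E). Qed.
Lemma phi_s10 : phi (s10 c u) = s10 c' (phi u).
Proof. by rewrite /s10 !(phi_s00, phi_Tu, phi_s02, phi_s01, E). Qed.
Lemma phi_s20 : phi (s20 c u) = s20 c' (phi u).
Proof. by rewrite /s20 !(phi_s10, phi_s00, phi_s11, phi_s12, phi_T1, E). Qed.
Lemma phi_residual : phi (residual c u) = residual c' (phi u).
Proof.
by rewrite /residual !(phi_s20, phi_T1, phi_s00, phi_s10, phi_s21, phi_s22, phi_s02, phi_Q, E).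
Qed.
End Morphism.

(** * Smooth functions *)

Section CkClosure.
Variables (R : realType) (V : set 'rV[R]_3).
Implicit Types f g : 'rV[R]_3 -> R.

Lemma CkS k f : Ck k.+1 V f -> Ck k V f.
Proof.
elim: k f => [|k IH] f [cf Hf]; split=> // i.
by have [df Cf] := Hf i; split=> //; exact: IH.
Qed.

Lemma Ck_sub k (V' : set 'rV[R]_3) f : V' `<=` V -> Ck k V f -> Ck k V' f.
Proof.
move=> sV; elim: k f => [|k IH] f [cf Hf]; split=> //; try by move=> x /sV; exact: cf.
move=> i; have [df Cf] := Hf i; split; last exact: IH.
by move=> x /sV; exact: df.
Qed.

Lemma Ck_cst k (a : R) : Ck k V (fun=> a).
Proof.
elim: k a => [|k IH] a; split=> //; try by move=> x _; exact: cst_continuous.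
move=> i; split; first by move=> x _; exact: derivable_cst.
have -> : partial i (fun=> a) = fun=> 0 :> R by apply/funext => x; exact: derive_cst.
exact: IH.
Qed.

Hypothesis oV : open V.

Lemma Ck_add k f g : Ck k V f -> Ck k V g -> Ck k V (fun x => f x + g x).
Proof.
elim: k f g => [|k IH] f g [cf Hf] [cg Hg]; split=> //;
  try by move=> x Vx; apply: continuousD; [exact: cf|exact: cg].
move=> i; have [df Cf] := Hf i; have [dg Cg] := Hg i; split.
  by move=> x Vx; apply: derivableD; [exact: df|exact: dg].
apply: eq_Ck (IH _ _ Cf Cg) => // x Vx.
by rewrite /partial -deriveD//; [exact: df|exact: dg].
Qed.

Lemma Ck_mul k f g : Ck k V f -> Ck k V g -> Ck k V (fun x => f x * g x).
Proof.
elim: k f g => [|k IH] f g Ckf Ckg; have [cf Hf] := Ckf; have [cg Hg] := Ckg; split=> //;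
  try by move=> x Vx; apply: continuousM; [exact: cf|exact: cg].
move=> i; have [df Cf] := Hf i; have [dg Cg] := Hg i; split.
  by move=> x Vx; apply: derivableM; [exact: df|exact: dg].
apply: (eq_Ck oV _ (Ck_add (IH _ _ (CkS Ckf) Cg) (IH _ _ (CkS Ckg) Cf))) => x Vx.
by rewrite /partial deriveM//; [exact: df|exact: dg].
Qed.

Lemma Ck_inv k f : (forall x, V x -> f x != 0) -> Ck k V f -> Ck k V (fun x => (f x)^-1).
Proof.
move=> f0; elim: k => [|k IH] Ckf; have [cf Hf] := Ckf; split=> //;
  try by move=> x Vx; apply: continuousV; [exact: f0|exact: cf].
move=> i; have [df Cf] := Hf i; split.
  by move=> x Vx; apply: derivableV; [exact: f0|exact: df].
have Ci := IH (CkS Ckf).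
apply: (eq_Ck oV _ (Ck_opp oV (Ck_mul (Ck_mul Ci Ci) Cf))) => x Vx.
rewrite /partial deriveV//; [|exact: f0|exact: df].
by rewrite /GRing.scale /= mulNr expr2 invfM.
Qed.
End CkClosure.

Section Smooth.
Variables (R : realType) (M : oriented_manifold3 R).
Local Notation C := R[i].
Implicit Types (U V : set M) (f g : M -> C) (p : M).

Lemma chart_open U phi : open U -> atlas phi -> open (Defs.coord phi @` (U `&` @dom R M phi)).
Proof.
move=> oU aphi; have [odom _ ophi] := atlas_chart aphi.
by apply/ophi; [move=> x [] | exact: openI].
Qed.

Lemma smooth_on_sub U V f : V `<=` U -> smooth_on U f -> smooth_on V f.
Proof.
move=> sVU sf phi aphi; have [sR sI] := sf _ aphi.
have sub : Defs.coord phi @` (V `&` dom phi) `<=` Defs.coord phi @` (U `&` dom phi).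
  by apply: image_subset => q [Vq dq]; split=> //; exact: sVU.
by split=> k; [exact: Ck_sub sub (sR k)|exact: Ck_sub sub (sI k)].
Qed.

Lemma eq_smooth_on U f g : open U -> (forall p, U p -> f p = g p) ->
  smooth_on U f -> smooth_on U g.
Proof.
move=> oU fg sf phi aphi; have [sR sI] := sf _ aphi.
have [odom phiK _] := atlas_chart aphi.
have E x : (Defs.coord phi @` (U `&` dom phi)) x -> f (pt phi x) = g (pt phi x).
  by move=> [q [Uq dq] <-]; rewrite phiK//; exact: fg.
split=> k.
  by apply: eq_Ck (chart_open oU aphi) _ (sR k) => x /E ->.
by apply: eq_Ck (chart_open oU aphi) _ (sI k) => x /E ->.
Qed.

Lemma smooth_on_cst U (a : C) : smooth_on U (fun=> a).
Proof. by move=> phi _; split=> k; exact: Ck_cst. Qed.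

Lemma smooth_on_add U f g : open U -> smooth_on U f -> smooth_on U g ->
  smooth_on U (fun p => f p + g p).
Proof.
move=> oU sf sg phi aphi; have [fR fI] := sf _ aphi; have [gR gI] := sg _ aphi.
have oC := chart_open oU aphi; split=> k.
  by apply: (eq_Ck oC _ (Ck_add oC (fR k) (gR k))) => x _; case: (f _); case: (g _).
by apply: (eq_Ck oC _ (Ck_add oC (fI k) (gI k))) => x _; case: (f _); case: (g _).
Qed.

Lemma smooth_on_mul U f g : open U -> smooth_on U f -> smooth_on U g ->
  smooth_on U (fun p => f p * g p).
Proof.
move=> oU sf sg phi aphi; have [fR fI] := sf _ aphi; have [gR gI] := sg _ aphi.
have oC := chart_open oU aphi; split=> k.
  apply: (eq_Ck oC _ (Ck_add oC (Ck_mul oC (fR k) (gR k))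
    (Ck_opp oC (Ck_mul oC (fI k) (gI k))))) => x _.
  by case: (f _) => a b; case: (g _).
apply: (eq_Ck oC _ (Ck_add oC (Ck_mul oC (fR k) (gI k))
  (Ck_mul oC (fI k) (gR k)))) => x _.
by case: (f _) => a b; case: (g _).
Qed.

Lemma smooth_on_opp U f : open U -> smooth_on U f -> smooth_on U (fun p => - f p).
Proof.
move=> oU sf; apply: (eq_smooth_on oU _ (smooth_on_mul oU (smooth_on_cst U (-1)) sf)).
by move=> p _; rewrite mulN1r.
Qed.

Lemma smooth_on_inv U f : open U -> (forall p, U p -> f p != 0) -> smooth_on U f ->
  smooth_on U (fun p => (f p)^-1).
Proof.
move=> oU f0 sf.
(* Writing 1/f as conj f / |f|^2 reduces the claim to the inverse of a real function. *)
pose n2 p := f p * (f p)^*.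
have sn : smooth_on U n2 by apply: smooth_on_mul => //; exact: smooth_on_conj.
have sn' : smooth_on U (fun p => (n2 p)^-1).
  move=> phi aphi; have [nR _] := sn _ aphi; have oC := chart_open oU aphi.
  have [_ phiK _] := atlas_chart aphi.
  have n2E q : n2 q = (complex.Re (n2 q))%:C.
    by rewrite RRe_real// ger0_real// /n2 mul_conjC_ge0.
  split=> k.
    apply: (eq_Ck oC _ (Ck_inv oC _ (nR k))) => x [q [Uq dq] <-]; rewrite phiK//.
      by rewrite [in RHS]n2E -fmorphV.
    apply/eqP => n0; have /eqP := f0 q Uq; apply.
    by apply/eqP; rewrite -(mul_conjC_eq0 (f q)) -/(n2 q) n2E n0.
  apply: (eq_Ck oC _ (Ck_cst _ k 0)) => x [q [Uq dq] <-]; rewrite phiK//.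
  by rewrite [in RHS]n2E -fmorphV.
apply: (eq_smooth_on oU _ (smooth_on_mul oU (smooth_on_conj oU sf) sn')) => p Up.
have n0 : (f p)^* != 0 by rewrite conjC_eq0 f0.
by rewrite /n2 invfM mulrCA divff// mulr1.
Qed.
End Smooth.

(** * Tangent vectors and brackets *)

Section Conjugation.
Variable C : numClosedFieldType.
Implicit Types x y : C.
Lemma conjM x y : (x * y)^* = x^* * y^*. Proof. exact: rmorphM. Qed.
Lemma conjD x y : (x + y)^* = x^* + y^*. Proof. exact: rmorphD. Qed.
Lemma conjN x : (- x)^* = - x^*. Proof. exact: rmorphN. Qed.
Lemma conjV x : (x^-1)^* = (x^*)^-1. Proof. exact: fmorphV. Qed.
Lemma conjz (n : int) : (n%:~R : C)^* = n%:~R. Proof. exact: rmorph_int. Qed.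
End Conjugation.

Section Tangent.
Variables (R : realType) (M : oriented_manifold3 R).
Local Notation C := R[i].
Implicit Types (U V : set M) (f g : M -> C) (p : M) (X Y : field M).

Lemma smooth_atW U p f : open U -> U p -> smooth_on U f -> smooth_at p f.
Proof. by move=> oU Up sf; exists U. Qed.

Lemma smooth_at2 p f g : smooth_at p f -> smooth_at p g ->
  exists U, [/\ open U, U p, smooth_on U f & smooth_on U g].
Proof.
move=> [U [oU Up sf]] [V [oV Vp sg]]; exists (U `&` V); split=> //; first exact: openI.
  by apply: smooth_on_sub sf => q [].
by apply: smooth_on_sub sg => q [].
Qed.

Lemma smooth_at_add p f g : smooth_at p f -> smooth_at p g ->
  smooth_at p (fun q => f q + g q).
Proof.
by move=> sf sg; have [U [oU Up ? ?]] := smooth_at2 sf sg; apply: (smooth_atW oU Up);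
  exact: smooth_on_add.
Qed.

Lemma smooth_at_mul p f g : smooth_at p f -> smooth_at p g ->
  smooth_at p (fun q => f q * g q).
Proof.
by move=> sf sg; have [U [oU Up ? ?]] := smooth_at2 sf sg; apply: (smooth_atW oU Up);
  exact: smooth_on_mul.
Qed.

Lemma smooth_at_cst p (a : C) : smooth_at p (fun=> a).
Proof. by apply: (smooth_atW openT) => //; exact: smooth_on_cst. Qed.

Lemma ct_tangent p (v : CT p) : is_tangent p (val v).
Proof. exact/asboolP/(valP v). Qed.

Lemma ct_ext p (v w : CT p) :
  (forall f, smooth_at p f -> val v f = val w f) -> v = w.
Proof.
move=> vw; apply: val_inj; apply/funext => f.
have [sf|nsf] := pselect (smooth_at p f); first exact: vw.
by have [_ _ _ ->] := ct_tangent v => //; have [_ _ _ ->] := ct_tangent w.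
Qed.

Lemma ct_add p (v : CT p) f g : smooth_at p f -> smooth_at p g ->
  val v (fun q => f q + g q) = val v f + val v g.
Proof.
move=> sf sg; have [+ _ _ _] := ct_tangent v => /(_ 1 f g sf sg).
by rewrite mul1r => <-; congr (val v _); apply/funext => q; rewrite mul1r.
Qed.

Lemma ct_mul p (v : CT p) f g : smooth_at p f -> smooth_at p g ->
  val v (fun q => f q * g q) = val v f * g p + f p * val v g.
Proof. by move=> sf sg; have [_ + _ _] := ct_tangent v => /(_ f g sf sg). Qed.

Lemma ct_cst p (v : CT p) (a : C) : val v (fun=> a) = 0.
Proof.
have s0 (b : C) := smooth_at_cst p b.
have one : val v (fun=> 1) = 0.
  have : val v (fun=> 1) = val v (fun=> 1) * 1 + 1 * val v (fun=> 1).
    by rewrite -(ct_mul v (s0 1) (s0 1)); congr (val v _); apply/funext => q; rewrite mulr1.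
  by rewrite mulr1 mul1r => /(congr1 (+%R^~ (- val v (fun=> 1)))); rewrite subrr addrK.
have zero : val v (fun=> 0) = 0.
  have : val v (fun=> 0) = val v (fun=> 0) + val v (fun=> 0).
    by rewrite -(ct_add v (s0 0) (s0 0)); congr (val v _); apply/funext => q; rewrite addr0.
  by move=> /(congr1 (+%R^~ (- val v (fun=> 0)))); rewrite subrr addrK.
have [+ _ _ _] := ct_tangent v => /(_ a (fun=> 1) (fun=> 0) (s0 1) (s0 0)).
move=> H; transitivity (a * val v (fun=> 1) + val v (fun=> 0)).
  by rewrite -H; congr (val v _); apply/funext => q; rewrite mulr1 addr0.
by rewrite one zero mulr0 addr0.
Qed.

Lemma ct_local p (v : CT p) U f g : open U -> U p -> smooth_on U f ->
  (forall q, U q -> f q = g q) -> val v f = val v g.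
Proof.
move=> oU Up sf fg; have [_ _ + _] := ct_tangent v; apply.
- exact: smooth_atW sf.
- by apply: (smooth_atW oU Up); exact: eq_smooth_on sf.
- by apply: filterS (open_nbhs_nbhs (conj oU Up)).
Qed.

Lemma ct_local_cst p (v : CT p) U f (a : C) : open U -> U p ->
  (forall q, U q -> f q = a) -> val v f = 0.
Proof.
move=> oU Up fa; rewrite -(ct_cst v a); apply/esym.
by apply: (ct_local _ oU Up) => [|q /fa ->//]; exact: smooth_on_cst.
Qed.

Lemma valD p (v w : CT p) f : val (v + w) f = val v f + val w f. Proof. by []. Qed.
Lemma valZ p (a : C) (v : CT p) f : val (a *: v) f = a * val v f. Proof. by []. Qed.
Lemma valN p (v : CT p) f : val (- v) f = - val v f. Proof. by []. Qed.

Lemma tconjE p (v : CT p) f : val (tconj v) f = (val v (fun q => (f q)^*))^*.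
Proof. by []. Qed.

Lemma tconjK p (v : CT p) : tconj (tconj v) = v.
Proof.
apply: ct_ext => f _; rewrite !tconjE conjCK; congr (val v _).
by apply/funext => q; rewrite conjCK.
Qed.

Lemma tconjD p (v w : CT p) : tconj (v + w) = tconj v + tconj w.
Proof. by apply: ct_ext => f _; rewrite valD !tconjE valD rmorphD. Qed.

Lemma tconjZ p (a : C) (v : CT p) : tconj (a *: v) = a^* *: tconj v.
Proof. by apply: ct_ext => f _; rewrite valZ !tconjE valZ rmorphM. Qed.

Lemma tconjN p (v : CT p) : tconj (- v) = - tconj v.
Proof. by apply: ct_ext => f _; rewrite valN !tconjE valN rmorphN. Qed.

Definition fscale g X : field M := fun p => g p *: X p.
Definition fadd X Y : field M := fun p => X p + Y p.

Lemma smooth_field_sub U V X : V `<=` U -> smooth_field U X -> smooth_field V X.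
Proof. by move=> sVU sX W f oW sW; apply: sX => // q /sW /sVU. Qed.

Lemma smooth_fscale U g X : smooth_on U g -> smooth_field U X -> smooth_field U (fscale g X).
Proof.
move=> sg sX V f oV sV sf; apply: smooth_on_mul => //; first exact: smooth_on_sub sg.
exact: sX.
Qed.

Lemma smooth_fadd U X Y : smooth_field U X -> smooth_field U Y -> smooth_field U (fadd X Y).
Proof.
by move=> sX sY V f oV sV sf; apply: smooth_on_add => //; [exact: sX|exact: sY].
Qed.

Lemma smooth_conj_field U X : smooth_field U X -> smooth_field U (conj_field X).
Proof.
move=> sX V f oV sV sf; apply: smooth_on_conj => //.
by apply: sX => //; exact: smooth_on_conj.
Qed.

Lemma app_smooth_at U p X f : open U -> U p -> smooth_field U X -> smooth_at p f ->
  smooth_at p (app X f).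
Proof.
move=> oU Up sX [V [oV Vp sf]]; apply: (@smooth_atW (U `&` V)) => //; first exact: openI.
by apply: sX => //; [exact: openI|apply: smooth_on_sub sf => q []].
Qed.

Lemma eq_smooth_field U X Y : (forall q, U q -> X q = Y q) ->
  smooth_field U X -> smooth_field U Y.
Proof.
move=> XY sX V f oV sV sf; apply: (eq_smooth_on oV _ (sX V f oV sV sf)) => q Vq.
by rewrite /app XY//; exact: sV.
Qed.

Lemma smooth_contract U (a : form1 M) X : open U -> smooth_form1 U a -> smooth_field U X ->
  smooth_on U (Defs.contract a X).
Proof. by move=> oU sa sX; apply: sa. Qed.

Section Bracket.
Variables (U : set M) (p : M).
Hypotheses (oU : open U) (Up : U p).

(** The content is that the commutator is again a derivation on germs, the second-order terms
    cancelling, so that [insubd] in [bracket] does not return its default 0. *)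
Lemma bracketE X Y f : smooth_field U X -> smooth_field U Y -> smooth_at p f ->
  val (bracket X Y p) f = val (X p) (app Y f) - val (Y p) (app X f).
Proof.
move=> sX sY sf; rewrite /bracket insubdK; first by rewrite asboolT.
have aX g : smooth_at p g -> smooth_at p (app X g) by move=> sg; exact: app_smooth_at oU Up sX sg.
have aY g : smooth_at p g -> smooth_at p (app Y g) by move=> sg; exact: app_smooth_at oU Up sY sg.
(* Linearity and the Leibniz rule for [app Z] are needed on a neighbourhood, not just at p, because
   they are differentiated once more. *)
have lin Z (a : C) g g' : smooth_at p g -> smooth_at p g' -> smooth_field U Z ->
    exists V, [/\ open V, V p, smooth_on V (app Z (fun q => a * g q + g' q)),
    forall q, V q -> app Z (fun q => a * g q + g' q) q = a * app Z g q + app Z g' q &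
    forall q, V q -> app Z (fun q => g q * g' q) q = app Z g q * g' q + g q * app Z g' q].
  move=> sg sg' sZ; have [V [oV Vp vg vg']] := smooth_at2 sg sg'.
  exists (U `&` V); split=> //; first exact: openI.
  - apply: sZ => //; [exact: openI|apply: (@smooth_on_sub _ _ V); first by move=> q []].
    by apply: smooth_on_add => //; apply: smooth_on_mul => //; exact: smooth_on_cst.
  - move=> q [Uq Vq]; have [+ _ _ _] := ct_tangent (Z q); apply.
      exact: smooth_atW vg.
    exact: smooth_atW vg'.
  - move=> q [Uq Vq]; apply: ct_mul.
      exact: smooth_atW vg.
    exact: smooth_atW vg'.
apply/asboolP; split.
- move=> a g g' sg sg'.
  have sl : smooth_at p (fun q => a * g q + g' q).
    by apply: smooth_at_add => //; apply: smooth_at_mul => //; exact: smooth_at_cst.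
  rewrite !asboolT//.
  have [V [oV Vp lV E _]] := lin _ a _ _ sg sg' sX.
  have [V' [oV' Vp' lV' E' _]] := lin _ a _ _ sg sg' sY.
  rewrite (ct_local (Y p) oV Vp lV E) (ct_local (X p) oV' Vp' lV' E').
  have [LX _ _ _] := ct_tangent (X p); rewrite LX; [|exact: aY..].
  have [LY _ _ _] := ct_tangent (Y p); rewrite LY; [|exact: aX..].
  ring.
- move=> g g' sg sg'.
  have sm := smooth_at_mul sg sg'.
  rewrite !asboolT//.
  have [V [oV Vp _ _ E]] := lin _ 1 _ _ sg sg' sX.
  have [V' [oV' Vp' _ _ E']] := lin _ 1 _ _ sg sg' sY.
  have loc Z W (v : CT p) : smooth_field U Z -> open W -> W p ->
      (forall q, W q -> app Z (fun q => g q * g' q) q = app Z g q * g' q + g q * app Z g' q) ->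
      val v (app Z (fun q => g q * g' q)) =
      val v (fun q => app Z g q * g' q + g q * app Z g' q).
    move=> sZ oW Wp EW; have [W' [oW' Wp' s]] := app_smooth_at oU Up sZ sm.
    apply: (@ct_local _ _ (W `&` W')) => //; first exact: openI.
      by apply: smooth_on_sub s => q [].
    by move=> q [/EW].
  rewrite (loc Y V' _ _ oV')// (loc X V _ _ oV)//.
  have aXg := aX _ sg; have aXg' := aX _ sg'; have aYg := aY _ sg; have aYg' := aY _ sg'.
  rewrite !ct_add ?ct_mul //; try exact: smooth_at_mul.
  rewrite /app; ring.
- move=> g g' sg sg' gg'.
  rewrite !asboolT//.
  have [V [oV Vp vg vg']] := smooth_at2 sg sg'.
  move: gg'; rewrite -nbhs_nearE nbhsE /= => -[W [oW Wp] WE].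
  have eqa Z : smooth_field U Z -> forall v : CT p, val v (app Z g) = val v (app Z g').
    move=> sZ v; apply: (@ct_local _ _ (U `&` (V `&` W))) => //.
    - by apply: openI => //; exact: openI.
    - apply: sZ => //; first by apply: openI => //; exact: openI.
      by apply: smooth_on_sub vg => q [_ []].
    - move=> q [_ [Vq Wq]]; apply: (@ct_local _ _ (V `&` W)) => //; first exact: openI.
      + by apply: smooth_on_sub vg => r [].
      + by move=> r [_ /WE].
  by rewrite !(eqa _ sX) !(eqa _ sY).
- by move=> g nsg; rewrite asboolF.
Qed.

Lemma bracketC X Y : smooth_field U X -> smooth_field U Y ->
  bracket Y X p = - bracket X Y p.
Proof.
by move=> sX sY; apply: ct_ext => f sf; rewrite valN !bracketE// opprB.
Qed.

Lemma bracketDr X Y Z : smooth_field U X -> smooth_field U Y -> smooth_field U Z ->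
  bracket X (fadd Y Z) p = bracket X Y p + bracket X Z p.
Proof.
move=> sX sY sZ; apply: ct_ext => f sf; rewrite valD !bracketE//; last exact: smooth_fadd.
have -> : app (fadd Y Z) f = fun q => app Y f q + app Z f q by [].
rewrite ct_add; [|exact: (app_smooth_at oU Up _ sf)..].
rewrite /fadd valD; ring.
Qed.

Lemma bracketZr X Y g : smooth_field U X -> smooth_field U Y -> smooth_on U g ->
  bracket X (fscale g Y) p = g p *: bracket X Y p + val (X p) g *: Y p.
Proof.
move=> sX sY sg; apply: ct_ext => f sf.
rewrite valD !valZ !bracketE//; last exact: smooth_fscale.
have -> : app (fscale g Y) f = fun q => g q * app Y f q by [].
rewrite ct_mul; [|exact: (smooth_atW oU Up sg)|exact: (app_smooth_at oU Up _ sf)].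
rewrite /fscale valZ /app; ring.
Qed.

Lemma bracketZl X Y g : smooth_field U X -> smooth_field U Y -> smooth_on U g ->
  bracket (fscale g X) Y p = g p *: bracket X Y p - val (Y p) g *: X p.
Proof.
move=> sX sY sg; rewrite bracketC ?bracketZr//; last exact: smooth_fscale.
by rewrite opprD -scalerN -bracketC.
Qed.

Lemma eq_bracket X Y X' Y' : smooth_field U X -> smooth_field U Y ->
  (forall q, U q -> X q = X' q) -> (forall q, U q -> Y q = Y' q) ->
  bracket X Y p = bracket X' Y' p.
Proof.
move=> sX sY XX YY.
have sX' : smooth_field U X' by exact: eq_smooth_field sX.
have sY' : smooth_field U Y' by exact: eq_smooth_field sY.
apply: ct_ext => f sf; rewrite !bracketE// XX// YY//; congr (_ - _).
  have [V [oV Vp sfV]] := sf.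
  apply: (@ct_local _ _ (U `&` V)) => //; first exact: openI.
    by apply: sY => //; [exact: openI|apply: smooth_on_sub sfV => q []].
  by move=> q [Uq _]; rewrite /app YY.
have [V [oV Vp sfV]] := sf.
apply: (@ct_local _ _ (U `&` V)) => //; first exact: openI.
  by apply: sX => //; [exact: openI|apply: smooth_on_sub sfV => q []].
by move=> q [Uq _]; rewrite /app XX.
Qed.

Lemma tconj_bracket X Y : smooth_field U X -> smooth_field U Y ->
  tconj (bracket X Y p) = bracket (conj_field X) (conj_field Y) p.
Proof.
move=> sX sY; apply: ct_ext => f sf.
have sfc := smooth_at_conj sf.
rewrite [RHS]bracketE//; [|exact: smooth_conj_field..].
rewrite tconjE bracketE// rmorphB.
have cc Z (v : CT p) : val (tconj v) (app (conj_field Z) f) =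
    (val v (app Z (fun q => (f q)^*)))^*.
  rewrite tconjE; congr (_^*); congr (val v _); apply/funext => q.
  by rewrite /app /conj_field tconjE conjCK.
by rewrite /conj_field !cc.
Qed.
End Bracket.
End Tangent.

(** * Pseudohermitian frames *)

Section CRLinear.
Variables (R : realType) (M : oriented_manifold3 R) (S : CRstructure M) (p : M).
Local Notation C := R[i].
Implicit Types v w X Y : CT p.

Lemma Jd0 : Jd S (0 : CT p) = 0.
Proof.
have h0 : Hd S (0 : CT p) by exact: H_zero.
have := J_lin 1 h0 h0; rewrite scaler0 addr0 scale1r => /(congr1 (+%R^~ (- Jd S 0))).
by rewrite subrr addrK.
Qed.

Lemma Jd_comb (a b : R) X Y : Hd S X -> Hd S Y ->
  Jd S (a%:C *: X + b%:C *: Y) = a%:C *: Jd S X + b%:C *: Jd S Y.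
Proof.
move=> hX hY; have h0 : Hd S (0 : CT p) by exact: H_zero.
have hbY : Hd S (b%:C *: Y) by rewrite -[_ *: _]addr0; exact: H_lin.
rewrite J_lin//; congr (_ + _).
by have := J_lin b hY h0; rewrite Jd0 !addr0.
Qed.

Let i2 : ('i : C) * 'i = -1. Proof. by rewrite -expr2 sqrCi. Qed.
Let iconj : ('i : C)^* = - 'i. Proof. exact: conjCi. Qed.
Let niconj : (- 'i : C)^* = 'i. Proof. by rewrite -iconj conjCK. Qed.
Let two0 : (2 : C) != 0. Proof. by rewrite pnatr_eq0. Qed.

(** X, Y, JX and JY are real, so adding the eigenvector equation to its conjugate gives 2 JX = - 2
    Y. *)
Lemma T10P v : T10 S v -> exists2 X, Hd S X & v = X - 'i *: Jd S X.
Proof.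
move=> [X [Y [hX hY vE jE]]]; exists X => //.
have := congr1 (@tconj _ _ p) jE.
rewrite vE !(tconjD, tconjZ) !iconj !(H_real (J_H hX), H_real (J_H hY), H_real hX, H_real hY).
move=> jE'; have : 2 *: Jd S X = 2 *: (- Y).
  have -> : 2 *: Jd S X = (Jd S X + 'i *: Jd S Y) + (Jd S X + - 'i *: Jd S Y).
    by rewrite scaleNr addrACA subrr addr0 scaler_nat mulr2n.
  rewrite jE jE' vE !scalerDr !scalerA i2 mulrNN i2 !scaleNr scale1r addrACA subrr add0r.
  by rewrite scaler_nat mulr2n.
by move/(scalerI two0) => ->; rewrite scalerN opprK.
Qed.

Lemma T01P v : T01 S v -> exists2 X, Hd S X & v = X + 'i *: Jd S X.
Proof.
move=> [X [Y [hX hY vE jE]]]; exists X => //.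
have := congr1 (@tconj _ _ p) jE.
rewrite vE !(tconjD, tconjZ) !(niconj, iconj) !(H_real (J_H hX), H_real (J_H hY), H_real hX, H_real hY).
move=> jE'; have : 2 *: Jd S X = 2 *: Y.
  have -> : 2 *: Jd S X = (Jd S X + 'i *: Jd S Y) + (Jd S X + - 'i *: Jd S Y).
    by rewrite scaleNr addrACA subrr addr0 scaler_nat mulr2n.
  rewrite jE jE' vE ?opprK !scalerDr !scalerA !mulNr mulrN i2 !opprK !scaleNr scale1r.
  by rewrite addrACA addNr add0r scaler_nat mulr2n.
by move/(scalerI two0) => ->.
Qed.

Lemma Hd_span X v : Hd S X -> X != 0 -> Hd S v ->
  exists a b : R, v = a%:C *: X + b%:C *: Jd S X.
Proof.
move=> hX X0 hv.
have [U [X' [[_ Up] _ _ hX' sp]]] := H_frame S p.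
have [hX'p _] := hX' p Up.
have [a [b XE]] := sp p X Up hX; have [a' [b' vE]] := sp p v Up hv.
have JE : Jd S X = (- b)%:C *: X' p + a%:C *: Jd S (X' p).
  rewrite XE Jd_comb//; last exact: J_H.
  by rewrite J_sq// scalerN rmorphN scaleNr addrC.
have n0 : a ^+ 2 + b ^+ 2 != 0.
  apply: contraNneq X0 => /eqP; rewrite paddr_eq0 ?sqr_ge0// !sqrf_eq0 => /andP[/eqP a0 /eqP b0].
  by rewrite XE a0 b0 !scale0r addr0.
(* With J as multiplication by i, these are the real and imaginary parts of (a' + i b') / (a + i
   b). *)
exists ((a' * a + b' * b) / (a ^+ 2 + b ^+ 2)), ((b' * a - a' * b) / (a ^+ 2 + b ^+ 2)).
rewrite JE {1}XE vE !scalerDr !scalerA -!rmorphM addrACA -!scalerDl -!rmorphD.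
by congr (_%:C *: _ + _%:C *: _); field.
Qed.
End CRLinear.

Section FrameLinear.
Variables (R : realType) (M : oriented_manifold3 R) (S : CRstructure M) (F : psh_frame S).
Variables (p : M).
Hypothesis Fp : dm F p.
Local Notation C := R[i].
Implicit Types v w : CT p.

Let i2 : ('i : C) * 'i = -1. Proof. by rewrite -expr2 sqrCi. Qed.

Lemma th_Hd v : Hd S v -> th F p v = 0.
Proof.
by move=> hv; have [_ _ + _] := th_contact F => /(_ p v Fp (H_real hv)) [_]; apply.
Qed.

Lemma Z1_form : exists X : CT p, [/\ Hd S X, X != 0, Z1 F p = X - 'i *: Jd S X
  & Z1b F p = X + 'i *: Jd S X].
Proof.
have [/T10P[X hX ZE] Z0] := Z1_T10 Fp; exists X; split=> //.
  by apply: contraNneq Z0 => X0; rewrite ZE X0 Jd0 scaler0 subr0.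
rewrite /Z1b /conj_field ZE tconjD tconjN tconjZ conjCi (H_real hX) (H_real (J_H hX)).
by rewrite scaleNr opprK.
Qed.

Lemma Hd_Z v : Hd S v -> exists a b : C, v = a *: Z1 F p + b *: Z1b F p.
Proof.
move=> hv; have [X [hX X0 -> ->]] := Z1_form.
have [a [b ->]] := Hd_span hX X0 hv.
exists ((a%:C + 'i * b%:C) / 2), ((a%:C - 'i * b%:C) / 2).
rewrite !scalerDr !scalerN !scalerA addrACA -scalerDl -scaleNr -scalerDl.
congr (_ *: _ + _ *: _); first by field.
by field: i2.
Qed.

Lemma T01_Z v : T01 S v -> exists a : C, v = a *: Z1b F p.
Proof.
move=> /T01P[Y hY ->]; have [X [hX X0 _ ->]] := Z1_form.
have [a [b ->]] := Hd_span hX X0 hY.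
exists (a%:C - 'i * b%:C).
rewrite Jd_comb//; last exact: J_H.
rewrite J_sq// !scalerDr !scalerN !scalerA [X in _ + X = _]addrC addrACA -scaleNr -!scalerDl.
by congr (_ *: _ + _ *: _); ring: i2.
Qed.

Lemma form_comb (a : {linear CT p -> C^o}) (b c : C) v w :
  a (b *: v + c *: w) = b * a v + c * a w.
Proof. by rewrite linearD !linearZ. Qed.

Lemma form_comb3 (a : {linear CT p -> C^o}) (b c d : C) u v w :
  a (b *: u + c *: v + d *: w) = b * a u + c * a v + d * a w.
Proof. by rewrite !linearD !linearZ. Qed.

Lemma th_Z1 : th F p (Z1 F p) = 0.
Proof.
have [X [hX _ -> _]] := Z1_form.
by rewrite -[X in X - _]scale1r -scaleNr form_comb !th_Hd ?mulr0 ?addr0//; exact: J_H.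
Qed.

Lemma th_Z1b : th F p (Z1b F p) = 0.
Proof.
have [X [hX _ _ ->]] := Z1_form.
by rewrite -[X in X + _]scale1r form_comb !th_Hd ?mulr0 ?addr0//; exact: J_H.
Qed.

Lemma th_conj v : th F p (tconj v) = (th F p v)^*.
Proof. by have [_ + _ _] := th_contact F; apply. Qed.

Definition th1b : CT p -> C := conj_form (th1 F p).

Lemma th1bD v w : th1b (v + w) = th1b v + th1b w.
Proof. by rewrite /th1b /conj_form tconjD linearD rmorphD. Qed.
Lemma th1bZ a v : th1b (a *: v) = a * th1b v.
Proof. by rewrite /th1b /conj_form tconjZ linearZ rmorphM /= conjCK. Qed.

Lemma th1_Z1 : th1 F p (Z1 F p) = 1. Proof. by have [] := th1_dual Fp. Qed.
Lemma th1_Z1b : th1 F p (Z1b F p) = 0. Proof. by have [] := th1_dual Fp. Qed.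
Lemma th1_Tf : th1 F p (Tf F p) = 0. Proof. by have [] := th1_dual Fp. Qed.
Lemma th1b_Z1 : th1b (Z1 F p) = 0.
Proof. by rewrite /th1b /conj_form; have [_ -> _] := th1_dual Fp; rewrite conjC0. Qed.
Lemma th1b_Z1b : th1b (Z1b F p) = 1.
Proof. by rewrite /th1b /conj_form /Z1b /conj_field tconjK th1_Z1 conjC1. Qed.
Lemma th1b_Tf : th1b (Tf F p) = 0.
Proof. by rewrite /th1b /conj_form Tf_real// th1_Tf conjC0. Qed.

(** A real vector killed by [th] lies in H, hence in the span of Z_1 and Z_{bar 1}. This is applied
    to v' + conj v' and i v' + conj (i v'), where v' = v - th(v) T; together they recover v'. *)
Lemma frame_dec v :
  v = th F p v *: Tf F p + th1 F p v *: Z1 F p + th1b v *: Z1b F p.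
Proof.
have two0 : (2 : C) != 0 by rewrite pnatr_eq0.
have [v' v'E] : exists v', v' = v - th F p v *: Tf F p by eexists.
have thv' : th F p v' = 0.
  by rewrite v'E linearB linearZ /= Tf_th// /GRing.scale /= mulr1 subrr.
have hre w : th F p w = 0 -> Hd S (w + tconj w).
  move=> w0; have [_ _ + _] := th_contact F => /(_ p (w + tconj w) Fp).
  rewrite tconjD tconjK addrC => /(_ erefl)[+ _]; apply.
  by rewrite linearD th_conj w0 conjC0 addr0.
have [a [b E1]] := Hd_Z (hre v' thv').
have [a' [b' E2]] : exists a b : C, 'i *: v' + tconj ('i *: v') = a *: Z1 F p + b *: Z1b F p.
  by apply: Hd_Z; apply: hre; rewrite linearZ /= thv' /GRing.scale /= mulr0.
have vE : exists a b : C, v' = a *: Z1 F p + b *: Z1b F p.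
  exists ((a - 'i * a') / 2), ((b - 'i * b') / 2); apply: (scalerI two0).
  rewrite [RHS]scalerDr !scalerA ![2 * (_ / 2)]mulrC !divfK//.
  have -> : 2 *: v' = (v' + tconj v') - 'i *: ('i *: v' + tconj ('i *: v')).
    rewrite tconjZ conjCi scalerDr !scalerA mulrN i2 opprK scale1r scaleN1r opprD opprK.
    by rewrite addrACA subrr addr0 scaler_nat mulr2n.
  rewrite E1 E2 !scalerDr !scalerA !scalerBl opprD addrACA.
  by [].
have {}vE : exists a b : C, v = th F p v *: Tf F p + a *: Z1 F p + b *: Z1b F p.
  have [c [d E]] := vE; exists c, d; rewrite -addrA -E v'E addrC subrK //.
have [c [d E]] := vE.
have -> : th1 F p v = c.
  by rewrite E !linearD !linearZ /= th1_Tf th1_Z1 th1_Z1b /GRing.scale /= !mulr0 mulr1 add0r addr0.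
suff -> : th1b v = d by [].
by rewrite E !th1bD !th1bZ th1b_Tf th1b_Z1 th1b_Z1b !mulr0 mulr1 !add0r.
Qed.
End FrameLinear.

Section Brackets.
Variables (R : realType) (M : oriented_manifold3 R) (S : CRstructure M) (F : psh_frame S).
Local Notation C := R[i].
Local Notation U := (dm F).
Local Notation Z := (Z1 F).
Local Notation Zb := (Z1b F).
Local Notation T := (Tf F).
Implicit Types (p : M).

Let oU := dm_open F.
Let sZ : smooth_field U Z := @Z1_smooth _ _ _ F.
Let sT : smooth_field U T := @Tf_smooth _ _ _ F.

Lemma Z1b_smooth : smooth_field U Zb. Proof. exact: smooth_conj_field sZ. Qed.
Let sZb := Z1b_smooth.

Lemma d1_bracket (a : form1 M) (w : form2 M) X Y p : U p -> d1_eq U a w ->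
  smooth_field U X -> smooth_field U Y ->
  a p (bracket X Y p) = val (X p) (contract a Y) - val (Y p) (contract a X) - w p (X p) (Y p).
Proof.
move=> Up dw sX sY; rewrite -(dw U X Y oU _ sX sY p Up)// /d1.
by rewrite opprB addrC subrK.
Qed.

Lemma h_neq0 p : U p -> h F p != 0.
Proof. by move=> Up; rewrite gt_eqF// h_gt0. Qed.

Lemma h_conj p : U p -> (h F p)^* = h F p.
Proof. by move=> Up; apply: conj_Creal; rewrite gtr0_real// h_gt0. Qed.

Lemma conj_Zb : conj_field Zb = Z.
Proof. by apply: functional_extensionality_dep => q; rewrite /conj_field tconjK. Qed.

Let c0 (a : form1 M) X (k : C) p (v : CT p) : U p -> (forall q, U q -> a q (X q) = k) ->
  val v (contract a X) = 0.
Proof. by move=> Up aX; exact: (ct_local_cst v oU Up aX). Qed.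

Let tZ : forall q, U q -> th F q (Z q) = 0 := fun q Uq => th_Z1 Uq.
Let tZb : forall q, U q -> th F q (Zb q) = 0 := fun q Uq => th_Z1b Uq.
Let tT : forall q, U q -> th F q (T q) = 1 := fun q Uq => Tf_th Uq.
Let uZ : forall q, U q -> th1 F q (Z q) = 1 := fun q Uq => th1_Z1 Uq.
Let uZb : forall q, U q -> th1 F q (Zb q) = 0 := fun q Uq => th1_Z1b Uq.
Let uT : forall q, U q -> th1 F q (T q) = 0 := fun q Uq => th1_Tf Uq.

(** The coframe is constant on the frame, so the formula for the exterior derivative reduces to
    a([X, Y]) = - da(X, Y) and the structure equations give the components. The last one is the
    conjugate of a component of [Z_{bar 1}, Z_1]. *)
Lemma bracket_ZZb p : U p -> bracket Z Zb p =
  - ('i * h F p) *: T p + - om F p (Zb p) *: Z p + (om F p (Zb p))^* *: Zb p.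
Proof.
move=> Up.
have E1 : th1 F p (bracket Z Zb p) = - om F p (Zb p).
  rewrite (d1_bracket Up (@th1_eq _ _ _ F) sZ sZb) (c0 _ Up uZ) (c0 _ Up uZb).
  rewrite /wedge11 uZ// uZb// tZ// tZb//; ring.
rewrite {1}(frame_dec Up (bracket Z Zb p)) E1; congr (_ *: _ + _ + _ *: _).
  rewrite (d1_bracket Up (@th_eq _ _ _ F) sZ sZb) (c0 _ Up tZ) (c0 _ Up tZb).
  have := th1b_Z1 Up; have := th1b_Z1b Up; rewrite /th1b /wedge11 => -> ->.
  by rewrite uZ//; ring.
rewrite /th1b /conj_form (tconj_bracket oU Up sZ sZb) conj_Zb.
by rewrite (bracketC oU Up)// linearN /= E1 opprK.
Qed.

Lemma bracket_ZT p : U p -> bracket Z T p =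
  - om F p (T p) *: Z p + (tors F p)^* *: Zb p.
Proof.
move=> Up; rewrite {1}(frame_dec Up (bracket Z T p)).
have -> : th F p (bracket Z T p) = 0.
  rewrite (bracketC oU Up)// linearN /=.
  have := @Tf_dth _ _ _ F U Z oU (@subset_refl _ _) sZ p Up.
  rewrite /d1 (c0 _ Up tZ) (c0 _ Up tT) subrr add0r => /eqP.
  by rewrite oppr_eq0 => /eqP ->; rewrite oppr0.
rewrite scale0r add0r; congr (_ *: _ + _ *: _).
  rewrite (d1_bracket Up (@th1_eq _ _ _ F) sZ sT) (c0 _ Up uZ) (c0 _ Up uT).
  have := th1b_Z1 Up; have := th1b_Tf Up; rewrite /th1b /wedge11 => -> ->.
  by rewrite uZ// uT// tZ// tT//; ring.
rewrite /th1b /conj_form (tconj_bracket oU Up sZ sT).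
rewrite -(@eq_bracket _ _ U p oU Up Zb T)//; last by move=> q Uq; rewrite /conj_field Tf_real.
rewrite (d1_bracket Up (@th1_eq _ _ _ F) sZb sT) (c0 _ Up uZb) (c0 _ Up uT).
have := th1b_Z1b Up; have := th1b_Tf Up; rewrite /th1b /wedge11 => -> ->.
rewrite uZb// uT// tZb// tT//; congr (_^*); ring.
Qed.

Definition Yf : field M := fscale (fun q => (h F q)^-1) Zb.
Definition Tt : field M := fscale (fun=> - 'i) T.
Definition omZ (p : M) : C := om F p (Z p).
Definition omY (p : M) : C := om F p (Yf p).
Definition omT (p : M) : C := om F p (Tt p).
Definition iA11 (p : M) : C := 'i * A11 F p.
Definition iA11up (p : M) : C := - 'i * tors F p / h F p.

Let sh : smooth_on U (h F) := @h_smooth _ _ _ F.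
Let stors : smooth_on U (tors F) := @tors_smooth _ _ _ F.

Lemma hV_smooth : smooth_on U (fun q => (h F q)^-1).
Proof. by apply: smooth_on_inv => // q; exact: h_neq0. Qed.

Lemma Yf_smooth : smooth_field U Yf.
Proof. exact: smooth_fscale hV_smooth sZb. Qed.

Lemma Tt_smooth : smooth_field U Tt.
Proof. by apply: smooth_fscale sT; exact: smooth_on_cst. Qed.

Lemma omZ_smooth : smooth_on U omZ.
Proof. exact: smooth_contract (@om_smooth _ _ _ F) sZ. Qed.
Lemma omY_smooth : smooth_on U omY.
Proof. exact: smooth_contract (@om_smooth _ _ _ F) Yf_smooth. Qed.
Lemma omT_smooth : smooth_on U omT.
Proof. exact: smooth_contract (@om_smooth _ _ _ F) Tt_smooth. Qed.

Lemma A11_smooth : smooth_on U (A11 F).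
Proof. by apply: smooth_on_mul => //; exact: smooth_on_conj. Qed.
Lemma iA11_smooth : smooth_on U iA11.
Proof. by apply: smooth_on_mul => //; [exact: smooth_on_cst|exact: A11_smooth]. Qed.
Lemma iA11up_smooth : smooth_on U iA11up.
Proof.
apply: smooth_on_mul => //; last exact: hV_smooth.
by apply: smooth_on_mul => //; exact: smooth_on_cst.
Qed.

Section AtPoint.
Variable p : M.
Hypothesis Up : U p.

Let at_p (f : M -> C) : smooth_on U f -> smooth_at p f.
Proof. exact: smooth_atW. Qed.

Lemma ct_hV (v : CT p) : val v (fun q => (h F q)^-1) = - (h F p)^-1 * (h F p)^-1 * val v (h F).
Proof.
have h0 := h_neq0 Up.
have /eqP := ct_local_cst v oU Up (f := fun q => h F q * (h F q)^-1) (a := 1)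
  (fun q Uq => mulfV (h_neq0 Uq)).
rewrite ct_mul; [|exact: at_p sh|exact: at_p hV_smooth].
rewrite addrC addr_eq0 => /eqP H.
apply: (mulfI h0); rewrite H; by field.
Qed.

Lemma Zh : val (Z p) (h F) = h F p * (omZ p + (om F p (Zb p))^*).
Proof. by rewrite [omZ p + _](om_eq (Z p) Up) mulrA mulfV ?mul1r// h_neq0. Qed.

Lemma Th : val (T p) (h F) = h F p * (om F p (T p) + (om F p (T p))^*).
Proof.
have := om_eq (T p) Up; rewrite /conj_form Tf_real// => ->.
by rewrite mulrA mulfV ?mul1r// h_neq0.
Qed.

Lemma omYE : omY p = (h F p)^-1 * om F p (Zb p).
Proof. by rewrite /omY /Yf /fscale linearZ. Qed.

(** Raising the index removes the conjugation: by om + conj om = h^{-1} dh, the derivative of h^{-1}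
    along Z_1 cancels the conjugate of om(Z_{bar 1}). *)
Lemma bracket_ZY : bracket Z Yf p = Tt p - omY p *: Z p - omZ p *: Yf p.
Proof.
have h0 := h_neq0 Up.
rewrite (bracketZr oU Up sZ sZb hV_smooth) bracket_ZZb// ct_hV Zh.
rewrite omYE; apply: ct_ext => f _; rewrite /Tt /Yf /fscale !(valD, valZ, valN); by field.
Qed.

Lemma bracket_ZTt : bracket Z Tt p = - omT p *: Z p - iA11 p *: Yf p.
Proof.
have h0 := h_neq0 Up.
rewrite (bracketZr oU Up sZ sT (smooth_on_cst _ _)) bracket_ZT// ct_cst.
have -> : omT p = - 'i * om F p (T p) by rewrite /omT /Tt /fscale linearZ.
apply: ct_ext => f _; rewrite /iA11 /A11 /Yf /fscale !(valD, valZ, valN); by field.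
Qed.

Lemma bracket_YTt : bracket Yf Tt p = omT p *: Yf p + iA11up p *: Z p.
Proof.
have h0 := h_neq0 Up.
have E : bracket Zb T p = - (om F p (T p))^* *: Zb p + tors F p *: Z p.
  rewrite (@eq_bracket _ _ U p oU Up Zb T Zb (conj_field T))//; last first.
    by move=> q Uq; rewrite /conj_field Tf_real.
  rewrite -(tconj_bracket oU Up sZ sT) bracket_ZT// tconjD !tconjZ conjCK rmorphN.
  by rewrite /Z1b /conj_field tconjK.
rewrite (bracketZr oU Up Yf_smooth sT (smooth_on_cst _ _)) ct_cst.
rewrite (bracketZl oU Up sZb sT hV_smooth) E ct_hV Th.
have -> : omT p = - 'i * om F p (T p) by rewrite /omT /Tt /fscale linearZ.
apply: ct_ext => f _; rewrite /iA11up /Yf /fscale !(valD, valZ, valN); by field.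
Qed.

Let thY : th F p (Yf p) = 0.
Proof. by rewrite /Yf /fscale linearZ /= th_Z1b// /GRing.scale /= mulr0. Qed.
Let thT : th F p (Tt p) = - 'i.
Proof. by rewrite /Tt /fscale linearZ /= Tf_th// /GRing.scale /= mulr1. Qed.
Let t1Y : th1 F p (Yf p) = 0.
Proof. by rewrite /Yf /fscale linearZ /= th1_Z1b// /GRing.scale /= mulr0. Qed.
Let t1T : th1 F p (Tt p) = 0.
Proof. by rewrite /Tt /fscale linearZ /= th1_Tf// /GRing.scale /= mulr0. Qed.
Let tbY : conj_form (th1 F p) (Yf p) = (h F p)^-1.
Proof. by rewrite -/(@th1b _ _ _ F p) /Yf /fscale th1bZ th1b_Z1b// mulr1. Qed.
Let tbT : conj_form (th1 F p) (Tt p) = 0.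
Proof. by rewrite -/(@th1b _ _ _ F p) /Tt /fscale th1bZ th1b_Tf// mulr0. Qed.
Let tbZ : conj_form (th1 F p) (Z p) = 0.
Proof. by rewrite -/(@th1b _ _ _ F p) th1b_Z1. Qed.

Lemma basis_inj (a b c a' b' c' : C) :
  a *: Tt p + b *: Z p + c *: Yf p = a' *: Tt p + b' *: Z p + c' *: Yf p ->
  [/\ a = a', b = b' & c = c'].
Proof.
have i0 : - 'i != 0 :> C by rewrite oppr_eq0 neq0Ci.
have h0 : (h F p)^-1 != 0 by rewrite invr_eq0 h_neq0.
move=> E; split.
- have := congr1 (th F p) E.
  rewrite !form_comb3 thT th_Z1// thY !mulr0 !addr0.
  by move/(mulIf i0).
- have := congr1 (th1 F p) E.
  by rewrite !form_comb3 t1T th1_Z1// t1Y !mulr0 !addr0 !add0r !mulr1.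
have := congr1 (@th1b _ _ _ F p) E.
rewrite !th1bD !(th1bZ F _ (Tt p), th1bZ F _ (Z p), th1bZ F _ (Yf p)).
by rewrite /th1b tbT tbZ tbY !mulr0 !add0r => /(mulIf h0).
Qed.

Variable Rs : M -> C.
Hypothesis Rs_eq : d1_eq U (om F) (fun p v w =>
       Rs p * h F p * wedge11 (th1 F p) (conj_form (th1 F p)) v w
       + divA F p * wedge11 (th1 F p) (th F p) v w
       - (divA F p)^* * wedge11 (conj_form (th1 F p)) (th F p) v w).

Lemma curvature_ZY : val (Z p) omY = val (Yf p) omZ + omT p - 2 * omZ p * omY p + Rs p.
Proof.
have h0 := h_neq0 Up.
have := d1_bracket Up Rs_eq sZ Yf_smooth.
have -> : bracket Z Yf p = 1 *: Tt p + - omY p *: Z p + - omZ p *: Yf p.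
  by rewrite bracket_ZY scale1r !scaleNr.
rewrite form_comb3 -/(omT p) -/(omY p) -/(omZ p) /wedge11 thY t1Y tbY tbZ th_Z1// th1_Z1//.
move=> E; apply/eqP; rewrite -subr_eq0 -oppr_eq0; apply/eqP.
move/eqP: E; rewrite -subr_eq0 => /eqP E.
by rewrite -[RHS]E /contract; field.
Qed.

Lemma curvature_ZT : val (Z p) omT =
  val (Tt p) omZ - omT p * omZ p + iA11 p * omY p - val (Yf p) iA11.
Proof.
have h0 := h_neq0 Up.
have := d1_bracket Up Rs_eq sZ Tt_smooth.
have -> : bracket Z Tt p = 0 *: Tt p + - omT p *: Z p + - iA11 p *: Yf p.
  by rewrite bracket_ZTt scale0r add0r !scaleNr.
rewrite form_comb3 -/(omT p) -/(omY p) -/(omZ p) /wedge11 thT t1T tbT tbZ th_Z1// th1_Z1//.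
have -> : val (Yf p) iA11 = 'i * val (Yf p) (A11 F).
  rewrite ct_mul; [|exact: smooth_at_cst|exact: at_p A11_smooth].
  by rewrite ct_cst mul0r add0r.
have -> : divA F p = val (Yf p) (A11 F) - 2 * omY p * A11 F p.
  by rewrite /divA /nabt_up /nabt omYE /Yf /fscale valZ; field.
rewrite /iA11 => E; apply/eqP; rewrite -subr_eq0 -oppr_eq0; apply/eqP.
move/eqP: E; rewrite -subr_eq0 => /eqP E.
by rewrite -[RHS]E /contract; field.
Qed.

Lemma curvature_YT : val (Yf p) omT =
  val (Tt p) omY + omT p * omY p - val (Z p) iA11up - omZ p * iA11up p.
Proof.
have h0 := h_neq0 Up.
have := d1_bracket Up Rs_eq Yf_smooth Tt_smooth.
have -> : bracket Yf Tt p = 0 *: Tt p + iA11up p *: Z p + omT p *: Yf p.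
  by rewrite bracket_YTt scale0r add0r addrC.
rewrite form_comb3 -/(omT p) -/(omY p) -/(omZ p) /wedge11 thT t1T tbT thY t1Y tbY.
have -> : val (Z p) iA11up = - 'i * (val (Z p) (tors F) / h F p
    - tors F p / h F p * (omZ p + (om F p (Zb p))^*)).
  rewrite /iA11up ct_mul; last 1 [exact: at_p hV_smooth].
    rewrite ct_mul; [|exact: smooth_at_cst|exact: at_p stors].
    by rewrite ct_cst ct_hV Zh; field.
  by apply: smooth_at_mul; [exact: smooth_at_cst|exact: at_p stors].
have -> : (divA F p)^* = val (Z p) (tors F) + (omZ p + (om F p (Zb p))^*) * tors F p
    - 2 * (om F p (Zb p))^* * tors F p.
  rewrite /divA /nabt_up /nabt !(conjM, conjD, conjN, conjV, conjz) h_conj//.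
  have -> : (val (Zb p) (A11 F))^* = val (Z p) (fun q => h F q * tors F q).
    rewrite tconjE conjCK; apply: (ct_local _ oU Up).
      by apply: smooth_on_conj => //; exact: A11_smooth.
    by move=> q Uq; rewrite /A11 rmorphM /= h_conj// conjCK.
  rewrite ct_mul; [|exact: at_p sh|exact: at_p stors].
  by rewrite Zh /A11 ?conjM ?h_conj// ?conjCK; field.
rewrite /iA11up => E; apply/eqP; rewrite -subr_eq0 -oppr_eq0; apply/eqP.
move/eqP: E; rewrite -subr_eq0 => /eqP E.
by rewrite -[RHS]E /contract; field.
Qed.
End AtPoint.
End Brackets.

(** * The ring of smooth functions on an open set *)

Section SmoothRing.
Variables (R : realType) (M : oriented_manifold3 R).
Local Notation C := R[i].

Definition opens := {V : set M | open V}.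
Implicit Types (V : opens) (p : M).

(** Tangent vectors act on functions on all of M, so functions on V are extended by 0. At points of
    V only germs matter, and the default value has no effect there. *)
Definition ext (V : opens) (f : {q : M | sval V q} -> C) : M -> C := fun q =>
  match pselect (sval V q) with left Vq => f (exist _ q Vq) | right _ => 0 end.

Lemma extE V f p (Vp : sval V p) : @ext V f p = f (exist _ p Vp).
Proof.
by rewrite /ext; case: pselect => // Vp'; congr (f (exist _ _ _)); exact: Prop_irrelevance.
Qed.

(* Functions on V itself, rather than on M, so that identities valid on V are
   equalities in the ring of smooth functions. *)
Definition smooth_pred V : {pred ({q : M | sval V q} -> C)} :=
  fun f => `[< smooth_on (sval V) (ext f) >].

Fact smooth_subring V : subring_closed (@smooth_pred V).
Proof.
have oV := svalP V; split.
- apply/asboolP; apply: (eq_smooth_on oV _ (smooth_on_cst (sval V) 1)) => p Vp.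
  by rewrite (extE _ Vp).
- move=> f g /asboolP sf /asboolP sg; apply/asboolP.
  apply: (eq_smooth_on oV _ (smooth_on_add oV sf (smooth_on_opp oV sg))) => p Vp.
  by rewrite !(extE _ Vp).
- move=> f g /asboolP sf /asboolP sg; apply/asboolP.
  apply: (eq_smooth_on oV _ (smooth_on_mul oV sf sg)) => p Vp.
  by rewrite !(extE _ Vp).
Qed.

HB.instance Definition _ V :=
  GRing.isSubringClosed.Build ({q : M | sval V q} -> C) (@smooth_pred V) (@smooth_subring V).

Definition smoothfun V := {f : ({q : M | sval V q} -> C) | smooth_pred f}.

HB.instance Definition _ V := SubType.on (smoothfun V).
HB.instance Definition _ V := [Choice of smoothfun V by <:].
HB.instance Definition _ V := 
  GRing.SubChoice_isSubComPzRing.Build _ _ (smoothfun V) (@smooth_subring V).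

Definition ev V (f : smoothfun V) : M -> C := ext (val f).

Lemma ev_smooth V (f : smoothfun V) : smooth_on (sval V) (ev f).
Proof. exact/asboolP/(valP f). Qed.

Lemma ev_inj V (f g : smoothfun V) : (forall p, sval V p -> ev f p = ev g p) -> f = g.
Proof.
move=> fg; apply: val_inj; apply/funext => -[p Vp].
by have := fg p Vp; rewrite /ev !(extE _ Vp).
Qed.

Fact smooth_pred_res V (g : M -> C) : smooth_on (sval V) g ->
  smooth_pred (fun q : {q : M | sval V q} => g (sval q)).
Proof.
move=> sg; apply/asboolP; apply: (eq_smooth_on (svalP V) _ sg) => p Vp.
by rewrite (extE _ Vp).
Qed.

Definition smooth_res V (g : M -> C) (sg : smooth_on (sval V) g) : smoothfun V :=
  exist (fun f => is_true (smooth_pred f)) _ (smooth_pred_res sg).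

Section At.
Variables (V : opens) (p : M).
Hypothesis Vp : sval V p.

Lemma ev_res g (sg : smooth_on (sval V) g) : ev (smooth_res sg) p = g p.
Proof. by rewrite /ev (extE _ Vp). Qed.

Lemma evD (f g : smoothfun V) : ev (f + g) p = ev f p + ev g p.
Proof. by rewrite /ev !(extE _ Vp). Qed.
Lemma evM (f g : smoothfun V) : ev (f * g) p = ev f p * ev g p.
Proof. by rewrite /ev !(extE _ Vp). Qed.
Lemma evN (f : smoothfun V) : ev (- f) p = - ev f p.
Proof. by rewrite /ev !(extE _ Vp). Qed.
Lemma ev1 : ev (1 : smoothfun V) p = 1.
Proof. by rewrite /ev !(extE _ Vp). Qed.
Lemma ev0 : ev (0 : smoothfun V) p = 0.
Proof. by rewrite /ev !(extE _ Vp). Qed.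
Lemma ev_nat n : ev (n%:R : smoothfun V) p = n%:R.
Proof. by elim: n => [|n IH]; rewrite ?ev0// -!natr1 evD IH ev1. Qed.
Lemma ev_int (k : int) : ev (k%:~R : smoothfun V) p = k%:~R.
Proof. by case: k => n; rewrite ?NegzE ?mulrNz ?evN -!pmulrn ev_nat. Qed.

Lemma ct_ev (v : CT p) (g : M -> C) (f : smoothfun V) :
  (forall q, sval V q -> ev f q = g q) -> val v (ev f) = val v g.
Proof. by move=> fg; apply: (ct_local _ (svalP V) Vp (@ev_smooth V f)). Qed.

Lemma ev_smooth_at (f : smoothfun V) : smooth_at p (ev f).
Proof. exact: smooth_atW (svalP V) Vp (@ev_smooth V f). Qed.
End At.

Definition evE V p (Vp : sval V p) := (@ev_nat V p Vp, @ev_int V p Vp, @ev1 V p Vp,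
  @ev0 V p Vp, @evD V p Vp, @evM V p Vp, @evN V p Vp).

Section Der.
Variables (V : opens) (X : field M).
Hypothesis sX : smooth_field (sval V) X.

Definition der (f : smoothfun V) : smoothfun V :=
  smooth_res (sX (svalP V) (@subset_refl _ _) (@ev_smooth V f)).

Lemma ev_der f p : sval V p -> ev (der f) p = val (X p) (ev f).
Proof. by move=> Vp; rewrite (ev_res Vp). Qed.

Lemma der_derivation : derivation der.
Proof.
split=> f g; apply: ev_inj => p Vp.
  rewrite (evD Vp) !ev_der// (ct_ev Vp _ (g := fun q => ev f q + ev g q)); last first.
    by move=> q Vq; rewrite (evD Vq).
  by rewrite ct_add //; exact: ev_smooth_at.
rewrite (evD Vp) !(evM Vp) !ev_der// (ct_ev Vp _ (g := fun q => ev f q * ev g q)); last first.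
  by move=> q Vq; rewrite (evM Vq).
by rewrite ct_mul //; exact: ev_smooth_at.
Qed.
End Der.
End SmoothRing.

(** * The calculus of a frame over an open subset of its domain *)

Section FrameCalculus.
Variables (R : realType) (M : oriented_manifold3 R) (S : CRstructure M) (L : cube_root S).
Variables (F : frame L) (V : opens M).
Hypothesis sV : sval V `<=` dm F.
Local Notation C := R[i].
Let oV := svalP V.

Let rs g (sg : smooth_on (dm F) g) : smoothfun V := smooth_res (smooth_on_sub sV sg).

Fact sc_smooth : smooth_on (dm F) (fun q => Rs F q / 12).
Proof.
apply: smooth_on_mul; [exact: dm_open|exact: Rs_smooth|exact: smooth_on_cst].
Qed.
Fact al_smooth : smooth_on (dm F) (fun q => iA11 F q / 3).
Proof.
apply: smooth_on_mul; [exact: dm_open|exact: iA11_smooth|exact: smooth_on_cst].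
Qed.
Fact be_smooth : smooth_on (dm F) (fun q => iA11up F q / 3).
Proof.
apply: smooth_on_mul; [exact: dm_open|exact: iA11up_smooth|exact: smooth_on_cst].
Qed.

Let fZ := smooth_field_sub sV (@Z1_smooth _ _ _ F).
Let fY := smooth_field_sub sV (@Yf_smooth _ _ _ F).
Let fT := smooth_field_sub sV (@Tt_smooth _ _ _ F).
Let dZ0 := der fZ.
Let dY0 := der fY.
Let dT0 := der fT.
Let wZ0 := rs (@omZ_smooth _ _ _ F).
Let wY0 := rs (@omY_smooth _ _ _ F).
Let wT0 := rs (@omT_smooth _ _ _ F).
Let s := rs sc_smooth.
Let a := rs al_smooth.
Let b := rs be_smooth.

Let dev X (sX : smooth_field (sval V) X) Y (sY : smooth_field (sval V) Y) (f : smoothfun V) p :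
  sval V p -> ev (der sX (der sY f)) p = val (X p) (app Y (ev f)).
Proof. by move=> Vp; rewrite ev_der//; apply: (ct_ev Vp) => q Vq; rewrite ev_der. Qed.

Let com X (sX : smooth_field (sval V) X) Y (sY : smooth_field (sval V) Y) (f : smoothfun V) p :
  sval V p -> ev (der sX (der sY f)) p = ev (der sY (der sX f)) p + val (bracket X Y p) (ev f).
Proof.
move=> Vp; rewrite !dev// (bracketE oV Vp sX sY (ev_smooth_at Vp f)); ring.
Qed.

Let dres X (sX : smooth_field (sval V) X) g (sg : smooth_on (dm F) g) p :
  sval V p -> ev (der sX (rs sg)) p = val (X p) g.
Proof. by move=> Vp; rewrite ev_der//; apply: (ct_ev Vp) => q Vq; rewrite (ev_res Vq). Qed.

Let tanc p (v : CT p) (g : M -> C) (k : C) : sval V p -> smooth_on (dm F) g ->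
  val v (fun q => g q * k) = val v g * k.
Proof.
move=> Vp sg; rewrite ct_mul ?ct_cst ?mulr0 ?addr0//; last exact: smooth_at_cst.
by apply: (smooth_atW oV Vp); exact: smooth_on_sub sg.
Qed.

Fact frame_comm_ZY f : dZ0 (dY0 f) = dY0 (dZ0 f) + dT0 f - wY0 * dZ0 f - wZ0 * dY0 f.
Proof.
apply: ev_inj => p Vp; have h0 := h_neq0 (sV Vp); rewrite com// (bracket_ZY (sV Vp)) !(evE Vp) !ev_der// !(ev_res Vp).
by rewrite !(valD, valN, valZ); ring.
Qed.

Fact frame_comm_ZT f : dZ0 (dT0 f) = dT0 (dZ0 f) - wT0 * dZ0 f - 3 * a * dY0 f.
Proof.
apply: ev_inj => p Vp; have h0 := h_neq0 (sV Vp); rewrite com// (bracket_ZTt (sV Vp)) !(evE Vp) !ev_der// !(ev_res Vp).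
by rewrite !(valD, valN, valZ); field.
Qed.

Fact frame_comm_YT f : dY0 (dT0 f) = dT0 (dY0 f) + wT0 * dY0 f + 3 * b * dZ0 f.
Proof.
apply: ev_inj => p Vp; have h0 := h_neq0 (sV Vp); rewrite com// (bracket_YTt (sV Vp)) !(evE Vp) !ev_der// !(ev_res Vp).
by rewrite !(valD, valN, valZ); field.
Qed.

Fact frame_curv_ZY : dZ0 wY0 = dY0 wZ0 + wT0 - 2 * wZ0 * wY0 + 12 * s.
Proof.
apply: ev_inj => p Vp; have h0 := h_neq0 (sV Vp); rewrite dres// (curvature_ZY (sV Vp) (@Rs_eq _ _ _ _ F)).
by rewrite !(evE Vp) dres// !(ev_res Vp); field.
Qed.

Fact frame_curv_ZT : dZ0 wT0 = dT0 wZ0 - wT0 * wZ0 + 3 * a * wY0 - 3 * dY0 a.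
Proof.
apply: ev_inj => p Vp; have h0 := h_neq0 (sV Vp); rewrite dres// (curvature_ZT (sV Vp) (@Rs_eq _ _ _ _ F)).
rewrite !(evE Vp) !dres// !(ev_res Vp) tanc//; last exact: iA11_smooth.
by field.
Qed.

Fact frame_curv_YT : dY0 wT0 = dT0 wY0 + wT0 * wY0 - 3 * dZ0 b - 3 * wZ0 * b.
Proof.
apply: ev_inj => p Vp; have h0 := h_neq0 (sV Vp); rewrite dres// (curvature_YT (sV Vp) (@Rs_eq _ _ _ _ F)).
rewrite !(evE Vp) !dres// !(ev_res Vp) tanc//; last exact: iA11up_smooth.
by field.
Qed.

Definition frame_calculus : calculus (smoothfun V) := Calculus
  (der_derivation fZ) (der_derivation fY) (der_derivation fT)
  frame_comm_ZY frame_comm_ZT frame_comm_YT frame_curv_ZY frame_curv_ZT frame_curv_YT.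

Section Values.
Variable p : M.
Hypothesis Vp : sval V p.
Lemma ev_dZ f : ev (dZ frame_calculus f) p = val (Z1 F p) (ev f). Proof. exact: ev_der. Qed.
Lemma ev_dY f : ev (dY frame_calculus f) p = val (Yf F p) (ev f). Proof. exact: ev_der. Qed.
Lemma ev_dT f : ev (dT frame_calculus f) p = val (Tt F p) (ev f). Proof. exact: ev_der. Qed.
Lemma ev_wZ : ev (wZ frame_calculus) p = omZ F p. Proof. exact: ev_res. Qed.
Lemma ev_wY : ev (wY frame_calculus) p = omY F p. Proof. exact: ev_res. Qed.
Lemma ev_wT : ev (wT frame_calculus) p = omT F p. Proof. exact: ev_res. Qed.
Lemma ev_sc : ev (sc frame_calculus) p = Rs F p / 12. Proof. exact: ev_res. Qed.
Lemma ev_al : ev (al frame_calculus) p = iA11 F p / 3. Proof. exact: ev_res. Qed.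
Lemma ev_be : ev (be frame_calculus) p = iA11up F p / 3. Proof. exact: ev_res. Qed.
End Values.
End FrameCalculus.

(** * The weight (1,0) connection *)

Section Zeta.
Variables (R : realType) (M : oriented_manifold3 R) (S : CRstructure M) (L : cube_root S).
Variable (F : frame L).
Local Notation C := R[i].
Local Notation U := (dm F).
Local Notation Z := (Z1 F).
Local Notation Zb := (Z1b F).
Local Notation T := (Tf F).
Implicit Types (p : M).
Let oU := dm_open F.
Let sZ : smooth_field U Z := @Z1_smooth _ _ _ F.
Let sT : smooth_field U T := @Tf_smooth _ _ _ F.
Let sZb := @Z1b_smooth _ _ _ F.

Definition thth1 : form2 M := fun p v w => wedge11 (th F p) (th1 F p) v w.

Lemma T01_forms p (v : CT p) : U p -> T01 S v -> th F p v = 0 /\ th1 F p v = 0.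
Proof.
move=> Up /(T01_Z Up)[a ->]; rewrite !linearZ /= th_Z1b// th1_Z1b//.
by rewrite /GRing.scale /= !mulr0.
Qed.

Lemma thth1_canonical p : U p -> Defs.canonical S (@thth1 p).
Proof. by move=> Up; exists (th F p), (th1 F p); split=> // v; exact: T01_forms. Qed.

Lemma thth1_smooth : smooth_form2 U thth1.
Proof.
move=> V X Y oV sV sX sY.
have sth W : smooth_field V W -> smooth_on V (contract (th F) W).
  by move=> sW; have [sth _ _ _] := th_contact F; exact: sth.
have sth1 W : smooth_field V W -> smooth_on V (contract (th1 F) W).
  by move=> sW; exact: (@th1_smooth _ _ _ F).
apply: smooth_on_add => //; first by apply: smooth_on_mul => //; [exact: sth|exact: sth1].
by apply: smooth_on_opp => //; apply: smooth_on_mul => //; [exact: sth|exact: sth1].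
Qed.

Lemma Z1b_T01 p : U p -> T01 S (Zb p).
Proof.
move=> Up; have [X [hX _ _ ->]] := Z1_form Up.
exists X, (Jd S X); split=> //; first exact: J_H.
rewrite J_sq//; apply: ct_ext => f _; rewrite !(valD, valN, valZ).
have i2 : ('i : C) * 'i = -1 by rewrite -expr2 sqrCi.
by ring: i2.
Qed.

(** A form vanishing on Z_{bar 1} is a combination of [th] and [th1], so th /\ th1 spans the
    canonical bundle; the coefficient is found by evaluating on (T, Z_1). *)
Lemma canonical_thth1 p (w : CT p -> CT p -> C) : U p -> Defs.canonical S w ->
  w = fun v v' => w (T p) (Z p) * @thth1 p v v'.
Proof.
move=> Up [a [b [ab ->]]]; have [aZb bZb] := ab _ (Z1b_T01 Up).
have dec (c : {linear CT p -> C^o}) v : c (Zb p) = 0 ->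
    c v = th F p v * c (T p) + th1 F p v * c (Z p).
  by move=> c0; rewrite {1}(frame_dec Up v) form_comb3 c0 mulr0 addr0.
apply/funext => v; apply/funext => v'; rewrite /thth1 /wedge11.
rewrite (dec a v aZb) (dec a v' aZb) (dec b v bZb) (dec b v' bZb); ring.
Qed.

Lemma cube_scale p (x : E10 L p) (a : C) (w : CT p -> CT p -> C) : Defs.canonical S w ->
  cube x (fun v v' => a * w v v') = a * cube x w.
Proof.
move=> cw; pose z := fun v v' : CT p => 0 : C.
have cz : Defs.canonical S z.
  exists \0, \0; split; first by [].
  by apply/funext => v; apply/funext => v'; rewrite /wedge11 /= mul0r subrr.
have z0 : cube x z = 0.
  have := cube_lin x (-1) cw cw; rewrite mulN1r addNr => <-; congr cube.
  by apply/funext => v; apply/funext => v'; rewrite mulN1r addNr.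
have := cube_lin x a cw cz; rewrite z0 addr0 => <-; congr cube.
by apply/funext => v; apply/funext => v'; rewrite addr0.
Qed.

Definition cubeg (p : M) : C := cube (ed F p) (@thth1 p).

Lemma zeta_cubeg p : U p -> zetaTZ F p * cubeg p = 1.
Proof.
move=> Up; rewrite /cubeg -cube_scale; last exact: thth1_canonical.
rewrite -(zeta_ed Up); congr cube; apply/esym.
exact: canonical_thth1 (zeta_canonical Up).
Qed.

Lemma cubeg_neq0 p : U p -> cubeg p != 0.
Proof.
move=> Up; apply/eqP => g0; have /eqP := zeta_cubeg Up.
by rewrite g0 mulr0 eq_sym oner_eq0.
Qed.

Lemma zetaTZ_neq0 p : U p -> zetaTZ F p != 0.
Proof.
move=> Up; apply/eqP => g0; have /eqP := zeta_cubeg Up.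
by rewrite g0 mul0r eq_sym oner_eq0.
Qed.

(** The record asserts no smoothness of [zeta]. It comes from the root: the pairing [cubeg] of ed^3
    with th /\ th1 is smooth, and [zetaTZ] is its inverse because zeta = zetaTZ th /\ th1. *)
Lemma zetaTZ_smooth : smooth_on U (zetaTZ F).
Proof.
have sg : smooth_on U cubeg.
  apply: cube_smooth => //; [exact: ed_smooth|exact: thth1_smooth|exact: thth1_canonical].
apply: (eq_smooth_on oU _ (smooth_on_inv oU cubeg_neq0 sg)) => p Up.
by apply: (mulIf (cubeg_neq0 Up)); rewrite mulVf ?cubeg_neq0// zeta_cubeg.
Qed.

(** This is the normalization of zeta by theta, evaluated on (T, Z_1, Z_{bar 1}). *)
Lemma h_zeta p : U p -> h F p = zetaTZ F p * (zetaTZ F p)^*.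
Proof.
move=> Up.
have zE := canonical_thth1 Up (zeta_canonical Up).
have zZ : zeta F (T p) (Z p) = zetaTZ F p by [].
have zZb : zeta F (T p) (Zb p) = 0.
  by rewrite zE /thth1 /wedge11 th_Z1b// th1_Z1b// mulr0 mul0r subrr mulr0.
have i0 : 'i != 0 :> C by rewrite neq0Ci.
have := zeta_th oU (@subset_refl _ U) sT sZ sZb Up.
rewrite Tf_th// th_Z1// th_Z1b// !mul0r !addr0 mul1r.
rewrite (@th_eq _ _ _ F U Z Zb oU)// /wedge12 Tf_th// th_Z1// th_Z1b// !mul0r !addr0 mul1r.
have := th1b_Z1 Up; have := th1b_Z1b Up; rewrite /th1b /wedge11 => -> ->.
rewrite th1_Z1// th1_Z1b// zZ zZb mul0r subr0.
have -> : conj_form (zeta F (T p)) (Zb p) = (zetaTZ F p)^*.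
  by rewrite /conj_form /Z1b /conj_field tconjK.
by rewrite mul0r subr0 !mulr1 => /(mulfI i0).
Qed.

(* Equivalently, the trivialization of E(1,1) by th is parallel. *)
Lemma conn_conj p (v : CT p) : U p -> conj_form (@conn _ _ _ _ F p) v = - conn F v.
Proof.
move=> Up; have h0 := h_neq0 Up; have z0 := zetaTZ_neq0 Up.
have zc0 : (zetaTZ F p)^* != 0 by rewrite conjC_eq0.
have sz := smooth_atW oU Up zetaTZ_smooth.
rewrite /conj_form /conn conjM conjD conjN conjM !conjV.
have -> : (val (tconj v) (zetaTZ F))^* = val v (fun q => (zetaTZ F q)^*).
  by rewrite tconjE conjCK.
have -> : (om F p (tconj v))^* = (h F p)^-1 * val v (h F) - om F p v.
  by rewrite -(om_eq v Up) /conj_form addrC addKr.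
have -> : val v (h F) = val v (zetaTZ F) * (zetaTZ F p)^*
    + zetaTZ F p * val v (fun q => (zetaTZ F q)^*).
  rewrite -ct_mul//; last exact: smooth_at_conj.
  apply: (ct_local v oU Up); first exact: h_smooth.
  by move=> q Uq; rewrite h_zeta.
have -> : (3%:R : C)^* = 3 by rewrite conjC_nat.
by rewrite h_zeta//; field; rewrite z0.
Qed.

(** The connections on E(1,0) and E(0,1) are opposite, so only w - w' matters. It is 0 for u and -1
    for each of the three slots of a tractor. *)
Lemma nabE (k w w' : int) (X : field M) f p : U p ->
  nab F k w w' X f p = nabt F k X f p + (w - w')%:~R * conn F (X p) * f p.
Proof. by move=> Up; rewrite /nab conn_conj//; ring. Qed.
End Zeta.

(** * Change of frame *)

Section T10.
Variables (R : realType) (M : oriented_manifold3 R) (S : CRstructure M) (F : psh_frame S).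
Lemma T10_Z p (v : CT p) : dm F p -> T10 S v -> v = th1 F p v *: Z1 F p.
Proof.
move=> Up /T10P[Y hY vE].
have i2 : ('i : R[i]) * 'i = -1 by rewrite -expr2 sqrCi.
have [a {}vE] : exists a, v = a *: Z1 F p.
  have [X [hX X0 -> _]] := Z1_form Up.
  have [a [b YE]] := Hd_span hX X0 hY.
  exists (a%:C + 'i * b%:C); rewrite vE YE Jd_comb//; last exact: J_H.
  rewrite J_sq//; apply: ct_ext => f _; rewrite !(valD, valN, valZ); by ring: i2.
by rewrite {1}vE vE linearZ /= th1_Z1// /GRing.scale /= mulr1.
Qed.
End T10.

Section Change.
Variables (R : realType) (M : oriented_manifold3 R) (S : CRstructure M) (L : cube_root S).
Variables (F F' : frame L).
Local Notation C := R[i].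
Local Notation V0 := (dm F `&` dm F').

Let oV : open V0. Proof. by apply: openI; exact: dm_open. Qed.
Let sF : V0 `<=` dm F. Proof. by move=> q []. Qed.
Let sF' : V0 `<=` dm F'. Proof. by move=> q []. Qed.

(** The change of frame is Z' = nu Z, Y' = m Y and - i T' = ta (- i T) + a Z + b Y. If theta' =
    e^Upsilon theta, then ta = e^{-Upsilon} and te = e^Upsilon. *)
Definition change_nu : M -> C := contract (th1 F) (Z1 F').
Definition change_ta : M -> C := contract (th F) (Tf F').
Definition change_te : M -> C := contract (th F') (Tf F).
Definition change_m (q : M) : C := (h F' q)^-1 * (change_nu q)^* * h F q.
Definition change_a (q : M) : C := - 'i * contract (th1 F) (Tf F') q.
Definition change_b (q : M) : C := - 'i * h F q * (contract (th1 F) (Tf F') q)^*.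

Let sZ := smooth_field_sub sF (@Z1_smooth _ _ _ F).
Let sZ' := smooth_field_sub sF' (@Z1_smooth _ _ _ F').
Let sY := smooth_field_sub sF (@Yf_smooth _ _ _ F).
Let sY' := smooth_field_sub sF' (@Yf_smooth _ _ _ F').
Let sT := smooth_field_sub sF (@Tt_smooth _ _ _ F).
Let sT' := smooth_field_sub sF' (@Tt_smooth _ _ _ F').
Let sTf := smooth_field_sub sF (@Tf_smooth _ _ _ F).
Let sTf' := smooth_field_sub sF' (@Tf_smooth _ _ _ F').

Lemma change_nu_smooth : smooth_on V0 change_nu.
Proof. by apply: (@th1_smooth _ _ _ F). Qed.
Lemma change_ta_smooth : smooth_on V0 change_ta.
Proof. by have [s _ _ _] := th_contact F; apply: s. Qed.
Lemma change_te_smooth : smooth_on V0 change_te.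
Proof. by have [s _ _ _] := th_contact F'; apply: s. Qed.
Let t1T_smooth : smooth_on V0 (contract (th1 F) (Tf F')).
Proof. by apply: (@th1_smooth _ _ _ F). Qed.
Let h_smooth0 : smooth_on V0 (h F).
Proof. by apply: smooth_on_sub sF _; exact: h_smooth. Qed.
Lemma change_a_smooth : smooth_on V0 change_a.
Proof. by apply: smooth_on_mul => //; exact: smooth_on_cst. Qed.
Lemma change_b_smooth : smooth_on V0 change_b.
Proof.
apply: smooth_on_mul => //; last exact: smooth_on_conj.
by apply: smooth_on_mul => //; exact: smooth_on_cst.
Qed.
Lemma change_m_smooth : smooth_on V0 change_m.
Proof.
apply: smooth_on_mul => //; apply: smooth_on_mul => //.
  by apply: smooth_on_sub sF' _; exact: hV_smooth.
by apply: smooth_on_conj => //; exact: change_nu_smooth.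
Qed.

Section AtPoint.
Variable q : M.
Hypothesis Vq : V0 q.
Let Fq : dm F q := sF Vq.
Let Fq' : dm F' q := sF' Vq.

Lemma Z1_change : Z1 F' q = change_nu q *: Z1 F q.
Proof. by apply: T10_Z => //; have [] := Z1_T10 Fq'. Qed.

Lemma change_nu_neq0 : change_nu q != 0.
Proof.
by have [_] := Z1_T10 Fq'; rewrite Z1_change; apply: contraNneq => ->; rewrite scale0r.
Qed.

Lemma Yf_change : Yf F' q = change_m q *: Yf F q.
Proof.
have h0 := h_neq0 Fq; rewrite /Yf /fscale /Z1b /conj_field Z1_change tconjZ /change_m.
by apply: ct_ext => f _; rewrite !valZ; field; rewrite h0 h_neq0.
Qed.

Lemma th_change (v : CT q) : th F' q v = change_te q * th F q v.
Proof.
rewrite {1}(frame_dec Fq v) form_comb3.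
have [X [hX _ -> ->]] := Z1_form Fq.
have hJ := J_H hX.
have E (a : C) : th F' q (X + a *: Jd S X) = 0.
  by rewrite -[X in X + _]scale1r form_comb !(th_Hd Fq')// !mulr0 addr0.
by rewrite -scaleNr !E !mulr0 !addr0 mulrC.
Qed.

Lemma change_ta_te : change_ta q * change_te q = 1.
Proof. by rewrite mulrC /change_ta /contract -th_change Tf_th. Qed.

Lemma Tt_change : Tt F' q = change_ta q *: Tt F q + (change_a q *: Z1 F q + change_b q *: Yf F q).
Proof.
have h0 := h_neq0 Fq.
apply: ct_ext => f _; rewrite {1}/Tt /fscale {1}(frame_dec Fq (Tf F' q)).
have -> : th1b F (Tf F' q) = (contract (th1 F) (Tf F') q)^*.
  by rewrite /th1b /conj_form Tf_real.
rewrite /change_a /change_b /change_ta /contract /Tt /Yf /fscale !(valD, valZ); by field.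
Qed.

End AtPoint.

Let snu := change_nu_smooth.
Let sm := change_m_smooth.
Let sta := change_ta_smooth.
Let sa := change_a_smooth.
Let sb := change_b_smooth.

Section Components.
Variable q : M.
Hypothesis Vq : V0 q.
Let Fq : dm F q := sF Vq.
Let Fq' : dm F' q := sF' Vq.
Local Notation Z := (Z1 F).
Local Notation Y := (Yf F).
Local Notation T := (Tt F).

(** The bracket is expanded by the Leibniz rule in the frame of [F] and by the structure equations
    of [F']; [basis_inj] compares the coefficients. *)
Lemma change_ZY : [/\ change_m q * change_nu q = change_ta q,
  - (change_m q * change_nu q * omY F q) - change_m q * val (Y q) change_nu = change_a q - omY F' q * change_nu q &
  - (change_m q * change_nu q * omZ F q) + change_nu q * val (Z q) change_m = change_b q - omZ F' q * change_m q].
Proof.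
apply: (basis_inj Fq); transitivity (bracket (Z1 F') (Yf F') q).
  rewrite (@eq_bracket _ _ V0 q oV Vq (Z1 F') (Yf F') (fscale change_nu Z) (fscale change_m Y))//;
    [|exact: Z1_change|exact: Yf_change].
  rewrite (bracketZr oV Vq (smooth_fscale snu sZ) sY sm) (bracketZl oV Vq sZ sY snu) bracket_ZY//.
  by apply: ct_ext => f _; rewrite /fscale !(valD, valN, valZ); ring.
rewrite bracket_ZY// Z1_change// Yf_change// Tt_change//.
by apply: ct_ext => f _; rewrite !(valD, valN, valZ); ring.
Qed.

Let sT'E := smooth_fadd (smooth_fscale sta sT) (smooth_fadd (smooth_fscale sa sZ) (smooth_fscale sb sY)).

Let bracketT X : smooth_field V0 X ->
  bracket X (fadd (fscale change_ta T) (fadd (fscale change_a Z) (fscale change_b Y))) q =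
  (change_ta q *: bracket X T q + val (X q) change_ta *: T q)
  + (change_a q *: bracket X Z q + val (X q) change_a *: Z q
     + (change_b q *: bracket X Y q + val (X q) change_b *: Y q)).
Proof.
move=> sX; have sTT := smooth_fscale sta sT.
have sZZ := smooth_fscale sa sZ; have sYY := smooth_fscale sb sY.
rewrite (bracketDr oV Vq sX sTT (smooth_fadd sZZ sYY)) (bracketDr oV Vq sX sZZ sYY).
by rewrite (bracketZr oV Vq sX sT sta) (bracketZr oV Vq sX sZ sa) (bracketZr oV Vq sX sY sb).
Qed.

Let bracket_self X : smooth_field V0 X -> bracket X X q = 0.
Proof. by move=> sX; apply: ct_ext => f sf; rewrite (bracketE oV Vq sX sX sf) subrr. Qed.

Lemma change_ZT : [/\ change_nu q * (val (Z q) change_ta + change_b q) = 0,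
  change_nu q * (- (change_ta q * omT F q) + val (Z q) change_a - change_b q * omY F q)
  - (change_ta q * val (T q) change_nu + change_a q * val (Z q) change_nu + change_b q * val (Y q) change_nu) = - (omT F' q * change_nu q) &
  change_nu q * (- (change_ta q * iA11 F q) + val (Z q) change_b - change_b q * omZ F q) = - (iA11 F' q * change_m q)].
Proof.
apply: (basis_inj Fq); transitivity (bracket (Z1 F') (Tt F') q).
  rewrite (@eq_bracket _ _ V0 q oV Vq (Z1 F') (Tt F') (fscale change_nu Z)
    (fadd (fscale change_ta T) (fadd (fscale change_a Z) (fscale change_b Y))))//;
    [|exact: Z1_change|exact: Tt_change].
  rewrite (bracketZl oV Vq sZ sT'E snu) bracketT// bracket_self// bracket_ZY// bracket_ZTt//.
  apply: ct_ext => f _; rewrite /fadd /fscale !(valD, valN, valZ).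
  have -> : val (0 : CT q) f = 0 by [].
  ring.
rewrite bracket_ZTt// Z1_change// Yf_change//.
by apply: ct_ext => f _; rewrite !(valD, valN, valZ); ring.
Qed.

Lemma change_YT : change_m q * (val (Y q) change_ta - change_a q) = 0 /\
  change_m q * (change_ta q * iA11up F q + val (Y q) change_a + change_a q * omY F q) = iA11up F' q * change_nu q.
Proof.
suff [E1 E2 _] : [/\ change_m q * (val (Y q) change_ta - change_a q) = 0,
  change_m q * (change_ta q * iA11up F q + val (Y q) change_a + change_a q * omY F q) = iA11up F' q * change_nu q &
  change_m q * (change_ta q * omT F q + val (Y q) change_b + change_a q * omZ F q)
  - (change_ta q * val (T q) change_m + change_a q * val (Z q) change_m + change_b q * val (Y q) change_m) = omT F' q * change_m q] by [].
apply: (basis_inj Fq); transitivity (bracket (Yf F') (Tt F') q).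
  rewrite (@eq_bracket _ _ V0 q oV Vq (Yf F') (Tt F') (fscale change_m Y)
    (fadd (fscale change_ta T) (fadd (fscale change_a Z) (fscale change_b Y))))//;
    [|exact: Yf_change|exact: Tt_change].
  rewrite (bracketZl oV Vq sY sT'E sm) bracketT// bracket_self//.
  rewrite (bracketC oV Vq sZ sY) bracket_ZY// bracket_YTt//.
  apply: ct_ext => f _; rewrite /fadd /fscale !(valD, valN, valZ).
  have -> : val (0 : CT q) f = 0 by [].
  ring.
rewrite bracket_YTt// Z1_change// Yf_change//.
by apply: ct_ext => f _; rewrite !(valD, valN, valZ); ring.
Qed.
End Components.

Definition overlap : opens M := exist _ V0 oV.
Section Rescaling.
Variables (sV : sval overlap `<=` dm F) (sV' : sval overlap `<=` dm F').
Local Notation c := (frame_calculus sV).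
Local Notation c' := (frame_calculus sV').
Local Notation K := (smoothfun overlap).

Let snv : smooth_on V0 (fun q => (change_nu q)^-1).
Proof. by apply: smooth_on_inv => // q Vq; exact: change_nu_neq0. Qed.

Let knu : K := @smooth_res _ _ overlap _ snu.
Let knv : K := @smooth_res _ _ overlap _ snv.
Let kta : K := @smooth_res _ _ overlap _ sta.
Let kte : K := @smooth_res _ _ overlap _ change_te_smooth.
Let km : K := @smooth_res _ _ overlap _ sm.
Let ka : K := @smooth_res _ _ overlap _ sa.
Let kb : K := @smooth_res _ _ overlap _ sb.
Let k6 : K := @smooth_res _ _ overlap _ (smooth_on_cst V0 6^-1).

Let der_res q (v : CT q) g (sg : smooth_on V0 g) : V0 q ->
  val v (ev (@smooth_res _ _ overlap _ sg)) = val v g.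
Proof. by move=> Vq; apply: (ct_ev (V := overlap) Vq) => r Vr; rewrite (ev_res Vr). Qed.

Let eqs (f g : K) : (forall q, sval overlap q -> ev f q = ev g q) -> f = g.
Proof. exact: (@ev_inj _ _ overlap). Qed.

Ltac kev Vq := rewrite ?(evE Vq) ?(ev_dZ _ Vq) ?(ev_dY _ Vq) ?(ev_dT _ Vq) ?(ev_wZ _ Vq)
  ?(ev_wY _ Vq) ?(ev_wT _ Vq) ?(ev_al _ Vq) ?(ev_be _ Vq) ?(ev_res Vq) ?(der_res _ _ Vq).

Let k1 : knu * knv = 1.
Proof. by apply: eqs => q Vq; kev Vq; rewrite mulfV// change_nu_neq0. Qed.
Let k2 : kta * kte = 1.
Proof. by apply: eqs => q Vq; kev Vq; rewrite change_ta_te. Qed.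
Let k3 : 6 * k6 = 1.
Proof. by apply: eqs => q Vq; kev Vq; rewrite mulfV// pnatr_eq0. Qed.
Let kZ f : dZ c' f = knu * dZ c f.
Proof. by apply: eqs => q Vq; kev Vq; rewrite Z1_change// valZ. Qed.
Let kY f : dY c' f = km * dY c f.
Proof. by apply: eqs => q Vq; kev Vq; rewrite Yf_change// valZ. Qed.
Let kT f : dT c' f = kta * dT c f + ka * dZ c f + kb * dY c f.
Proof. by apply: eqs => q Vq; kev Vq; rewrite Tt_change// !valD !valZ addrA. Qed.
Let ke1 : km * knu = kta.
Proof. by apply: eqs => q Vq; kev Vq; have [] := change_ZY Vq. Qed.
Let ke2 : - (km * knu * wY c) - km * dY c knu = ka - wY c' * knu.
Proof. by apply: eqs => q Vq; kev Vq; have [] := change_ZY Vq. Qed.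
Let ke3 : - (km * knu * wZ c) + knu * dZ c km = kb - wZ c' * km.
Proof. by apply: eqs => q Vq; kev Vq; have [] := change_ZY Vq. Qed.
Let kf1 : knu * (dZ c kta + kb) = 0.
Proof. by apply: eqs => q Vq; kev Vq; have [] := change_ZT Vq. Qed.
Let kf2 : knu * (- (kta * wT c) + dZ c ka - kb * wY c)
  - (kta * dT c knu + ka * dZ c knu + kb * dY c knu) = - (wT c' * knu).
Proof. by apply: eqs => q Vq; kev Vq; have [] := change_ZT Vq. Qed.
Let thr (z : C) : 3 * (z / 3) = z.
Proof. by rewrite mulrC divfK// pnatr_eq0. Qed.
Let kf3 : knu * (- (kta * (3 * al c)) + dZ c kb - kb * wZ c) = - (3 * al c' * km).
Proof. by apply: eqs => q Vq; kev Vq; rewrite !thr; have [] := change_ZT Vq. Qed.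
Let kg1 : km * (dY c kta - ka) = 0.
Proof. by apply: eqs => q Vq; kev Vq; have [] := change_YT Vq. Qed.
Let kg2 : km * (kta * (3 * be c) + dY c ka + ka * wY c) = 3 * be c' * knu.
Proof. by apply: eqs => q Vq; kev Vq; rewrite !thr; have [] := change_YT Vq. Qed.

Definition frame_rescaling : rescaling c c' :=
  mk_rescaling k1 k2 k3 kZ kY kT ke1 ke2 ke3 kf1 kf2 kf3 kg1 kg2.

Section Values.
Variable q : M.
Hypothesis Vq : sval overlap q.
Lemma ev_nu : ev (nu frame_rescaling) q = change_nu q. Proof. exact: ev_res. Qed.
Lemma ev_nv : ev (nv frame_rescaling) q = (change_nu q)^-1. Proof. exact: ev_res. Qed.
Lemma ev_ta : ev (ta frame_rescaling) q = change_ta q. Proof. exact: ev_res. Qed.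
Lemma ev_te : ev (te frame_rescaling) q = change_te q. Proof. exact: ev_res. Qed.
Lemma ev_rx : ev (rx frame_rescaling) q = 6^-1 * (change_ta q * val (Z1 F q) change_te).
Proof. by rewrite -[rx _]/(k6 * (kta * dZ c kte)); kev Vq. Qed.
Lemma ev_ry : ev (ry frame_rescaling) q = 6^-1 * (change_ta q * val (Yf F q) change_te).
Proof. by rewrite -[ry _]/(k6 * (kta * dY c kte)); kev Vq. Qed.
Lemma ev_rw : ev (rw frame_rescaling) q = 6^-1 * (change_ta q * val (Tt F q) change_te).
Proof. by rewrite -[rw _]/(k6 * (kta * dT c kte)); kev Vq. Qed.
End Values.
End Rescaling.
End Change.

(** * Restriction to a smaller open set *)

Section Restriction.
Variables (R : realType) (M : oriented_manifold3 R) (S : CRstructure M) (L : cube_root S).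
Variables (F : frame L) (V W : opens M).
Hypotheses (sVW : sval V `<=` sval W) (sW : sval W `<=` dm F).

Definition restr (f : smoothfun W) : smoothfun V := smooth_res (smooth_on_sub sVW (@ev_smooth _ _ W f)).

Lemma ev_restr f p : sval V p -> ev (restr f) p = ev f p.
Proof. by move=> Vp; rewrite (ev_res Vp). Qed.

Local Notation cW := (frame_calculus sW).
Local Notation cV := (frame_calculus (subset_trans sVW sW)).

Let go (f : smoothfun W) (g : smoothfun V) : (forall p, sval V p -> ev f p = ev g p) -> restr f = g.
Proof. by move=> E; apply: ev_inj => p Vp; rewrite ev_restr// E. Qed.

Let rD f g : restr (f + g) = restr f + restr g.
Proof.
by apply: go => p Vp; rewrite (evD (sVW Vp)) (evD Vp) !ev_restr.
Qed.
Let rN f : restr (- f) = - restr f.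
Proof. by apply: go => p Vp; rewrite (evN (sVW Vp)) (evN Vp) !ev_restr. Qed.
Let rM f g : restr (f * g) = restr f * restr g.
Proof. by apply: go => p Vp; rewrite (evM (sVW Vp)) (evM Vp) !ev_restr. Qed.
Let r1 : restr 1 = 1.
Proof. by apply: go => p Vp; rewrite (ev1 (sVW Vp)) (ev1 Vp). Qed.
Let rloc (f : smoothfun W) p (v : CT p) : sval V p -> val v (ev f) = val v (ev (restr f)).
Proof. by move=> Vp; apply/esym/(ct_ev Vp) => q Vq; rewrite ev_restr. Qed.
Let rZ f : restr (dZ cW f) = dZ cV (restr f).
Proof. by apply: go => p Vp; rewrite (ev_dZ _ (sVW Vp)) (ev_dZ _ Vp) rloc. Qed.
Let rY f : restr (dY cW f) = dY cV (restr f).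
Proof. by apply: go => p Vp; rewrite (ev_dY _ (sVW Vp)) (ev_dY _ Vp) rloc. Qed.
Let rT f : restr (dT cW f) = dT cV (restr f).
Proof. by apply: go => p Vp; rewrite (ev_dT _ (sVW Vp)) (ev_dT _ Vp) rloc. Qed.
Let rwZ : restr (wZ cW) = wZ cV.
Proof. by apply: go => p Vp; rewrite (ev_wZ _ (sVW Vp)) (ev_wZ _ Vp). Qed.
Let rwY : restr (wY cW) = wY cV.
Proof. by apply: go => p Vp; rewrite (ev_wY _ (sVW Vp)) (ev_wY _ Vp). Qed.
Let rwT : restr (wT cW) = wT cV.
Proof. by apply: go => p Vp; rewrite (ev_wT _ (sVW Vp)) (ev_wT _ Vp). Qed.
Let rsc : restr (sc cW) = sc cV.
Proof. by apply: go => p Vp; rewrite (ev_sc _ (sVW Vp)) (ev_sc _ Vp). Qed.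
Let ral : restr (al cW) = al cV.
Proof. by apply: go => p Vp; rewrite (ev_al _ (sVW Vp)) (ev_al _ Vp). Qed.
Let rbe : restr (be cW) = be cV.
Proof. by apply: go => p Vp; rewrite (ev_be _ (sVW Vp)) (ev_be _ Vp). Qed.

Lemma restr_D1 k f : restr (D1 cW k f) = D1 cV k (restr f).
Proof. by apply: phi_D1. Qed.
Lemma restr_al : restr (al cW) = al cV. Proof. exact: ral. Qed.
Lemma restr_s00 u : restr (s00 cW u) = s00 cV (restr u).
Proof. by apply: phi_s00. Qed.
Lemma restr_s01 u : restr (s01 cW u) = s01 cV (restr u).
Proof. by apply: phi_s01. Qed.
Lemma restr_s02 u : restr (s02 u) = s02 (restr u).
Proof. by apply: phi_s02. Qed.
Lemma restr_s10 u : restr (s10 cW u) = s10 cV (restr u).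
Proof. by apply: phi_s10. Qed.
Lemma restr_s11 u : restr (s11 cW u) = s11 cV (restr u).
Proof. by apply: phi_s11. Qed.
Lemma restr_s12 u : restr (s12 cW u) = s12 cV (restr u).
Proof. by apply: phi_s12. Qed.
Lemma restr_s20 u : restr (s20 cW u) = s20 cV (restr u).
Proof. by apply: phi_s20. Qed.
Lemma restr_s21 u : restr (s21 cW u) = s21 cV (restr u).
Proof. by apply: phi_s21. Qed.
Lemma restr_s22 u : restr (s22 cW u) = s22 cV (restr u).
Proof. by apply: phi_s22. Qed.
Lemma restr_residual u : restr (residual cW u) = residual cV (restr u).
Proof. by apply: phi_residual. Qed.
End Restriction.

(** * The frame of E(1,0) and the factor e^Upsilon *)

Section Lambda.
Variables (R : realType) (M : oriented_manifold3 R) (S : CRstructure M) (L : cube_root S).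
Variables (F F' : frame L) (q : M) (la : R[i]).
Hypotheses (Fq : dm F q) (Fq' : dm F' q) (laE : ed F' q = la *: ed F q).
Local Notation C := R[i].
Let Vq : (dm F `&` dm F') q := conj Fq Fq'.
Let t : C := change_te F F' q.
Let nu : C := change_nu F F' q.

Let nu0 : nu != 0. Proof. exact: change_nu_neq0. Qed.

Let t_real : t^* = t.
Proof.
rewrite /t /change_te /Defs.contract -[RHS](congr1 (th F' q) (Tf_real Fq)).
by rewrite (th_conj Fq').
Qed.

(** The law of the Levi form follows from the T component of [Z', Y'], which says m nu =
    e^{-Upsilon}, because m = conj nu h / h'. *)
Let hE : h F' q = nu * nu^* * h F q * t.
Proof.
have [e _ _] := change_ZY Vq; have h0 := h_neq0 Fq'.
have tt := change_ta_te Vq; rewrite -e /change_m -/nu -/t in tt.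
apply: (mulIf (x := (h F' q)^-1)); first by rewrite invr_eq0.
by rewrite mulfV// -tt; ring.
Qed.

Let t_gt0 : 0 < t.
Proof.
have := h_gt0 Fq'; rewrite hE -mulrA mulrC -mulrA.
have n0 : 0 < nu * nu^* by rewrite mul_conjC_gt0.
by rewrite pmulr_rgt0 ?(h_gt0 Fq)// mulrC pmulr_rgt0.
Qed.

(* Taking norms in zeta = ed^{-3} gives (|la|^2 e^Upsilon)^3 = 1, with a positive base. *)
Lemma change_ta_la : change_ta F F' q = la * la^*.
Proof.
have h0 := h_neq0 Fq; have t0 : t != 0 by rewrite gt_eqF.
have g0 := cubeg_neq0 Fq.
have E1 : cubeg F' q = la ^+ 3 * (t * nu^-1) * cubeg F q.
  rewrite /cubeg laE.
  have TE : @thth1 _ _ _ _ F' q = fun v v' => (t * nu^-1) * @thth1 _ _ _ _ F q v v'.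
    rewrite {1}(canonical_thth1 Fq (thth1_canonical Fq')).
    apply/funext => v; apply/funext => v'; congr (_ * _).
    have ZE : th1 F' q (Z1 F q) = nu^-1.
      have := th1_Z1 Fq'; rewrite (Z1_change Vq) linearZ /= => E.
      by apply: (mulfI nu0); rewrite mulfV// -E.
    have Z0 : th F' q (Z1 F q) = 0 by rewrite (th_change Vq) th_Z1// mulr0.
    by rewrite {1}/thth1 /wedge11 ZE Z0 mul0r subr0.
  rewrite cube_hom; last exact: thth1_canonical.
  rewrite TE.
  by rewrite cube_scale ?mulrA//; exact: thth1_canonical.
have E2 := zeta_cubeg Fq; have E3 := zeta_cubeg Fq'.
(* With h = |zetaTZ|^2 and zetaTZ cubeg = 1 this gives |cubeg|^2 = 1 / h in each of the two
   frames. *)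
have n2 (z g : C) : z * g = 1 -> g * g^* = (z * z^*)^-1.
  move=> zg; have z0 : z * z^* != 0.
    by rewrite mul_conjC_eq0; apply: contra_eq_neq zg => ->; rewrite mul0r eq_sym oner_neq0.
  apply: (mulfI z0); rewrite mulfV//.
  have -> : z * z^* * (g * g^*) = (z * g) * (z * g)^* by rewrite conjM; ring.
  by rewrite zg conjC1 mulr1.
have N1 := n2 _ _ E2; have N2 := n2 _ _ E3.
rewrite -!h_zeta// in N1 N2.
have nc0 : nu^* != 0 by rewrite conjC_eq0.
have N3 : (h F' q)^-1 = (la * la^*) ^+ 3 * (t * t) / (nu * nu^*) * (h F q)^-1.
  rewrite -N1 -N2 E1 !(conjM, conjV) t_real.
  by field; apply/andP; split; [exact: nc0|exact: nu0].
rewrite hE in N3.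
have N4 : (la * la^* * t) ^+ 3 = 1.
  have nn0 : nu * nu^* != 0 by rewrite mulf_neq0.
  have -> : (la * la^* * t) ^+ 3 = ((la * la^*) ^+ 3 * (t * t) / (nu * nu^*) * (h F q)^-1)
      * (nu * nu^* * h F q * t).
    by field; apply/and3P; split; [exact: h0|exact: nc0|exact: nu0].
  by rewrite -N3 mulVf// !mulf_neq0.
have p0 : 0 <= la * la^* * t by rewrite mulr_ge0 ?mul_conjC_ge0// ltW.
have {N4} N5 : la * la^* * t = 1.
  by apply/eqP; rewrite -(pexpr_eq1 (n := 3))// N4.
apply: (mulIf t0); rewrite N5; exact: change_ta_te.
Qed.

Lemma change_te_la : change_te F F' q = (la * la^*)^-1.
Proof.
have := change_ta_te Vq; rewrite change_ta_la => E.
have l0 : la * la^* != 0.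
  by apply: contra_eq_neq E => ->; rewrite mul0r eq_sym oner_neq0.
by apply: (mulfI l0); rewrite mulfV.
Qed.
End Lambda.

(** * The solution *)

Section Components.
Variables (R : realType) (M : oriented_manifold3 R) (S : CRstructure M) (L : cube_root S).
Variable (F : frame L).
Local Notation C := R[i].
Local Notation U := (dm F).
Let oU := dm_open F.

Definition frame_dom : opens M := exist _ U oU.
Local Notation K := (smoothfun frame_dom).
Definition frame_calc : calculus K := @frame_calculus _ _ _ _ F frame_dom (@subset_refl _ _).
Local Notation c := frame_calc.

Lemma nabt_smooth k X g : smooth_field U X -> smooth_on U g -> smooth_on U (nabt F k X g).
Proof.
move=> sX sg; apply: smooth_on_add => //; first exact: sX.
apply: smooth_on_opp => //; apply: smooth_on_mul => //; apply: smooth_on_mul => //.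
  exact: smooth_on_cst.
exact: (@om_smooth _ _ _ F).
Qed.

Lemma nabt_up_smooth k g : smooth_on U g -> smooth_on U (nabt_up F k g).
Proof.
move=> sg; apply: smooth_on_mul => //; first exact: hV_smooth.
by apply: nabt_smooth => //; exact: Z1b_smooth.
Qed.

Section AtPoint.
Variable p : M.
Hypothesis Up : U p.

(** The constant a carries the factors 1/12, i/3 and 1/3 relating [sc], [al] and [third_u] to R,
    A_11 and u. *)
Lemma ev_D1 k (a : C) f g : smooth_on U g -> (forall q, U q -> ev f q = a * g q) ->
  ev (D1 c k f) p = a * nabt F k (Z1 F) g p.
Proof.
move=> sg fg; have Wp : sval frame_dom p := Up.
rewrite /D1 !(evE Wp) (ev_dZ _ Wp) (ev_wZ _ Wp) fg// (ct_ev Wp _ fg).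
rewrite ct_mul; [|exact: smooth_at_cst|exact: smooth_atW sg].
by rewrite ct_cst /nabt /omZ; ring.
Qed.

Lemma ev_Du k (a : C) f g : smooth_on U g -> (forall q, U q -> ev f q = a * g q) ->
  ev (Du c k f) p = a * nabt_up F k g p.
Proof.
move=> sg fg; have Wp : sval frame_dom p := Up.
rewrite /Du !(evE Wp) (ev_dY _ Wp) (ev_wY _ Wp) fg// (ct_ev Wp _ fg).
rewrite ct_mul; [|exact: smooth_at_cst|exact: smooth_atW sg].
by rewrite ct_cst /nabt_up /nabt omYE /Yf /fscale valZ; ring.
Qed.

Lemma ev_D0 k (a : C) f g : smooth_on U g -> (forall q, U q -> ev f q = a * g q) ->
  ev (D0 c k f) p = - 'i * a * nabt F k (Tf F) g p.
Proof.
move=> sg fg; have Wp : sval frame_dom p := Up.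
rewrite /D0 !(evE Wp) (ev_dT _ Wp) (ev_wT _ Wp) fg// (ct_ev Wp _ fg).
rewrite ct_mul; [|exact: smooth_at_cst|exact: smooth_atW sg].
have -> : omT F p = - 'i * om F p (Tf F p) by rewrite /omT /Tt /fscale linearZ.
by rewrite ct_cst /nabt /Tt /fscale valZ; ring.
Qed.

End AtPoint.

Let sR : smooth_on U (Rs F) := @Rs_smooth _ _ _ _ F.
Let sA : smooth_on U (A11 F) := @A11_smooth _ _ _ F.
Let sZ : smooth_field U (Z1 F) := @Z1_smooth _ _ _ F.
Let sdR : smooth_on U (nabt F 0 (Z1 F) (Rs F)). Proof. exact: nabt_smooth. Qed.
Let sdA : smooth_on U (divA F). Proof. exact: nabt_up_smooth. Qed.

Lemma ev_scE q : U q -> ev (sc c) q = 12^-1 * Rs F q.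
Proof. by move=> Uq; rewrite (ev_sc _ (V := frame_dom) Uq) mulrC. Qed.
Lemma ev_alE q : U q -> ev (al c) q = ('i / 3) * A11 F q.
Proof. by move=> Uq; rewrite (ev_al _ (V := frame_dom) Uq) /iA11 mulrAC. Qed.

Lemma ev_T1 p : U p -> ev (tracT1 c) p = T1 F p.
Proof.
move=> Up; have Wp : sval frame_dom p := Up.
have -> : ev (tracT1 c) p = ev (D1 c 0 (sc c)) p - ev (Du c 2 (al c)) p.
  by rewrite /tracT1 (evD Wp) (evN Wp).
rewrite (ev_D1 Up _ sR ev_scE) (ev_Du Up _ sA ev_alE) /T1 -/(divA F p).
by field.
Qed.

(** The constants of [cartanQ] match those of Q_11 through R = 12 sc and i A_11 = 3 al: 2 T_1 yields
    1/6 and 2i/3, 18 sc al is (i/2) R A_11, and 3 (- i) (i/3) = 1. *)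
Lemma ev_Q p : U p -> ev (cartanQ c) p = Q11 F p.
Proof.
move=> Up; have Wp : sval frame_dom p := Up.
have -> : ev (cartanQ c) p = - (2 * (ev (D1 c 1%Z (D1 c 0%Z (sc c))) p
    - ev (D1 c 1%Z (Du c 2%Z (al c))) p)) - 18 * (ev (sc c) p * ev (al c) p)
    + 3 * ev (D0 c 2%Z (al c)) p.
  rewrite /cartanQ /tracT1 D1D D1N; move: (D1 _ _ _) (D1 _ _ _) (D0 _ _ _) => f g k.
  by rewrite !(evE Wp).
rewrite (ev_scE Up) (ev_alE Up) (ev_D0 Up _ sA ev_alE).
rewrite (ev_D1 Up _ sdR (fun q Uq => ev_D1 Uq 0 sR ev_scE)).
rewrite (ev_D1 Up _ sdA (fun q Uq => ev_Du Uq 2 sA ev_alE)) /Q11.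
have i2 : ('i : C) * 'i = -1 by rewrite -expr2 sqrCi.
by field: i2.
Qed.

Lemma Q11_smooth : smooth_on U (Q11 F).
Proof. by apply: (eq_smooth_on oU ev_Q); exact: (@ev_smooth _ _ frame_dom). Qed.

Lemma ev_Y p : U p -> Y1 F p = - 'i * ev (Du c 2%Z (cartanQ c)) p.
Proof.
move=> Up; rewrite (@ev_Du _ Up 2%Z 1 _ (Q11 F)) ?mul1r//; first exact: Q11_smooth.
by move=> q Uq; rewrite mul1r ev_Q.
Qed.
End Components.

Section Matrix3.
Lemma ord3P (P : 'I_3 -> Prop) : P (inord 0) -> P (inord 1) -> P (inord 2) -> forall i, P i.
Proof.
move=> P0 P1 P2 [[|[|[|//]]] i3].
- by rewrite (_ : Ordinal _ = inord 0)//; apply: val_inj; rewrite /= inordK.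
- by rewrite (_ : Ordinal _ = inord 1)//; apply: val_inj; rewrite /= inordK.
- by rewrite (_ : Ordinal _ = inord 2)//; apply: val_inj; rewrite /= inordK.
Qed.

Lemma sum3 (V : nmodType) (f : 'I_3 -> V) :
  \sum_(j < 3) f j = f (inord 0) + f (inord 1) + f (inord 2).
Proof.
rewrite !big_ord_recl big_ord0 addr0 addrA; congr (f _ + f _ + f _);
  by apply: val_inj; rewrite /= inordK.
Qed.

Lemma mx3M (R : realType) (a b c d e f g h k a' b' c' d' e' f' g' h' k' : R[i]) :
  mx3 [:: [:: a; b; c]; [:: d; e; f]; [:: g; h; k]]
  *m mx3 [:: [:: a'; b'; c']; [:: d'; e'; f']; [:: g'; h'; k']] =
  mx3 [:: [:: a * a' + b * d' + c * g'; a * b' + b * e' + c * h'; a * c' + b * f' + c * k'];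
          [:: d * a' + e * d' + f * g'; d * b' + e * e' + f * h'; d * c' + e * f' + f * k'];
          [:: g * a' + h * d' + k * g'; g * b' + h * e' + k * h'; g * c' + h * f' + k * k']].
Proof.
by apply/matrixP; apply: ord3P; apply: ord3P; rewrite !mxE sum3 !mxE !inordK.
Qed.

(** The left factor has entries D_i / D_j times those of N s N^{-1}; stating an intertwining
    relation avoids the inverse of D N. [m20] and [p20] are the corners of N and N^{-1}. The double
    sign before 6 w reflects i Upsilon_0 = - 6 w. *)
Lemma tractor_conj (R : realType) (a b c d e f g h k x y w n la lc : R[i]) :
  la != 0 -> lc != 0 -> n != 0 ->
  let m20 := - (18 * (x * y) + 3 * w) in let p20 := 3 * w - 18 * (x * y) in
  let D := mx3 [:: [:: lc^-1; 0; 0]; [:: 0; n^-1 * la; 0]; [:: 0; 0; la]] in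
  let N := mx3 [:: [:: 1; 0; 0]; [:: 6 * y; 1; 0];
    [:: - ((6 * y * (6 * x) - - (6 * w)) / 2%:R); - (6 * x); 1]] in
  mx3 [:: [:: a - 6 * (y * b) + p20 * c; n / (la * lc) * (b + 6 * (x * c)); (la * lc)^-1 * c];
          [:: n^-1 * (la * lc) *
            (6 * (y * a) + d - 6 * (y * (6 * (y * b) + e)) + p20 * (6 * (y * c) + f));
            6 * (y * b) + e + 6 * (x * (6 * (y * c) + f)); n^-1 * (6 * (y * c) + f)];
          [:: la * lc * (m20 * a - 6 * (x * d) + g
             - 6 * (y * (m20 * b - 6 * (x * e) + h)) + p20 * (m20 * c - 6 * (x * f) + k));
            n * (m20 * b - 6 * (x * e) + h + 6 * (x * (m20 * c - 6 * (x * f) + k)));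
            m20 * c - 6 * (x * f) + k]] *m (D *m N) =
  D *m N *m mx3 [:: [:: a; b; c]; [:: d; e; f]; [:: g; h; k]].
Proof.
move=> la0 lc0 n0 /=; rewrite !mx3M.
congr (mx3 [:: [:: _; _; _]; [:: _; _; _]; [:: _; _; _]]); by field; rewrite ?la0 ?lc0 ?n0.
Qed.
End Matrix3.

Section Solution.
Variables (R : realType) (M : oriented_manifold3 R) (S : CRstructure M) (L : cube_root S).
Variable u : frame L -> M -> R[i].
Hypothesis du : density 0 1 1 u.
Hypothesis equ : forall (F : frame L) p, dm F p ->
  nab F 1 1 1 (Z1 F) (nab F 0 1 1 (Z1 F) (u F)) p + 'i * A11 F p * u F p = 0.
Local Notation C := R[i].
Local Notation c := frame_calc.

Section OneFrame.
Variable F : frame L.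
Local Notation U := (dm F).
Let oU := dm_open F.
Let su : smooth_on U (u F) := du.1 F.

Fact third_u_smooth : smooth_on (sval (frame_dom F)) (fun q => u F q / 3).
Proof. by apply: smooth_on_mul => //; exact: smooth_on_cst. Qed.

(** The abstract entry [s02] is three times its argument, so the division by 3 makes entry 02 of m
    equal to u. *)
Definition third_u : smoothfun (frame_dom F) := smooth_res third_u_smooth.

Lemma third_u_eqn : D1 (c F) 1%Z (D1 (c F) 0%Z third_u) = - (3 * (al (c F) * third_u)).
Proof.
have sZ : smooth_field U (Z1 F) := @Z1_smooth _ _ _ F.
have ukE q : U q -> ev third_u q = 3^-1 * u F q.
  by move=> Uq; rewrite (ev_res (V := frame_dom F) Uq) mulrC.
apply: ev_inj => p Up.
rewrite (ev_D1 Up _ (nabt_smooth 0 sZ su) (fun q Uq => ev_D1 Uq 0 su ukE)).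
have := equ Up; rewrite nabE// subrr mul0r mul0r addr0.
have -> : nabt F 1 (Z1 F) (nab F 0 1 1 (Z1 F) (u F)) p
    = nabt F 1 (Z1 F) (nabt F 0 (Z1 F) (u F)) p.
  have E q : U q -> nab F 0 1 1 (Z1 F) (u F) q = nabt F 0 (Z1 F) (u F) q.
    by move=> Uq; rewrite nabE// subrr mul0r mul0r addr0.
  rewrite {1}/nabt E//; congr (_ - _); apply/esym/(ct_local _ oU Up).
    exact: nabt_smooth.
  by move=> q Uq; rewrite E.
move=> /eqP; rewrite addr_eq0 => /eqP ->.
rewrite !(evE (V := frame_dom F) Up) (ev_alE Up) ukE//; by field.
Qed.

Definition sol_mx (p : M) : 'M[C]_3 := 'i *: mx3
  [:: [:: ev (s00 (c F) third_u) p; ev (s01 (c F) third_u) p; ev (s02 third_u) p];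
      [:: ev (s10 (c F) third_u) p; ev (s11 (c F) third_u) p; ev (s12 (c F) third_u) p];
      [:: ev (s20 (c F) third_u) p; ev (s21 (c F) third_u) p; ev (s22 (c F) third_u) p]].

Definition sol_residual (p : M) : C := 'i * ev (residual (c F) third_u) p.

Lemma sol_mx_smooth i j : smooth_on U (fun p => sol_mx p i j).
Proof.
have H f : smooth_on U (fun p => 'i * ev (f : smoothfun (frame_dom F)) p).
  by apply: smooth_on_mul => //; [exact: smooth_on_cst|exact: (@ev_smooth _ _ (frame_dom F))].
have E f : (forall p, sol_mx p i j = 'i * ev (f : smoothfun (frame_dom F)) p) ->
    smooth_on U (fun p => sol_mx p i j).
  by move=> Ef; apply: (eq_smooth_on oU _ (H f)) => p _; rewrite Ef.
move: i j E; apply: ord3P; apply: ord3P => E; (eapply E => p; rewrite !mxE !inordK//=).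
Qed.

Lemma sol_residual_smooth : smooth_on U sol_residual.
Proof.
by apply: smooth_on_mul => //; [exact: smooth_on_cst|exact: (@ev_smooth _ _ (frame_dom F))].
Qed.

Lemma sol_mx_trace p : U p -> \tr (sol_mx p) = 0.
Proof.
move=> Up; have Wp : sval (frame_dom F) p := Up.
rewrite /mxtrace sum3 !mxE !inordK//= -!mulrDr -!(evD Wp).
have -> : s00 (c F) third_u + s11 (c F) third_u + s22 (c F) third_u = 0.
  by rewrite /s00 /s11 /s22; ring.
by rewrite (ev0 Wp) mulr0.
Qed.

Lemma sol_mx_top p : U p -> Zdown F p *m sol_mx p *m Zup R = ('i * u F p)%:M.
Proof.
move=> Up; have Wp : sval (frame_dom F) p := Up.
apply/matrixP => i j; rewrite !ord1 !mxE sum3 !mxE !sum3 !mxE !sum3 !mxE !inordK//=.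
have -> : ev (s02 third_u) p = u F p.
  by rewrite /s02 !(evE Wp) (ev_res Wp); field.
by rewrite conjC0 conjC1; ring.
Qed.

Section Nabla.
Variables (s00 s01 s02 s10 s11 s12 s20 s21 s22 T Q Y r : smoothfun (frame_dom F)).
Let sg := sc (c F).
Let a := al (c F).
Local Notation D1 := (D1 (c F)).
Hypotheses (E00 : D1 0%Z s00 = 3 * (sg * s01) - s02 * T)
  (E01 : D1 1%Z s01 = - (3 * (a * s02)))
  (E02 : D1 0%Z s02 = s01)
  (E10 : D1 (-1)%Z s10 = - (s20 + 3 * (sg * (s00 - s11)) + s12 * T))
  (E11 : D1 0%Z s11 = - (3 * (sg * s01)) - s21 - 3 * (a * s12))
  (E12 : D1 (-1)%Z s12 = s11 - s22 - 3 * (sg * s02))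
  (E20 : D1 0%Z s20 = r + T * s00 + 3 * (a * s10) + 3 * (sg * s21) - T * s22 - s02 * Y)
  (E21 : D1 1%Z s21 = T * s01 + 3 * (a * (s11 - s22)) + s02 * Q)
  (E22 : D1 0%Z s22 = s21 + s02 * T + 3 * (a * s12)).
Hypotheses (TE : forall p, U p -> T1 F p = ev T p) (QE : forall p, U p -> Q11 F p = ev Q p)
  (YE : forall p, U p -> Y1 F p = - 'i * ev Y p).

Let s (p : M) : 'M[C]_3 := 'i *: mx3
  [:: [:: ev s00 p; ev s01 p; ev s02 p]; [:: ev s10 p; ev s11 p; ev s12 p];
      [:: ev s20 p; ev s21 p; ev s22 p]].

(** The entries are arbitrary functions known only through the first-order system. Derivatives of v
    cancel by the Leibniz rule, and so does [conn], which acts on the three slots of a tractor by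
    the same scalar. *)
Lemma nabla1_mx3 : nabla1_end_eq F s
  (fun p => ev s02 p *: kappa10 F p + ('i * ev r p) *: (Zup R *m Zdown F p)).
Proof.
move=> V v oV sV sv p Vp; have Up := sV p Vp; have Wp : sval (frame_dom F) p := Up.
have sva k : smooth_at p (fun q => v q k 0) by exact: smooth_atW oV Vp (sv k).
have sE q k : (s q *m v q) k 0 = s q k (inord 0) * v q (inord 0) 0
    + s q k (inord 1) * v q (inord 1) 0 + s q k (inord 2) * v q (inord 2) 0.
  by rewrite mxE sum3.
have dE (f g h : smoothfun (frame_dom F)) k :
    (forall q, [/\ s q k (inord 0) = 'i * ev f q, s q k (inord 1) = 'i * ev g q
       & s q k (inord 2) = 'i * ev h q]) ->
    val (Z1 F p) (fun q => (s q *m v q) k 0) =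
    'i * (val (Z1 F p) (ev f) * v p (inord 0) 0 + ev f p * val (Z1 F p) (fun q => v q (inord 0) 0)
    + val (Z1 F p) (ev g) * v p (inord 1) 0 + ev g p * val (Z1 F p) (fun q => v q (inord 1) 0)
    + val (Z1 F p) (ev h) * v p (inord 2) 0 + ev h p * val (Z1 F p) (fun q => v q (inord 2) 0)).
  move=> E.
  have -> : (fun q => (s q *m v q) k 0) = (fun q => 'i * (ev f q * v q (inord 0) 0
      + ev g q * v q (inord 1) 0 + ev h q * v q (inord 2) 0)).
    by apply/funext => q; rewrite sE; have [-> -> ->] := E q; ring.
  have se := @ev_smooth_at _ _ (frame_dom F) p Wp.
  have sm f' k' : smooth_at p (fun q => ev f' q * v q k' 0) := smooth_at_mul (se f') (sva k').
  rewrite ct_mul; [|exact: smooth_at_cst|exact: (smooth_at_add (smooth_at_add (sm f _) (sm g _)) (sm h _))].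
  rewrite ct_cst mul0r add0r (ct_add _ (smooth_at_add (sm f _) (sm g _)) (sm h _)).
  by rewrite (ct_add _ (sm f _) (sm g _)) !(ct_mul _ (se _) (sva _)); ring.
pose W (f : smoothfun (frame_dom F)) := val (Z1 F p) (ev f : M -> C).
have evD1 k f g : D1 k f = g -> W f = ev g p + k%:~R * omZ F p * ev f p.
  by move=> <-; rewrite /W D1_def !(evE Wp) (ev_dZ _ Wp) (ev_wZ _ Wp); ring.
have sSE := ev_scE Up; have sAE := ev_alE Up.
have e00 := evD1 _ _ _ E00; have e01 := evD1 _ _ _ E01; have e02 := evD1 _ _ _ E02.
have e10 := evD1 _ _ _ E10; have e11 := evD1 _ _ _ E11; have e12 := evD1 _ _ _ E12.
have e20 := evD1 _ _ _ E20; have e21 := evD1 _ _ _ E21; have e22 := evD1 _ _ _ E22.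
rewrite !(evE Wp) sSE sAE in e00 e01 e02 e10 e11 e12 e20 e21 e22.
have ZZ : Zup R *m Zdown F p = mx3 [:: [:: 0; 0; 0]; [:: 0; 0; 0]; [:: 1; 0; 0]].
  by apply/matrixP; apply: ord3P; apply: ord3P;
    rewrite !mxE big_ord1 !mxE sum3 !mxE !inordK//= conjC0 conjC1; ring.
have N0 w : nabla1 F w p (inord 0) 0 = nab F 0 0 1 (Z1 F) (fun q => w q (inord 0) 0) p.
  by rewrite mxE inordK.
have N1 w : nabla1 F w p (inord 1) 0 = nab F (-1) (-1) 0 (Z1 F) (fun q => w q (inord 1) 0) p
    + w p (inord 2) 0 + Rs F p / 4%:R * w p (inord 0) 0.
  by rewrite mxE inordK.
have N2 w : nabla1 F w p (inord 2) 0 = nab F 0 (-1) 0 (Z1 F) (fun q => w q (inord 2) 0) p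
    - 'i * A11 F p * w p (inord 1) 0 - w p (inord 0) 0 * T1 F p.
  by rewrite mxE inordK.
have i2 : ('i : C) * 'i = -1 by rewrite -expr2 sqrCi.
have D0E := dE s00 s01 s02 (inord 0); have D1E := dE s10 s11 s12 (inord 1).
have D2E := dE s20 s21 s22 (inord 2).
rewrite ZZ; apply/matrixP => k j; rewrite (ord1 j) {j}.
have sp i j : s p i j = 'i * nth 0 (nth [::] [:: [:: ev s00 p; ev s01 p; ev s02 p];
  [:: ev s10 p; ev s11 p; ev s12 p]; [:: ev s20 p; ev s21 p; ev s22 p]] i) j.
  by rewrite !mxE.
have -> : (nabla1 F (fun q => s q *m v q) p - s p *m nabla1 F v p) k 0 =
    nabla1 F (fun q => s q *m v q) p k 0 - (s p k (inord 0) * nabla1 F v p (inord 0) 0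
    + s p k (inord 1) * nabla1 F v p (inord 1) 0 + s p k (inord 2) * nabla1 F v p (inord 2) 0).
  by rewrite mxE [X in _ + X]mxE [X in _ - X]mxE sum3.
have tE i j : (ev s02 p *: kappa10 F p + ('i * ev r p) *: mx3
    [:: [:: 0; 0; 0]; [:: 0; 0; 0]; [:: 1; 0; 0]]) i j =
    ev s02 p * nth 0 (nth [::] [:: [:: 0; 0; 0]; [:: 0; 0; 0]; [:: Y1 F p; 'i * Q11 F p; 0]] i) j
    + 'i * ev r p * nth 0 (nth [::] [:: [:: 0; 0; 0]; [:: 0; 0; 0]; [:: 1; 0; 0]] i) j.
  by rewrite !mxE.
rewrite [RHS]mxE sum3 !tE !sp.
move: k; apply: ord3P.
(* Once the system has replaced the derivatives of the entries, the row is an identity linear in v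
   and its derivatives, to be checked modulo i^2 = -1. *)
- rewrite !N0 !N1 !N2 !nabE// /nabt D0E; last by move=> q; rewrite !mxE !inordK.
  rewrite -/(W s00) -/(W s01) -/(W s02) e00 e01 e02 !sE !sp !inordK//= ?TE// ?QE// ?YE//.
  by field: i2.
- rewrite !N0 !N1 !N2 !nabE// /nabt D1E; last by move=> q; rewrite !mxE !inordK.
  rewrite -/(W s10) -/(W s11) -/(W s12) e10 e11 e12 !sE !sp !inordK//= ?TE// ?QE// ?YE//.
  by field: i2.
- rewrite !N0 !N1 !N2 !nabE// /nabt D2E; last by move=> q; rewrite !mxE !inordK.
  rewrite -/(W s20) -/(W s21) -/(W s22) e20 e21 e22 !sE !sp !inordK//= ?TE// ?QE// ?YE//.
  by field: i2.
Qed.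
End Nabla.

Lemma ev_s02_third_u p : U p -> ev (s02 third_u) p = u F p.
Proof.
by move=> Up; rewrite /s02 !(evE (V := frame_dom F) Up) (ev_res (V := frame_dom F) Up); field.
Qed.

Lemma sol_mx_nabla : nabla1_end_eq F sol_mx
  (fun p => u F p *: kappa10 F p + sol_residual p *: (Zup R *m Zdown F p)).
Proof.
have E20 : D1 (c F) 0%Z (s20 (c F) third_u) = residual (c F) third_u + tracT1 (c F) * s00 (c F) third_u
    + 3 * (al (c F) * s10 (c F) third_u) + 3 * (sc (c F) * s21 (c F) third_u)
    - tracT1 (c F) * s22 (c F) third_u - s02 third_u * Du (c F) 2%Z (cartanQ (c F)).
  by rewrite /residual; ring.
move=> V v oV sV sv p Vp; rewrite -(ev_s02_third_u (sV p Vp)).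
apply: (nabla1_mx3 (D1_s00 third_u_eqn) (D1_s01 third_u_eqn) (D1_s02 _ _) (D1_s10 _ _) (D1_s11 third_u_eqn)
  (D1_s12 _ _) E20 (D1_s21 third_u_eqn) (D1_s22 _ _) _ _ _ oV sV sv Vp) => q Uq.
- by rewrite ev_T1.
- by rewrite ev_Q.
- by rewrite ev_Y.
Qed.
End OneFrame.

Section TwoFrames.
Variables (F F' : frame L) (q : M).
Hypotheses (Fq : dm F q) (Fq' : dm F' q).
Local Notation V := (overlap F F').
Let sF : sval V `<=` dm F. Proof. by move=> r []. Qed.
Let sF' : sval V `<=` dm F'. Proof. by move=> r []. Qed.
Let Vq : sval V q := conj Fq Fq'.
(** The inclusion is composed by [subset_trans] so that this is literally the calculus onto which
    the restriction lemmas map. *)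
Let cV : calculus (smoothfun V) := 
  @frame_calculus _ _ _ _ F V (@subset_trans _ (sval (frame_dom F)) _ _ sF (@subset_refl _ (dm F))).
Let cV' : calculus (smoothfun V) := 
  @frame_calculus _ _ _ _ F' V (@subset_trans _ (sval (frame_dom F')) _ _ sF' (@subset_refl _ (dm F'))).
Let r : rescaling cV cV' := @frame_rescaling _ _ _ _ F F' _ _.
Let uV : smoothfun V := restr (W := frame_dom F) sF (third_u F).
Let uV' : smoothfun V := restr (W := frame_dom F') sF' (third_u F').

(** [ed] does not vanish because its cube pairs to 1 with zeta. The factor la is needed at every
    point of the overlap, since the law for u is used there as an identity of functions to be
    differentiated. *)
Lemma ed_change p : dm F p -> dm F' p -> exists la : C, ed F' p = la *: ed F p.
Proof.
move=> Fp Fp'; have [x x0 sp] := E10_line L p.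
have [a aE] := sp (ed F p); have [b bE] := sp (ed F' p).
have a0 : a != 0.
  apply/eqP => a0; have := zeta_ed Fp; rewrite aE a0.
  rewrite cube_hom ?expr0n ?mul0r; first by move/eqP; rewrite eq_sym oner_eq0.
  exact: zeta_canonical.
by exists (b / a); rewrite aE bE scalerA divfK.
Qed.

(** A component of weight (1,1) scales by |la|^{-2}, and this is e^Upsilon by [change_te_la]. *)
Let uVE : uV' = te r * uV.
Proof.
apply: ev_inj => p [Fp Fp'].
have Vp : sval V p by [].
have [la laE] := ed_change Fp Fp'.
rewrite (evM Vp) !ev_restr// (ev_res Vp).
rewrite (ev_res (V := frame_dom F') Fp') (ev_res (V := frame_dom F) Fp).
have [_ law] := du.
rewrite (law F F' p _ la Fp Fp' (Z1_change Vp) laE) (change_te_la Fp Fp' laE).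
by rewrite expr0z mul1r -/(la ^- 1) !exprN1 -invfM mulrA.
Qed.

Let eqV : D1 cV 1%Z (D1 cV 0%Z uV) = - (3 * (al cV * uV)).
Proof.
rewrite /uV /cV -!restr_D1 [D1 _ _ (D1 _ _ _)]third_u_eqn -restr_al; apply: ev_inj => p Vp.
have Wp : sval (frame_dom F) p by exact: sF.
by rewrite ev_restr// !(evE Vp, evE Wp) !ev_restr.
Qed.

Local Notation c00 G := (ev (s00 (c G) (third_u G)) q).
Local Notation c01 G := (ev (s01 (c G) (third_u G)) q).
Local Notation c02 G := (ev (s02 (third_u G)) q).
Local Notation c10 G := (ev (s10 (c G) (third_u G)) q).
Local Notation c11 G := (ev (s11 (c G) (third_u G)) q).
Local Notation c12 G := (ev (s12 (c G) (third_u G)) q).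
Local Notation c20 G := (ev (s20 (c G) (third_u G)) q).
Local Notation c21 G := (ev (s21 (c G) (third_u G)) q).
Local Notation c22 G := (ev (s22 (c G) (third_u G)) q).
Let X : C := ev (rx r) q.
Let Y : C := ev (ry r) q.
Let W : C := ev (rw r) q.
Let n0 : C := change_nu F F' q.
Let t0 : C := change_ta F F' q.
Let e0 : C := change_te F F' q.
Let N : C := - (18 * (X * Y) + 3 * W).
Let P : C := 3 * W - 18 * (X * Y).

Let res00 : ev (s00 cV uV) q = c00 F. Proof. by rewrite /uV /cV -restr_s00 ev_restr. Qed.
Let res01 : ev (s01 cV uV) q = c01 F. Proof. by rewrite /uV /cV -restr_s01 ev_restr. Qed.
Let res02 : ev (s02 uV) q = c02 F. Proof. by rewrite /uV -restr_s02 ev_restr. Qed.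
Let res10 : ev (s10 cV uV) q = c10 F. Proof. by rewrite /uV /cV -restr_s10 ev_restr. Qed.
Let res11 : ev (s11 cV uV) q = c11 F. Proof. by rewrite /uV /cV -restr_s11 ev_restr. Qed.
Let res12 : ev (s12 cV uV) q = c12 F. Proof. by rewrite /uV /cV -restr_s12 ev_restr. Qed.
Let res20 : ev (s20 cV uV) q = c20 F. Proof. by rewrite /uV /cV -restr_s20 ev_restr. Qed.
Let res21 : ev (s21 cV uV) q = c21 F. Proof. by rewrite /uV /cV -restr_s21 ev_restr. Qed.
Let res22 : ev (s22 cV uV) q = c22 F. Proof. by rewrite /uV /cV -restr_s22 ev_restr. Qed.

Let enu : ev (nu r) q = n0 := ev_nu _ _ Vq.
Let env : ev (nv r) q = n0^-1 := ev_nv _ _ Vq.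
Let eta : ev (ta r) q = t0 := ev_ta _ _ Vq.
Let ete : ev (te r) q = e0 := ev_te _ _ Vq.

Ltac ev_step := match goal with
  | |- context [ev (?f + ?g) q] => rewrite (evD Vq f g)
  | |- context [ev (- ?f) q] => rewrite (evN Vq f)
  | |- context [ev (?f * ?g) q] => rewrite (evM Vq f g)
  | |- context [ev (?n%:R) q] => rewrite (ev_nat Vq n)
  | |- context [ev 1 q] => rewrite (ev1 Vq)
  end.

Ltac evs := rewrite /N /P /X /Y /W; move: (rx r) (ry r) (rw r) => ? ? ?;
  repeat ev_step; rewrite ?enu ?env ?eta ?ete; ring.

Let change02 : c02 F' = e0 * c02 F.
Proof.
have -> : c02 F' = ev (s02 uV') q by rewrite /uV' -restr_s02 ev_restr.
rewrite (s02_wpow uVE) -res02 /wpow /zpow !expr0 !expr1.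
by move: (s02 uV) => f; evs.
Qed.

Let change01 : c01 F' = n0 * e0 * (c01 F + 6 * (X * c02 F)).
Proof.
have -> : c01 F' = ev (s01 cV' uV') q by rewrite /uV' /cV' -restr_s01 ev_restr.
rewrite (s01_wpow uVE) -res01 -res02 /wpow /zpow !expr1 /hat01.
by move: (s01 cV uV) (s02 uV) => f g; evs.
Qed.

Let change12 : c12 F' = n0^-1 * (6 * (Y * c02 F) + c12 F).
Proof.
have -> : c12 F' = ev (s12 cV' uV') q by rewrite /uV' /cV' -restr_s12 ev_restr.
rewrite (s12_wpow uVE) -res12 -res02 /wpow /zpow !expr1 !expr0 /hat12.
by move: (s12 cV uV) (s02 uV) => f g; evs.
Qed.

Let change00 : c00 F' = c00 F - 6 * (Y * c01 F) + P * c02 F.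
Proof.
have -> : c00 F' = ev (s00 cV' uV') q by rewrite /uV' /cV' -restr_s00 ev_restr.
rewrite (s00_wpow uVE) -res00 -res01 -res02 /wpow /zpow !expr0 /hat00.
by move: (s00 cV uV) (s01 cV uV) (s02 uV) => f g h; evs.
Qed.

Let change11 : c11 F' = 6 * (Y * c01 F) + c11 F + 6 * (X * (6 * (Y * c02 F) + c12 F)).
Proof.
have -> : c11 F' = ev (s11 cV' uV') q by rewrite /uV' /cV' -restr_s11 ev_restr.
rewrite (s11_wpow uVE) -res11 -res01 -res12 -res02 /wpow /zpow !expr0 /hat11.
by move: (s11 cV uV) (s01 cV uV) (s12 cV uV) (s02 uV) => f g h k; evs.
Qed.

Let change22 : c22 F' = N * c02 F - 6 * (X * c12 F) + c22 F.
Proof.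
have -> : c22 F' = ev (s22 cV' uV') q by rewrite /uV' /cV' -restr_s22 ev_restr.
rewrite (s22_wpow uVE) -res22 -res12 -res02 /wpow /zpow !expr0 /hat22.
by move: (s22 cV uV) (s12 cV uV) (s02 uV) => f g h; evs.
Qed.

Let change10 : c10 F' = n0^-1 * t0 * (6 * (Y * c00 F) + c10 F
  - 6 * (Y * (6 * (Y * c01 F) + c11 F)) + P * (6 * (Y * c02 F) + c12 F)).
Proof.
have -> : c10 F' = ev (s10 cV' uV') q by rewrite /uV' /cV' -restr_s10 ev_restr.
rewrite (s10_wpow uVE) -res00 -res10 -res01 -res11 -res02 -res12 /wpow /zpow !expr1 /hat10.
move: (s00 cV uV) (s10 cV uV) (s01 cV uV) (s11 cV uV) (s02 uV) (s12 cV uV) => f g h k l m.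
by evs.
Qed.

Let change21 : c21 F' = n0 * (N * c01 F - 6 * (X * c11 F) + c21 F
  + 6 * (X * (N * c02 F - 6 * (X * c12 F) + c22 F))).
Proof.
have -> : c21 F' = ev (s21 cV' uV') q by rewrite /uV' /cV' -restr_s21 ev_restr.
rewrite (s21_wpow uVE) -res01 -res11 -res21 -res02 -res12 -res22 /wpow /zpow !expr1 !expr0 /hat21.
move: (s01 cV uV) (s11 cV uV) (s21 cV uV) (s02 uV) (s12 cV uV) (s22 cV uV) => f g h k l m.
by evs.
Qed.

Let change20 : c20 F' = t0 * (N * c00 F - 6 * (X * c10 F) + c20 F
  - 6 * (Y * (N * c01 F - 6 * (X * c11 F) + c21 F))
  + P * (N * c02 F - 6 * (X * c12 F) + c22 F)).
Proof.
have -> : c20 F' = ev (s20 cV' uV') q by rewrite /uV' /cV' -restr_s20 ev_restr.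
rewrite (s20_wpow uVE eqV) -res00 -res10 -res20 -res01 -res11 -res21 -res02 -res12 -res22.
rewrite /wpow /zpow !expr1 !expr0 /hat20.
move: (s00 cV uV) (s10 cV uV) (s20 cV uV) (s01 cV uV) (s11 cV uV) (s21 cV uV) (s02 uV)
  (s12 cV uV) (s22 cV uV) => f0 f1 f2 f g h k l m.
by evs.
Qed.

Lemma sol_residual_change : sol_residual F' q = n0 * t0 * sol_residual F q.
Proof.
have E : ev (residual (c F') (third_u F')) q = n0 * t0 * ev (residual (c F) (third_u F)) q.
  have -> : ev (residual (c F') (third_u F')) q = ev (residual cV' uV') q.
    by rewrite /uV' /cV' -restr_residual ev_restr.
  have <- : ev (residual cV uV) q = ev (residual (c F) (third_u F)) q.
    by rewrite /uV /cV -restr_residual ev_restr.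
  rewrite (residual_wpow uVE eqV) /wpow /zpow !expr1.
  by move: (residual cV uV) => f; evs.
by rewrite /sol_residual E mulrCA.
Qed.

Lemma sol_mx_change la : ed F' q = la *: ed F q ->
  sol_mx F' q *m tractor_change F F' n0 la q = tractor_change F F' n0 la q *m sol_mx F q.
Proof.
move=> laE.
have tE : t0 = la * la^* by exact: change_ta_la.
have eE : e0 = (la * la^*)^-1 by exact: change_te_la.
have te1 : t0 * e0 = 1 by exact: change_ta_te.
have la0 : la * la^* != 0 by apply: contra_eq_neq te1 => l0; rewrite tE l0 mul0r eq_sym oner_neq0.
have l0 : la != 0 by apply: contraNneq la0 => ->; rewrite mul0r.
have lc0 : la^* != 0 by rewrite conjC_eq0.
have nn0 : n0 != 0 by exact: change_nu_neq0.
have e0V : e0^-1 = t0 by rewrite eE tE invrK.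
have UE Z : Ups F F' Z q = e0^-1 * val (Z q) (change_te F F') by [].
(* 6 X, 6 Y and 6 W are the derivatives of Upsilon along Z_1, h^{-1} Z_{bar 1} and - i T, so
   [tractor_change] takes the form of D N in [tractor_conj]. *)
have U1 : Ups F F' (Z1 F) q = 6 * X.
  by rewrite UE e0V /X ev_rx//; field.
have Uu : (h F q)^-1 * Ups F F' (Z1b F) q = 6 * Y.
  by rewrite UE e0V /Y ev_ry// /Yf /fscale valZ; field; exact: h_neq0.
have U0 : 'i * Ups F F' (Tf F) q = - (6 * W).
  by rewrite UE e0V /W ev_rw// /Tt /fscale valZ; field.
rewrite /tractor_change /sol_mx U1 Uu U0.
rewrite change00 change01 change02 change10 change11 change12 change20 change21 change22.
rewrite eE tE /N /P -scalemxAl -scalemxAr; congr (_ *: _).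
move: (la^*) lc0 => lc lc0; exact: tractor_conj.
Qed.
End TwoFrames.

Lemma change_nu_unique (F F' : frame L) p (nu : C) : dm F p -> dm F' p ->
  Z1 F' p = nu *: Z1 F p -> nu = change_nu F F' p.
Proof.
move=> Fp Fp' E; rewrite /change_nu /contract E linearZ /= th1_Z1//.
by rewrite /GRing.scale /= mulr1.
Qed.

Lemma sol_mx_section : end_section sol_mx.
Proof.
split=> [F i j|F F' p nu la Fp Fp' ZE laE]; first exact: sol_mx_smooth.
by rewrite (change_nu_unique Fp Fp' ZE); exact: sol_mx_change.
Qed.

Lemma sol_residual_density : density 1 (-1) (-1) sol_residual.
Proof.
split=> [F|F F' p nu la Fp Fp' ZE laE]; first exact: sol_residual_smooth.
rewrite (sol_residual_change Fp Fp') (change_nu_unique Fp Fp' ZE) (change_ta_la Fp Fp' laE).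
by rewrite opprK !expr1z !mulrA.
Qed.
End Solution.

Theorem proposition4p2 (R : realType) (M : oriented_manifold3 R)
    (S : CRstructure M) (L : cube_root S) (u : frame L -> M -> R[i]) :
  density 0 1 1 u ->
  (forall (F : frame L) p, dm F p ->
     nab F 1 1 1 (Z1 F) (nab F 0 1 1 (Z1 F) (u F)) p
     + 'i * A11 F p * u F p = 0) ->
  exists s : frame L -> M -> 'M[R[i]]_3,
    [/\ end_section s,
        (forall (F : frame L) p, dm F p -> \tr (s F p) = 0),
        (forall (F : frame L) p, dm F p ->
           Zdown F p *m s F p *m Zup R = ('i * u F p)%:M) &
        exists2 r : frame L -> M -> R[i], density 1 (-1) (-1) r &
          forall F : frame L,
            nabla1_end_eq F (s F)
              (fun p => u F p *: kappa10 F p + r F p *: (Zup R *m Zdown F p))].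
Proof.
move=> du equ; exists (sol_mx du); split.
- exact: sol_mx_section.
- by move=> F p; exact: sol_mx_trace.
- by move=> F p; exact: sol_mx_top.
- by exists (sol_residual du); [exact: sol_residual_density|move=> F; exact: sol_mx_nabla].
Qed.
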